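(* Let $\theta=\mathbb P(\varphi(\boldsymbol\omega)>c)$ with $\varphi(\boldsymbol\omega)=\mathbb E[X\mid\boldsymbol\omega]$, and let $\hat Q$ and $\bar Q$ be the multilevel Monte Carlo (MLMC) estimators of $\theta$ with exact preintegration and with numerical preintegration, respectively, defined in the context. Assume: (A) For each $m\ge1$ the joint density $p_m(x,y)$ of $\varphi(\boldsymbol\omega)$ and $m^{1/2}[\hat\varphi_m(\boldsymbol\omega)-\varphi(\boldsymbol\omega)]$ and its partial derivatives $\frac{\partial}{\partial x}p_m(x,y)$, $\frac{\partial^2}{\partial x^2}p_m(x,y)$ exist for all $(x,y)$; and for each $m\ge1$ there exist functions $f_{i,m}(\cdot)$ such that $\left|\frac{\partial^i}{\partial x^i}p_m(x,y)\right|\le f_{i,m}(y)$ for $i=0,1,2$, with $\sup_{m\ge1}\int|y|^rf_{i,m}(y)\,dy<\infty$ for $i=0,1,2$ and $0\le r\le4$. (B) $\varphi(\omega_1,\boldsymbol\omega_{-1})=\mathcal O(1)$, $\partial_{\omega_1}\varphi(\omega_1,\boldsymbol\omega_{-1})=\mathcal O(1)$ and $\partial^2_{\omega_1}\varphi(\omega_1,\boldsymbol\omega_{-1})=\mathcal O(1)$. (C) $\left(\partial_{\omega_1}\hat\varphi_\ell(\omega_1,\boldsymbol\omega_{-1})\right)^{-1}=\mathcal O(1)$. (D) The function $\rho_1'/\rho_1$ exists and $\int_{\mathbb R}\left(1+\left|\rho_1'(y)/\rho_1(y)\right|\right)^p\rho_1(y)\,dy<\infty$ for every $p\ge1$. Here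 $\mathcal O(1)$ is meant in the sense defined in the context. Then, for any $0<\mathrm{TOL}<1$, the complexity (total computational cost needed to achieve root mean square error $\mathrm{TOL}$, for suitable choices of the method's parameters) of MLMC with numerical preintegration is $$O\left(\mathrm{TOL}^{-2-2/s}(\log(\mathrm{TOL}))^2\right),$$ where $s>0$ is the quadrature convergence exponent defined in the context. Moreover, the complexity of MLMC with (exact) preintegration is $$O\left(\mathrm{TOL}^{-2}(\log(\mathrm{TOL}))^2\right).$$
   Context: Setting. $X$ is a one-dimensional random variable, $\boldsymbol\omega=(\omega_1,\boldsymbol\omega_{-1})$ is a $d$-dimensional random vector, $c\in\mathbb R$ is a constant, $\varphi(\boldsymbol y):=\mathbb E[X\mid\boldsymbol\omega=\boldsymbol y]$, $g(\cdot):=\mathbb I\{\cdot>c\}$, so $\theta=\mathbb E[g(\varphi(\boldsymbol\omega))]$. The coordinate $\omega_1$ is independent of $\boldsymbol\omega_{-1}$ and has probability density $\rho_1$ on $\mathbb R$. Inner simulation. $X_j(\boldsymbol y)$, $j\ge1$, are i.i.d. replications of $X$ given $\boldsymbol\omega=\boldsymbol y$ (viewed as random functions of $\boldsymbol y$). For $m\ge1$, $$\hat\varphi_m(\boldsymbol y)=\frac1m\sum_{j=1}^mX_j(\boldsymbol y),\quad \hat g_m(\boldsymbol y)=\mathbb I\{\hat\varphi_m(\boldsymbol y)>c\},\quad \hat h_m(\boldsymbol\omega_{-1})=\int_{\mathbb R}\hat g_m(\omega_1,\boldsymbol\omega_{-1})\rho_1(\omega_1)\,d\omega_1 .$$ Levels.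 $m_\ell=2^{\ell+\ell_0}$ with a fixed integer $\ell_0\ge0$; the subscript $m_\ell$ is abbreviated to $\ell$ (e.g. $\hat\varphi_\ell=\hat\varphi_{m_\ell}$, $\hat h_\ell=\hat h_{m_\ell}$). MLMC with exact preintegration. $\hat Y_0=\hat h_0$, $\hat Y_\ell=\hat h_\ell-\hat h_{\ell-1}$ for $\ell\ge1$, and $\hat Q=\sum_{\ell=0}^L\frac1{N_\ell}\sum_{i=1}^{N_\ell}\hat Y_\ell^{(i)}$, where $\hat Y_\ell^{(1)},\dots,\hat Y_\ell^{(N_\ell)}$ are i.i.d. replications of $\hat Y_\ell$, independent across levels. The cost per sample at level $\ell$ is proportional to $m_\ell$, so the total cost is proportional to $\sum_{\ell=0}^LN_\ell m_\ell$; the parameters are $L$ and $N_0,\dots,N_L$. Numerical preintegration. It is assumed that for fixed $\boldsymbol x_{-1}$ the function $x_1\mapsto\varphi(x_1,\boldsymbol x_{-1})-c$ either has a simple root or is positive for all $x_1\in\mathbb R$ (as guaranteed by a monotonicity condition $\partial\varphi/\partial x_1>0$ together with the growth condition that $\varphi(x_1,\boldsymbol x_{-1})\to+\infty$ as $x_1\to+\infty$ or $\partial^2\varphi/\partial x_1^2\ge0$). The root $y_1^*=y_1^*(\boldsymbol\omega_{-1})$ is approximated by $\bar y_1^*$ using Newton iteration with tolerance $\mathrm{TOL}_{\mathrm{Newton}}$, and $\hat h_m$ is approximated by $$\bar h_m(\boldsymbol\omega_{-1})=\sum_{k=0}^{M_{\mathrm{Lag}}}\eta_k\,\hat g_m(\zeta_k(\bar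 y_1^* ),\boldsymbol\omega_{-1}),$$ where $\zeta_k$ (with $\zeta_0=\bar y_1^*$) and $\eta_k$ are the points and weights of a two-sided Laguerre quadrature rule split at $\bar y_1^*$; $M_{\mathrm{Lag}}$ is the number of quadrature points. At level $\ell$ the parameters are $M_{\mathrm{Lag},\ell}$ and $\mathrm{TOL}_{\mathrm{Newton},\ell}$, taken equal on all levels: $M_{\mathrm{Lag},\ell}=M_{\mathrm{Lag},L}$, $\mathrm{TOL}_{\mathrm{Newton},\ell}=\mathrm{TOL}_{\mathrm{Newton},L}$ for $0\le\ell\le L$. MLMC with numerical preintegration. $\bar Y_0=\bar h_0$, $\bar Y_\ell=\bar h_\ell-\bar h_{\ell-1}$ for $\ell\ge1$, and $\bar Q=\sum_{\ell=0}^L\frac1{N_\ell}\sum_{i=1}^{N_\ell}\bar Y_\ell^{(i)}$, where $\bar Y_\ell^{(1)},\dots,\bar Y_\ell^{(N_\ell)}$ are i.i.d. replications of $\bar Y_\ell$, independent across levels, and $\bar Y_\ell^{(i)}$ uses the same random samples as $\hat Y_\ell^{(i)}$. The number $s>0$ (related to the regularity of the integrand in the variable $\omega_1$) is the exponent for which the numerical preintegration error satisfies $$\mathbb E\left[(\hat Q-\bar Q)^2\right]=O(M_{\mathrm{Lag},L}^{-s})+O(\mathrm{TOL}_{\mathrm{Newton},L}^2).$$ The Newton iteration has second-order convergence and the number of Newton iterations at level $\ell$ is proportional to $\log(\mathrm{TOL}_{\mathrm{Newton},\ell}^{-1})$. The cost per sample at level $\ell$ is $C_\ell\propto m_\ell\left(M_{\mathrm{Lag},\ell}+\log(\mathrm{TOL}_{\mathrm{Newton},\ell}^{-1})\right)$,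 and the total cost is $\sum_{\ell=0}^LN_\ell C_\ell$; the parameters are $L$, $\{N_\ell\}$, $\{M_{\mathrm{Lag},\ell}\}$, $\{\mathrm{TOL}_{\mathrm{Newton},\ell}\}$. Complexity. The complexity of a method is the total cost required, over suitable choices of its parameters, to make the mean square error $\mathbb E[(\bar Q-\theta)^2]$ (respectively $\mathbb E[(\hat Q-\theta)^2]$) at most $\mathrm{TOL}^2$. Notation $\mathcal O(1)$. For a sequence of random variables $F_N$, $F_N=\mathcal O(1)$ means that there exists a random variable $C$ with finite moments of all orders such that for all $N$, $|F_N|\le C$ almost surely. The ordinary $O(\cdot)$ is the usual deterministic Landau symbol. *)

(* Defs.v *)
From HB Require Import structures.
From mathcomp Require Import all_boot all_order all_algebra.
From mathcomp Require Import all_classical all_reals all_analysis.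

Set Implicit Arguments.
Unset Strict Implicit.
Unset Printing Implicit Defensive.

Import Order.TTheory GRing.Theory Num.Theory.
Import numFieldNormedType.Exports.

Local Open Scope classical_set_scope.
Local Open Scope ring_scope.

Definition rv_events dT dT' (T : measurableType dT) (T' : measurableType dT')
    (f : T -> T') : set_system T :=
  preimage_set_system [set: T] f measurable.

Definition mutually_independent (R : realType) dT (T : measurableType dT)
    (P : probability T R) (I : eqType) (F : I -> set_system T) : Prop :=
  forall (J : seq I) (A : I -> set T), uniq J ->
    (forall i, i \in J -> F i (A i)) ->
    P (\bigcap_(i in [set` J]) A i) = (\prod_(i <- J) fine (P (A i)))%:E.

Definition same_law (R : realType) dT dT' (T : measurableType dT)
    (T' : measurableType dT') (P : probability T R) (X Y : {RV P >-> T'}) :=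
  forall A, measurable A -> distribution P X A = distribution P Y A.

(* [phi] is a version of the regression function y |-> E[X | omega = y]. *)
Definition is_regression (R : realType) dT dT' (T : measurableType dT)
    (T' : measurableType dT') (P : probability T R)
    (omega : T -> T') (X : T -> R) (phi : T' -> R) : Prop :=
  [/\ measurable_fun setT phi,
      P.-integrable setT (EFin \o X),
      P.-integrable setT (EFin \o (phi \o omega)) &
      forall A, measurable A ->
        (\int[P]_(t in omega @^-1` A) (phi (omega t))%:E =
         \int[P]_(t in omega @^-1` A) (X t)%:E)%E].

(* The stochastic O(1): a family indexed by [I] is dominated almost surely by
   one random variable with finite moments of all orders. *)
Definition stochO1 (R : realType) dT (T : measurableType dT)
    (P : probability T R) (I : Type) (F : I -> T -> R) : Prop :=
  exists C : {RV P >-> R},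
    (forall k : nat, P.-integrable setT (EFin \o (fun t => `|C t| ^+ k))) /\
    (forall i, {ae P, forall t, `|F i t| <= C t}).

(* The inner randomness is carried by noise variables [noise j] with values in
   [E]: the random function X_{j+1} is y |-> sim y (noise j).
   [omegam_rep l i] and [noise_rep l i j] are the inputs of the i-th
   replication at level l; the exact and the numerically preintegrated
   estimators both read them. *)
Record setting (R : realType) (d : nat) (dT dE : measure_display)
    (T : measurableType dT) (P : probability T R) (E : measurableType dE) :=
  Setting {
    thr : R;
    lev0 : nat;
    omega1 : {RV P >-> R};
    omegam : {RV P >-> d.-1.-tuple R};
    outX : {RV P >-> R};
    phi : R * d.-1.-tuple R -> R;
    rho1 : R -> R;
    sim : R * d.-1.-tuple R -> E -> R;
    noise : nat -> {RV P >-> E};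
    omegam_rep : nat -> nat -> {RV P >-> d.-1.-tuple R};
    noise_rep : nat -> nat -> nat -> {RV P >-> E} }.

Section Estimators.
Context (R : realType) (d : nat) (dT dE : measure_display)
  (T : measurableType dT) (P : probability T R) (E : measurableType dE).
Variable S : setting d P E.

Definition omega (t : T) : R * d.-1.-tuple R := (omega1 S t, omegam S t).

Definition noise_seq (t : T) : nat -> E := fun j => noise S j t.

Definition theta : R := fine (P [set t | thr S < phi S (omega t)]).

Definition phihat (m : nat) (y : R * d.-1.-tuple R) (e : nat -> E) : R :=
  m%:R^-1 * \sum_(j < m) sim S y (e j).

Definition ghat (m : nat) (y : R * d.-1.-tuple R) (e : nat -> E) : R :=
  if thr S < phihat m y e then 1 else 0.

Definition hhat (m : nat) (w : d.-1.-tuple R) (e : nat -> E) : R :=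
  \int[lebesgue_measure]_u (ghat m (u, w) e * rho1 S u).

Definition mlev (l : nat) : nat := 2 ^ (l + lev0 S).

Definition level_diff (h : nat -> d.-1.-tuple R -> (nat -> E) -> R)
    (l : nat) (w : d.-1.-tuple R) (e : nat -> E) : R :=
  if l is l'.+1 then h (mlev l) w e - h (mlev l') w e else h (mlev 0) w e.

Definition mlmc (h : nat -> d.-1.-tuple R -> (nat -> E) -> R)
    (L : nat) (N : nat -> nat) (t : T) : R :=
  \sum_(l < L.+1) (N l)%:R^-1 *
    \sum_(i < N l)
      level_diff h l (omegam_rep S l i t) (fun j => noise_rep S l i j t).

Definition Qhat (L : nat) (N : nat -> nat) : T -> R := mlmc hhat L N.

Record standing : Prop := Standing {
  omega1_indep_omegam :
    mutually_independent P (fun b : bool =>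
      if b then rv_events (omega1 S) else rv_events (omegam S));
  rho1_measurable : measurable_fun setT (rho1 S);
  rho1_ge0 : forall u, 0 <= rho1 S u;
  rho1_density : forall A, measurable A ->
    distribution P (omega1 S) A = (\int[lebesgue_measure]_(u in A) (rho1 S u)%:E)%E;
  phi_regression : is_regression P omega (outX S) (phi S);
  sim_measurable : measurable_fun setT
    (fun z : (R * d.-1.-tuple R) * E => sim S z.1 z.2);
  noise_indep : mutually_independent P (fun k : option nat =>
    if k is Some j then rv_events (noise S j) else rv_events omega);
  noise_law : forall j, same_law (noise S j) (noise S 0);
  (* the law of sim y (noise j) is the conditional law of X given omega = y *)
  sim_conditional_law : forall (A : set (R * d.-1.-tuple R)) (B : set R),
    measurable A -> measurable B ->
    P ((omega @^-1` A) `&` (outX S @^-1` B)) =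
    (\int[P]_(t in omega @^-1` A)
       distribution P (noise S 0%N) [set e | B (sim S (omega t) e)])%E;
  rep_indep : mutually_independent P (fun k : (nat * nat) * option nat =>
    if k.2 is Some j then rv_events (noise_rep S k.1.1 k.1.2 j)
    else rv_events (omegam_rep S k.1.1 k.1.2));
  omegam_rep_law : forall l i, same_law (omegam_rep S l i) (omegam S);
  noise_rep_law : forall l i j, same_law (noise_rep S l i j) (noise S 0) }.

Definition scaled_error (m : nat) (t : T) : R :=
  Num.sqrt m%:R * (phihat m (omega t) (noise_seq t) - phi S (omega t)).

Definition assumptionA : Prop :=
  exists (p : nat -> R -> R -> R) (f : nat -> nat -> R -> R),
  [/\ forall m, (0 < m)%N ->
        [/\ measurable_fun setT (fun z : R * R => p m z.1 z.2),
            forall x y, 0 <= p m x y &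
            forall A : set (R * R), measurable A ->
              P [set t | A (phi S (omega t), scaled_error m t)] =
              (\int[(lebesgue_measure \x lebesgue_measure)%E]_(z in A)
                 (p m z.1 z.2)%:E)%E],
      forall m, (0 < m)%N -> forall x y,
        derivable (p m ^~ y) x 1 /\ derivable (derive1 (p m ^~ y)) x 1,
      forall i m, (i <= 2)%N -> (0 < m)%N ->
        measurable_fun setT (f i m) /\
        forall x y, `|derive1n i (p m ^~ y) x| <= f i m y &
      forall (i : nat) (r : R), (i <= 2)%N -> 0 <= r <= 4 ->
        (ereal_sup [set \int[lebesgue_measure]_y (`|y| `^ r * f i m y)%:E
                   | m in [set m | (0 < m)%N]] < +oo)%E].

Definition dphi (w : d.-1.-tuple R) : R -> R :=
  derive1 (fun u => phi S (u, w)).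

Definition assumptionB : Prop :=
  [/\ forall u w, derivable (fun u => phi S (u, w)) u 1 /\
                  derivable (dphi w) u 1,
      stochO1 P (fun (_ : unit) t => phi S (omega t)),
      stochO1 P (fun (_ : unit) t => dphi (omegam S t) (omega1 S t)) &
      stochO1 P (fun (_ : unit) t => derive1 (dphi (omegam S t)) (omega1 S t))].

Definition phihat_path (l : nat) (t : T) : R -> R :=
  fun u => phihat (mlev l) (u, omegam S t) (noise_seq t).

(* As [0^-1 = 0] in a field, the existence of the inverse derivative as a
   function of the first coordinate has to be stated explicitly. *)
Definition assumptionC : Prop :=
  (forall l, {ae P, forall t, forall u,
     derivable (phihat_path l t) u 1 /\ derive1 (phihat_path l t) u != 0}) /\
  stochO1 P (fun l t => (derive1 (phihat_path l t) (omega1 S t))^-1).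

Definition assumptionD : Prop :=
  (forall u, 0 < rho1 S u /\ derivable (rho1 S) u 1) /\
  forall p : R, 1 <= p ->
    (\int[lebesgue_measure]_u
       ((1 + `|derive1 (rho1 S) u / rho1 S u|) `^ p * rho1 S u)%:E < +oo)%E.

Definition mse (Q : T -> R) : \bar R := ('E_P[fun t => ((Q t - theta) ^+ 2)%R])%E.

Definition cost_exact (kappa : R) (L : nat) (N : nat -> nat) : R :=
  \sum_(l < L.+1) (N l)%:R * (kappa * (mlev l)%:R).

Definition complexity_exact (kappa TOL : R) : \bar R :=
  ereal_inf [set x | exists (L : nat) (N : nat -> nat),
    [/\ forall l, (l <= L)%N -> (0 < N l)%N,
        (mse (Qhat L N) <= (TOL ^+ 2)%:E)%E &
        x = (cost_exact kappa L N)%:E]].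

End Estimators.

(* Landau O as TOL -> 0+ for an extended real valued complexity, which is
   moreover required to be finite, and the bound uniform, on each ]0, TOL0] with
   TOL0 < 1 (no constant can serve on the whole of ]0, 1[ for a bound which
   vanishes at TOL = 1, while the cost is at least that of one sample). *)
Definition complexity_bigO (R : realType) (cplx : R -> \bar R)
    (bound : R -> R) : Prop :=
  forall TOL0 : R, 0 < TOL0 < 1 ->
    exists K : R, forall TOL : R, 0 < TOL <= TOL0 ->
      (cplx TOL <= (K * bound TOL)%:E)%E.

(* A Laguerre quadrature rule
     \sum_(k <= lag_n) lag_weight k * p (lag_node k)
   for \int_0^oo p(x) e^(-x) dx, with lag_n positive nodes and the endpoint
   0 as node number 0. [lag_weight 0 = 0] gives the Gauss-Laguerre rule, and
   the Gauss-Radau-Laguerre rule is also of this form. *)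
Record laguerre_rule (R : realType) := LaguerreRule {
  lag_n : nat;
  lag_node : nat -> R;
  lag_weight : nat -> R;
  lag_node0 : lag_node 0 = 0;
  lag_node_gt0 : forall k, (0 < k <= lag_n)%N -> 0 < lag_node k;
  lag_node_inj : forall j k, (j <= lag_n)%N -> (k <= lag_n)%N ->
    lag_node j = lag_node k -> j = k;
  lag_exact : forall p : {poly R}, (size p <= maxn 1 lag_n.*2)%N ->
    \sum_(k < lag_n.+1) lag_weight k * p.[lag_node k] =
    \int[lebesgue_measure]_(x in `[0, +oo[) (p.[x] * expR (- x)) }.

(* The two-sided rule with M + 1 nodes split at y: node 0 is y itself, the
   nodes 1..lag_n ruleL lie on its left and the others on its right. The
   weights absorb e^x and the density, so that
     \sum_(k <= M) eta k * g (zeta k)  ~  \int g(u) rho1(u) du. *)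
Record two_sided_laguerre (R : realType) (M : nat) := TwoSidedLaguerre {
  ruleL : laguerre_rule R;
  ruleR : laguerre_rule R;
  rule_size : (lag_n ruleL + lag_n ruleR)%N = M }.

Section TwoSidedLaguerre.
Context (R : realType) (M : nat).
Variables (q : two_sided_laguerre R M) (rho : R -> R) (y : R).

Definition zeta (k : nat) : R :=
  if (k <= lag_n (ruleL q))%N then y - lag_node (ruleL q) k
  else y + lag_node (ruleR q) (k - lag_n (ruleL q)).

Definition eta (k : nat) : R :=
  rho (zeta k) *
  if k == 0%N then lag_weight (ruleL q) 0 + lag_weight (ruleR q) 0
  else if (k <= lag_n (ruleL q))%N then
    lag_weight (ruleL q) k * expR (lag_node (ruleL q) k)
  else let j := (k - lag_n (ruleL q))%N in
    lag_weight (ruleR q) j * expR (lag_node (ruleR q) j).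

End TwoSidedLaguerre.

(* [ybar tol w] is the approximate root delivered by Newton's method with
   tolerance [tol], and [quad M] the rule with parameter M_Lag = M. *)
Record numerical_scheme (R : realType) (d : nat) := NumericalScheme {
  quad : forall M : nat, two_sided_laguerre R M;
  ybar : R -> d.-1.-tuple R -> R }.

Section NumericalPreintegration.
Context (R : realType) (d : nat) (dT dE : measure_display)
  (T : measurableType dT) (P : probability T R) (E : measurableType dE).
Variables (S : setting d P E) (V : numerical_scheme R d).

Definition is_root (w : d.-1.-tuple R) (y : R) : Prop :=
  forall u, phi S (u, w) = thr S <-> u = y.

Definition simple_root_or_positive : Prop :=
  forall w, (exists y, is_root w y /\ dphi S w y != 0) \/
            (forall u, thr S < phi S (u, w)).

Definition newton_step (w : d.-1.-tuple R) (u : R) : R :=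
  u - (phi S (u, w) - thr S) / dphi S w u.

(* The number of iterations is proportional to log (1 / tol), rounded up. When
   there is no root nothing is required of the splitting point. *)
Definition newton_approximation : Prop :=
  (forall tol, 0 < tol < 1 -> measurable_fun setT (ybar V tol)) /\
  exists (y0 : d.-1.-tuple R -> R) (kN : R), 0 < kN /\
  forall w y, is_root w y ->
    [/\ (fun n => iter n (newton_step w) (y0 w)) @ \oo --> y,
        exists K : R, forall n,
          `|iter n.+1 (newton_step w) (y0 w) - y| <=
          K * `|iter n (newton_step w) (y0 w) - y| ^+ 2 &
        forall tol, 0 < tol < 1 ->
          ybar V tol w =
            iter `|Num.ceil (kN * ln tol^-1)|%N (newton_step w) (y0 w) /\
          `|ybar V tol w - y| <= tol].

Definition hbar (M : nat) (tol : R) (m : nat) (w : d.-1.-tuple R)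
    (e : nat -> E) : R :=
  \sum_(k < M.+1) eta (quad V M) (rho1 S) (ybar V tol w) k *
    ghat S m (zeta (quad V M) (ybar V tol w) k, w) e.

Definition Qbar (L : nat) (N : nat -> nat) (M : nat) (tol : R) : T -> R :=
  mlmc S (hbar M tol) L N.

(* E[(Qhat - Qbar)^2] = O(M^-s) + O(tol^2) as M -> oo and tol -> 0, uniformly
   in L and in the sample sizes. *)
Definition preintegration_error (s : R) : Prop :=
  exists (K : R) (M0 : nat) (tol0 : R), 0 < tol0 /\
  forall (L : nat) (N : nat -> nat) (M : nat) (tol : R),
    (forall l, (l <= L)%N -> (0 < N l)%N) -> (M0 <= M)%N -> (0 < M)%N ->
    0 < tol < 1 -> tol <= tol0 ->
    ('E_P[fun t => ((Qhat S L N t - Qbar L N M tol t) ^+ 2)%R] <=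
     (K * (M%:R `^ (- s) + tol ^+ 2))%:E)%E.

Definition cost_num (kappa : R) (L : nat) (N : nat -> nat) (M : nat)
    (tol : R) : R :=
  \sum_(l < L.+1)
    (N l)%:R * (kappa * ((mlev S l)%:R * (M%:R + ln tol^-1))).

Definition complexity_num (kappa TOL : R) : \bar R :=
  ereal_inf [set x |
    exists (L : nat) (N : nat -> nat) (M : nat) (tol : R),
    [/\ (forall l, (l <= L)%N -> (0 < N l)%N),
        (0 < M)%N,
        0 < tol < 1,
        (mse S (Qbar L N M tol) <= (TOL ^+ 2)%:E)%E &
        x = (cost_num kappa L N M tol)%:E]].

End NumericalPreintegration.

(* Main.v *)
Require Import Defs.
From HB Require Import structures.
From mathcomp Require Import all_boot all_order all_algebra.
From mathcomp Require Import all_classical all_reals all_analysis.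
From mathcomp Require Import measurable_realfun.
From mathcomp Require Import ring lra.

(** The proof rests on one estimate, [smoothing_rate_exists]: the smoothed
    indicator hhat_m differs from its limit h, the conditional probability of
    phi(omega) > c given omega_(-1), by a random variable whose second moment is
    O(1/m). It bounds the bias of the finest level and, the levels being
    telescoped, the variance of every level ([mse_Qhat_le], [mse_Qhat_rate]).
    The sum over l of 1 / (m_l N_l) is then balanced against the cost, the sum
    of N_l m_l, in [mlmc_parameters]: each of the O(log(1/TOL)) levels gets the
    same share of both. For the numerical method the error of the
    preintegration is added, and the cost of the exact method is multiplied by
    M + log(1/tol), of order TOL^(-2/s) ([complexity_num_rate]).

    The rate O(1/m) is one power of m^(-1/2) better than for an indicator
    without smoothing. Fix omega_(-1) and the noises; let u stand for omega1,
    A = sqrt(m) (phi - c) and Z = sqrt(m) (phihat_m - phi). The two indicators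
    at u differ only if |A| <= |Z|. For any t > 0 the points with |A| <= t have
    rho1-measure at most 4 pi R t / sqrt(m), where R controls the density of
    phi(., omega_(-1)); the other points are counted by Y / t^2, where Y is the
    integral of (1 + |Z|)^4 / (1 + A^2). Optimizing t, |hhat_m - h|^3 is at most
    a constant times R^2 Y / m, whence (hhat_m - h)^2 = O(R^4 / m + Y / sqrt(m))
    ([smoothed_gap_path]). The mean of Y is O(1 / sqrt(m)) by the bounds on the
    joint density of phi and Z ([near_threshold_moment]).

    It remains to bound the mean of R^4. By [density_comp_le] one may take for R
    the integral of rho1 (|rho1'/rho1| / |phi'| + |phi''| / phi'^2), so that
    moments of rho1'/rho1, of phi'' and of 1 / phi' are needed. The inverse
    slope of phi is not controlled by hypothesis; only that of the inner
    averages phihat_l is. It is recovered from finite differences: by Jensen's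
    inequality the inverse powers of the difference quotients of phihat_l have
    bounded moments ([integral_inverse_slope_le]), the quotients converge to
    those of phi in mean ([slope_test_moment]), and Fatou's lemma passes to the
    derivative ([inverse_slope_moment]). The estimates of increments by
    integrals of derivatives hold for functions which are merely differentiable
    ([increment_le_integral]), as no continuity of phihat_l' or phi'' is
    assumed. *)

Import Order.TTheory GRing.Theory Num.Theory.
Import numFieldNormedType.Exports.

Local Open Scope classical_set_scope.
Local Open Scope ring_scope.

Set Implicit Arguments.
Unset Strict Implicit.
Unset Printing Implicit Defensive.

(** * Integrals of nonnegative real functions *)

Lemma eq_leW (disp : Order.disp_t) (X : porderType disp) (x y : X) :
  x = y -> (x <= y)%O.
Proof. by move=> ->. Qed.

Lemma invr_measurable (R : realType) : measurable_fun setT (fun x : R => x^-1).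
Proof.
apply: (@measurable_fun_cvg _ _ R setT (fun n (x : R) => x / (x ^+ 2 + n.+1%:R^-1))) => [n|x _].
  apply: continuous_measurable_fun => x; apply: cvgM; first exact: cvg_id.
  apply: cvgV; first by rewrite gt_eqF// ltr_wpDl ?sqr_ge0// invr_gt0.
  apply: cvgD; last exact: cvg_cst.
  exact: exprn_continuous.
(* at 0 both sides are 0, by the convention for the inverse in a field *)
have [->|x0] := eqVneq x 0.
  by rewrite invr0; under eq_fun do rewrite mul0r; exact: cvg_cst.
rewrite [X in _ --> X](_ : _ = x / (x ^+ 2 + 0)); last by rewrite addr0; field.
apply: cvgM; first exact: cvg_cst.
apply: cvgV; first by rewrite addr0 expf_neq0.
by apply: cvgD; [exact: cvg_cst|exact: cvg_harmonic].
Qed.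

Section measurable_compositions.
Context d (X : measurableType d) (R : realType).
Implicit Types (f : X -> R).

Lemma measurable_abs f : measurable_fun setT f -> measurable_fun setT (fun x => `|f x|).
Proof. by move=> mf; exact: (measurableT_comp (@normr_measurable _ _) mf). Qed.

Lemma measurable_inv f : measurable_fun setT f -> measurable_fun setT (fun x => (f x)^-1).
Proof. by move=> mf; exact: (measurableT_comp (@invr_measurable _) mf). Qed.
End measurable_compositions.

Section real_integrands.
Context d (X : measurableType d) (R : realType) (m : {measure set X -> \bar R}).
Implicit Types (f g : X -> R).

Lemma integral_real_ge0 (D : set X) f :
  (forall x, 0 <= f x) -> (0 <= \int[m]_(x in D) (f x)%:E)%E.
Proof. by move=> f0; apply: integral_ge0 => x _; rewrite lee_fin. Qed.

Section domain.
Context (D : set X) (mD : measurable D).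

Lemma integral_real_le f g :
  measurable_fun setT f -> measurable_fun setT g ->
  (forall x, 0 <= f x) -> (forall x, D x -> f x <= g x) ->
  (\int[m]_(x in D) (f x)%:E <= \int[m]_(x in D) (g x)%:E)%E.
Proof.
move=> mf mg f0 fg; apply: ge0_le_integral => //.
- by move=> x _; rewrite lee_fin.
- by apply: measurable_funTS; exact/measurable_EFinP.
- by apply: measurable_funTS; exact/measurable_EFinP.
Qed.

Lemma integral_realD f g :
  measurable_fun setT f -> measurable_fun setT g ->
  (forall x, 0 <= f x) -> (forall x, 0 <= g x) ->
  (\int[m]_(x in D) (f x + g x)%:E =
   \int[m]_(x in D) (f x)%:E + \int[m]_(x in D) (g x)%:E)%E.
Proof.
move=> mf mg f0 g0; under eq_integral do rewrite EFinD; apply: ge0_integralD => //.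
- by move=> x _; rewrite lee_fin.
- by apply: measurable_funTS; exact/measurable_EFinP.
- by move=> x _; rewrite lee_fin.
- by apply: measurable_funTS; exact/measurable_EFinP.
Qed.

Lemma integral_realZ (k : R) f :
  measurable_fun setT f -> (forall x, 0 <= f x) -> 0 <= k ->
  (\int[m]_(x in D) (k * f x)%:E = k%:E * \int[m]_(x in D) (f x)%:E)%E.
Proof.
move=> mf f0 k0; under eq_integral do rewrite EFinM; apply: ge0_integralZl => //.
- by apply: measurable_funTS; exact/measurable_EFinP.
- by move=> x _; rewrite lee_fin.
Qed.
End domain.

(** Fatou's lemma in the form used below: a common bound of the integrals
    survives a pointwise limit. *)
Lemma integral_real_cvg_le (g_ : nat -> X -> R) (g : X -> R) (K : \bar R) :
  (forall n, measurable_fun setT (g_ n)) -> (forall n x, 0 <= g_ n x) ->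
  (forall x, g_ n x @[n --> \oo] --> g x) ->
  (forall n, \int[m]_x (g_ n x)%:E <= K)%E -> (\int[m]_x (g x)%:E <= K)%E.
Proof.
move=> mg g0 gg gK.
have := @fatou _ _ _ m setT measurableT (fun n x => (g_ n x)%:E).
move=> /(_ (fun n => (measurable_EFinP _ _).2 (mg n))).
move=> /(_ (fun n x _ => g0 n x)) H.
rewrite (eq_integral (fun x => limn_einf (fun n => (g_ n x)%:E))); last first.
  move=> x _; apply/esym; apply: (cvg_limn_einf_sup _).1.
  by apply: cvg_EFin; [exact: nearW|exact: gg].
apply: (le_trans H); rewrite limn_einf_lim; apply: lime_le; first exact: is_cvg_einfs.
apply: nearW => n; apply: le_trans (gK n); apply: ereal_inf_lbound.
by exists n => //=.
Qed.
End real_integrands.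

(** * Increments bounded by integrals *)

Section increments.
Context {R : realType}.
Implicit Types (F Phi : R -> R) (a b : R).
Notation mu := (@lebesgue_measure R).

(** The comparison of increments holds up to the supremum of the points where
    it holds, and if this supremum were below b, the local hypothesis at it would
    carry the comparison further. *)
Lemma local_increment_bound F Phi a b : a <= b ->
  (forall x, a <= x <= b -> exists2 d, 0 < d & forall y, a <= y <= b ->
     `|y - x| < d ->
     (x <= y -> F y - F x <= Phi y - Phi x) /\
     (y <= x -> F x - F y <= Phi x - Phi y)) ->
  F b - F a <= Phi b - Phi a.
Proof.
move=> ab loc; pose A := [set x | a <= x <= b /\ F x - F a <= Phi x - Phi a].
have Aa : A a by split; rewrite ?lexx ?subrr.
have ubA : ubound A b by move=> x [/andP[]].
have hsA : has_sup A by split; [exists a | exists b].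
set s := sup A.
have as_ : a <= s by apply: ub_le_sup; [exists b|].
have sb : s <= b by apply: ge_sup; [exists a|].
have [d d0 locs] := loc s (introT andP (conj as_ sb)).
have [x Ax sx] := sup_adherent d0 hsA.
have [/andP[ax xb] Fx] := Ax.
have xs : x <= s by apply: ub_le_sup; [exists b|].
have sA : F s - F a <= Phi s - Phi a.
  have [|_ /(_ xs)] := locs x (introT andP (conj ax xb)).
    by rewrite distrC ger0_norm ?subr_ge0// ltrBlDr addrC -ltrBlDr.
  by move=> h; lra.
move: sb; rewrite le_eqVlt => /orP[/eqP <-//|sb].
pose y := Num.min b (s + d / 2).
have sy : s < y by rewrite lt_min sb/= ltrDl divr_gt0.
have yb : y <= b by rewrite ge_min lexx.
have : y <= s.
  apply: ub_le_sup; first by exists b.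
  split; first by rewrite yb (le_trans as_ (ltW sy)).
  have [||/(_ (ltW sy)) h _] := locs y.
  - by rewrite yb (le_trans as_ (ltW sy)).
  - rewrite ger0_norm ?subr_ge0 ?(ltW sy)// ltrBlDl.
    have : y <= s + d / 2 by rewrite ge_min lexx orbT.
    move=> /le_lt_trans; apply; lra.
  lra.
by rewrite leNgt sy.
Qed.

(** The majorant of the Vitali-Caratheodory theorem. The level sets of g, cut
    at the multiples of h, are enclosed in open sets U n of slightly larger
    measure. Near a point of U n the sum is at least the constant (n + 1) h:
    comparing difference quotients takes no more than this. *)
Lemma upper_lsc_majorant (g : R -> R) a b (e : R) : 0 < e -> a <= b ->
  measurable_fun setT g -> (forall x, 0 <= g x) ->
  exists (U : nat -> set R) (h : R), [/\ 0 < h,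
    (forall n, open (U n)),
    (forall x, a <= x <= b -> exists2 n, U n x & g x < n.+1%:R * h) &
    (\int[mu]_(x in `[a, b]) (\sum_(n <oo) (n.+1%:R * h * \1_(U n) x)%:E) <=
     \int[mu]_(x in `[a, b]) (g x)%:E + e%:E)%E].
Proof.
move=> e0 ab mg g0.
pose h := e / (b - a + 1).
have ba1 : 0 < b - a + 1 by rewrite ltr_wpDl// subr_ge0.
have h0 : 0 < h by rewrite divr_gt0.
pose E n := `[a, b]%classic `&` g @^-1` `[n%:R * h, n.+1%:R * h[%classic.
have mE n : measurable (E n).
  apply: measurableI => //; rewrite -[X in measurable X]setTI; exact: mg.
have finE n : (mu (E n) < +oo)%E.
  apply: (@le_lt_trans _ _ (mu `[a, b]%classic)).
    by apply: le_measure; [rewrite inE; exact: mE|rewrite inE|exact: subIsetl].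
  by rewrite /= lebesgue_measure_itv/=; case: ifPn => _ //; rewrite -EFinB ltry.
have d0 n : 0 < (n.+1%:R * 2 ^+ n.+1 : R)^-1.
  by rewrite invr_gt0 mulr_gt0// exprn_gt0.
have /choice [U HU] : forall n, exists U : set R, [/\ open U, E n `<=` U &
     (mu (U `\` E n) < ((n.+1%:R * 2 ^+ n.+1 : R)^-1)%:E)%E].
  by move=> n; exact: (lebesgue_regularity_outer (mE n) (finE n) (d0 n)).
have mU n : measurable (U n) by apply: open_measurable; case: (HU n).
have mUE n : measurable (U n `\` E n) by apply: measurableD.
exists U, h; split => //.
- by move=> n; case: (HU n).
- move=> x xab; pose n := Num.truncn (g x / h).
  have gh : n%:R <= g x / h < n.+1%:R by apply: truncn_itv; rewrite divr_ge0// ltW.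
  have [gh1 gh2] := andP gh.
  exists n; last by rewrite -ltr_pdivrMr.
  by case: (HU n) => _ EU _; apply: EU; split => //=; rewrite in_itv/= -ler_pdivlMr// gh1 -ltr_pdivrMr.
rewrite integral_nneseries//; last 2 first.
- move=> n; apply/measurable_EFinP; apply: measurable_funM => //.
  by exact: (measurable_indic (mU n)).
- by move=> n x _; rewrite lee_fin mulr_ge0// mulr_ge0// ltW.
have -> : (e = (b - a) * h + h)%R.
  by rewrite -[X in _ + X]mul1r -mulrDl mulrC divfK// gt_eqF.
rewrite EFinD addeA.
have step1 n : (\int[mu]_(x in `[a, b]) (n.+1%:R * h * \1_(U n) x)%:E <=
    (n.+1%:R * h)%:E * mu (E n) + (h / (2 ^ n.+1)%:R)%:E)%E.
  have nh0 : 0 <= n.+1%:R * h by rewrite mulr_ge0// ltW.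
  under eq_integral do rewrite EFinM.
  rewrite ge0_integralZl//; last first.
    by apply/measurable_EFinP; exact: (measurable_indic (mU n)).
  rewrite integral_indic//; last exact: mU.
  have [_ EU UE] := HU n.
  apply: (@le_trans _ _ ((n.+1%:R * h)%:E * (mu (E n) + mu (U n `\` E n)))%E).
    apply: lee_wpmul2l; first by rewrite lee_fin.
    rewrite -[leLHS]/(mu _) -measureU//; last 3 first.
    - exact: mE.
    - exact: mUE.
    - by rewrite setDE setICA setICr setI0.
    apply: le_measure; rewrite ?inE.
    + by apply: measurableI => //; exact: mU.
    + by apply: measurableU; [exact: mE|exact: mUE].
    + by move=> x [Ux _]; have [?|?] := pselect (E n x); [left|right].
  rewrite ge0_muleDr//; apply: leeD => //.
  apply: (@le_trans _ _ ((n.+1%:R * h)%:E * ((n.+1%:R * 2 ^+ n.+1 : R)^-1)%:E)%E).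
    by apply: lee_wpmul2l; [rewrite lee_fin|exact: ltW].
  rewrite -EFinM lee_fin natrX invfM mulrACA divff ?mul1r//.
have eqE n : ((n.+1%:R * h)%:E * mu (E n) =
    \int[mu]_(x in `[a, b]) (n.+1%:R * h * \1_(E n) x)%:E)%E.
  under eq_integral do rewrite EFinM.
  rewrite ge0_integralZl//; last 2 first.
  - by apply/measurable_EFinP; exact: (measurable_indic (mE n)).
  - by rewrite lee_fin mulr_ge0// ltW.
  rewrite integral_indic//; last exact: mE.
  by congr (_ * mu _)%E; apply/esym/setIidPl => x [].
have step2 : (\sum_(n <oo) (n.+1%:R * h)%:E * mu (E n) <=
     \int[mu]_(x in `[a, b]) (g x)%:E + ((b - a) * h)%:E)%E.
  have -> : (((b - a) * h)%:E = \int[mu]_(x in `[a, b]) (h%:E))%E.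
    rewrite integral_cst//= lebesgue_measure_itv/= lte_fin.
    case: ltP => [ab'|ba]; first by rewrite -EFinB -EFinM mulrC.
    by rewrite mule0 (le_anti (introT andP (conj ab ba))) subrr mul0r.
  rewrite -ge0_integralD//; last 3 first.
  - by move=> x _; rewrite lee_fin.
  - by apply/measurable_EFinP/measurable_funTS.
  - by move=> x _; rewrite lee_fin ltW.
  under eq_eseriesr do rewrite eqE.
  rewrite -integral_nneseries//; last 2 first.
  - move=> n; apply/measurable_EFinP; apply: measurable_funM => //.
    by exact: (measurable_indic (mE n)).
  - by move=> n x _; rewrite lee_fin mulr_ge0// mulr_ge0// ltW.
  apply: ge0_le_integral => //.
  - move=> x _; apply: nneseries_ge0 => n _ _.
    by rewrite lee_fin mulr_ge0// mulr_ge0// ltW.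
  - apply: ge0_emeasurable_sum => n.
      by move=> x _ _; rewrite lee_fin mulr_ge0// mulr_ge0// ltW.
    move=> _; apply/measurable_EFinP; apply: measurable_funM => //.
    by exact: (measurable_indic (mE n)).
  - apply: emeasurable_funD => //.
    by apply/measurable_EFinP/measurable_funTS.
  - move=> x xab; pose n := Num.truncn (g x / h).
    have gh : n%:R <= g x / h < n.+1%:R.
      by apply: truncn_itv; rewrite divr_ge0// ltW.
    have [gh1 gh2] := andP gh.
    rewrite (@nneseriesD1 _ _ n)//; last first.
      by move=> k _; rewrite lee_fin mulr_ge0// mulr_ge0// ltW.
    rewrite eseries0 ?adde0; last first.
      move=> k _ /= kn; rewrite /indic memNset ?mulr0//.
      move=> [_ /=]; rewrite in_itv/= -ler_pdivlMr// -ltr_pdivrMr// => hk.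
      move: kn; rewrite -(truncn_def hk) eqxx.
      by [].
    rewrite -EFinD lee_fin -natr1 mulrDl mul1r.
    apply: (@le_trans _ _ ((n%:R * h + h) * 1)).
      apply: ler_wpM2l; first by rewrite addr_ge0// ?(ltW h0)// mulr_ge0// ltW.
      by rewrite /indic; case: (_ \in _).
    by rewrite mulr1 lerD2r -ler_pdivlMr.
apply: (le_trans (lee_nneseries _ _)).
- by move=> n _ _; apply: integral_ge0 => x _; rewrite lee_fin mulr_ge0// mulr_ge0// ltW.
- by move=> n _; exact: step1.
apply: (le_trans (@epsilon_trick _ _ _ _ _ _)).
- by move=> n; rewrite mule_ge0// lee_fin mulr_ge0// ltW.
- exact: ltW.
by apply: leeD.
Qed.

(** The derivative exists everywhere but may fail to be integrable, so the
    fundamental theorem of calculus does not apply. Instead W is compared with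
    the primitive Phi of the majorant of g: at x the quotients of W are
    eventually below (n + 1) h > dW x, those of Phi above it. *)
Lemma increment_le_integral (W dW g : R -> R) a b : a <= b ->
  (forall x, a <= x <= b -> is_derive x 1 W (dW x)) ->
  (forall x, a <= x <= b -> dW x <= g x) ->
  measurable_fun setT g -> (forall x, 0 <= g x) ->
  ((W b - W a)%:E <= \int[mu]_(x in `[a, b]) (g x)%:E)%E.
Proof.
move=> ab dWx dWg mg g0.
have [->|gfin] := eqVneq (\int[mu]_(x in `[a, b]) (g x)%:E)%E +oo%E.
  by rewrite leey.
apply/lee_addgt0Pr => e e0.
have [U [h [h0 oU gU intU]]] := upper_lsc_majorant e0 ab mg g0.
pose t n x := (n.+1%:R * h * \1_(U n) x)%:E.
pose G x := (\sum_(n <oo) t n x)%E.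
have t0 n x : (0 <= t n x)%E by rewrite lee_fin mulr_ge0// mulr_ge0// ltW.
have G0 x : (0 <= G x)%E by apply: nneseries_ge0.
have mU n : measurable (U n) by exact: open_measurable.
have mt n : measurable_fun setT (t n).
  by apply/measurable_EFinP; apply: measurable_funM => //; exact: measurable_indic.
have mG D : measurable_fun D G.
  by apply: measurable_funTS; apply: ge0_emeasurable_sum => // n _; exact: mt.
have Gfin : (\int[mu]_(x in `[a, b]) G x < +oo)%E.
  by rewrite (le_lt_trans intU)// lte_add_pinfty ?ltry// ltey.
have Gsub x y : a <= x -> y <= b -> (\int[mu]_(z in `]x, y]) G z < +oo)%E.
  move=> ax yb; apply: le_lt_trans Gfin; apply: ge0_subset_integral => //; first exact: mG.
  by move=> z /=; rewrite !in_itv/= => /andP[xz zy]; rewrite (le_trans ax (ltW xz)) (le_trans zy yb).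
pose Phi x := fine (\int[mu]_(z in `]a, x]) G z)%E.
have PhiB x y : a <= x -> x <= y -> y <= b ->
    ((Phi y - Phi x)%:E = \int[mu]_(z in `]x, y]) G z)%E.
  move=> ax xy yb; rewrite EFinB !fineK ?ge0_fin_numE ?integral_ge0 ?Gsub// ?(le_trans xy)//.
  have -> : (`]a, y] = `]a, x] `|` `]x, y] :> set R)%classic.
    apply/seteqP; split => z /=; rewrite !in_itv/=.
      by move=> /andP[az zy]; rewrite az zy andbT; case: (leP z x) => /=; [left|right].
    by move=> [/andP[-> zx]|/andP[xz ->]]; rewrite ?(le_trans zx xy)// (le_lt_trans ax xz).
  rewrite ge0_integral_setU//=.
  - by rewrite addeAC subee ?add0e// ge0_fin_numE ?integral_ge0 ?Gsub// (le_trans xy).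
  - exact: mG.
  - by rewrite disj_set2E; apply/eqP; rewrite -subset0 => z /= []; rewrite !in_itv/= => /andP[_ zx] /andP[/(le_lt_trans zx)]; rewrite ltxx.
have PhiG n x y : a <= x -> x <= y -> y <= b ->
    (forall z, x < z <= y -> U n z) -> n.+1%:R * h * (y - x) <= Phi y - Phi x.
  move=> ax xy yb Uz; rewrite -lee_fin PhiB//.
  have -> : ((n.+1%:R * h * (y - x))%:E = \int[mu]_(z in `]x, y]) (n.+1%:R * h)%:E)%E.
    rewrite integral_cst//= lebesgue_measure_itv/= lte_fin.
    case: ltP => [xy'|yx]; first by rewrite -EFinB -EFinM.
    by rewrite mule0 (le_anti (introT andP (conj xy yx))) subrr mulr0.
  apply: ge0_le_integral => //.
  - by move=> z _; rewrite lee_fin mulr_ge0// ltW.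
  - exact: mG.
  - move=> z; rewrite /= in_itv/= => xzy.
    rewrite /G (@nneseriesD1 _ _ n)//.
    apply: (@le_trans _ _ (t n z)); last by rewrite leeDl// nneseries_ge0.
    by rewrite /t /indic mem_set ?mulr1//; exact: Uz.
have Phile : Phi b - Phi a <= fine (\int[mu]_(x in `[a, b]) G x)%E.
  rewrite -lee_fin PhiB// fineK ?ge0_fin_numE ?integral_ge0//.
  apply: ge0_subset_integral => //; first exact: mG.
  move=> z /=; rewrite !in_itv/= => /andP[az ->].
  by rewrite ltW.
apply: (@le_trans _ _ (\int[mu]_(x in `[a, b]) G x)%E); last exact: intU.
rewrite -(@fineK _ (\int[mu]_(x in `[a, b]) G x)%E) ?ge0_fin_numE ?integral_ge0//.
rewrite lee_fin; apply: le_trans Phile.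
apply: local_increment_bound => // x /[dup] xab /andP[ax xb].
(* x lies in U n with dW x < (n + 1) h, and U n is open *)
have [n Unx gx] := gU x xab.
have dx : dW x < n.+1%:R * h by apply: le_lt_trans gx; exact: dWg.
have /= [/cvg_ex[l /= Hl] D] := dWx x xab.
have lE : l = dW x by rewrite -D; apply/esym/cvg_lim.
rewrite {}lE in Hl.
have /= [d1 d10 Hd1] := @cvgr_lt _ _ _ _ _ _ Hl _ dx.
have /= [d2 d20 Hd2] : nbhs x (U n) by apply: open_nbhs_nbhs.
exists (Num.min d1 d2); first by rewrite lt_min d10.
move=> y /andP[ay yb]; rewrite lt_min => /andP[yd1 yd2].
have quot : y != x -> (W y - W x) / (y - x) < n.+1%:R * h.
  move=> yx; have := Hd1 (y - x); rewrite /= sub0r normrN => /(_ yd1).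
  by rewrite subr_eq0 => /(_ yx); rewrite /GRing.scale/= mulr1 subrK mulrC.
have inU z : `|z - x| <= `|y - x| -> U n z.
  by move=> zy; apply: Hd2; rewrite /= distrC (le_lt_trans zy).
split => [xy|yx].
- apply: (le_trans _ (PhiG n x y ax xy yb _)); last first.
    move=> z /andP[xz zy]; apply: inU.
    by rewrite !ger0_norm ?subr_ge0 ?lerD2r ?(ltW xz).
  move: xy; rewrite le_eqVlt => /orP[/eqP->|xy]; first by rewrite !subrr mulr0.
  by rewrite -ler_pdivrMr ?subr_gt0// ltW// quot// gt_eqF.
- apply: (le_trans _ (PhiG n y x ay yx xb _)); last first.
    move=> z /andP[yz zx]; apply: inU.
    by rewrite !ler0_norm ?subr_le0 ?lerN2 ?lerD2r// ltW.
  move: yx; rewrite le_eqVlt => /orP[/eqP->|yx]; first by rewrite !subrr mulr0.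
  rewrite -ler_pdivrMr ?subr_gt0// -mulrNN -invrN !opprB ltW// quot// lt_eqF//.
Qed.
End increments.

(** * Derivatives without zeros *)

Section derivatives.
Context {R : realType}.
Implicit Types (F f r : R -> R) (a b : R).
Notation mu := (@lebesgue_measure R).

(** Exhibits the derivative as the limit of a sequence of functions which are
    measurable together with F. *)
Lemma derive1_quotient_cvg F u : derivable F u 1 ->
  n.+1%:R * (F (u + n.+1%:R^-1) - F u) @[n --> \oo] --> derive1 F u.
Proof.
move=> dF; rewrite derive1E.
have := dF; rewrite /derivable => /cvg_ex[l Hl].
have -> : 'D_1 F u = l by apply/cvg_lim.
move: Hl => /cvgr_dnbhsP /(_ (fun n => n.+1%:R^-1)) H.
have := H (conj (fun n => _) (@cvg_harmonic R)) .
rewrite /= => {}H; apply: cvg_trans (H _) => [|n]; last by rewrite invr_eq0.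
apply: near_eq_cvg; near=> n.
by rewrite invrK /GRing.scale/= mulr1 [in RHS](addrC u).
Unshelve. all: by end_near. Qed.

Lemma derivable1_continuous F : (forall x, derivable F x 1) -> continuous F.
Proof. by move=> dF x; apply/differentiable_continuous/derivable1_diffP/dF. Qed.

Lemma derive1_is_derive F x : derivable F x 1 -> is_derive x 1 F (derive1 F x).
Proof. by move=> dF; rewrite derive1E; exact: derivableP. Qed.

Lemma measurable_derive1_pair d (W : measurableType d) (f : R * W -> R) :
  measurable_fun setT f -> (forall u w, derivable (fun v => f (v, w)) u 1) ->
  measurable_fun setT (fun z : R * W => derive1 (fun v => f (v, z.2)) z.1).
Proof.
move=> mf df.
apply: (@measurable_fun_cvg _ _ _ _ (fun n (z : R * W) =>
  n.+1%:R * (f (z.1 + n.+1%:R^-1, z.2) - f z))) => [n|[u w] _].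
  apply: measurable_funM => //; apply: measurable_funB => //.
  apply: measurableT_comp => //; apply: measurable_fun_pair => //.
  exact: measurable_funD.
exact: (derive1_quotient_cvg (df u w)).
Qed.

Lemma measurable_derive1 F : (forall u, derivable F u 1) ->
  measurable_fun setT (derive1 F).
Proof.
move=> dF; apply: (@measurable_fun_cvg _ _ R setT (fun n (u : R) =>
  n.+1%:R * (F (u + n.+1%:R^-1) - F u))) => [n|u _].
  have mF : measurable_fun setT F.
    by apply: continuous_measurable_fun; exact: derivable1_continuous.
  apply: measurable_funM => //; apply: measurable_funB => //.
  by apply: measurableT_comp => //; exact: measurable_funD.
exact: derive1_quotient_cvg.
Qed.

Lemma derive1_neq0_injective F : (forall x, derivable F x 1 /\ derive1 F x != 0) ->
  injective F.
Proof.
move=> dF; have dF1 x : derivable F x 1 by case: (dF x).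
have injlt x y : x < y -> F x != F y.
  move=> xy; apply/eqP => Fxy.
  have [||c _ Hc] := Rolle xy _ _ Fxy.
  - by move=> z _; exact: dF1.
  - exact: continuous_subspaceT (derivable1_continuous dF1).
  by have [_ /eqP[]] := dF c; rewrite derive1E derive_val.
move=> x y Fxy; apply/eqP; apply: contraT; rewrite neq_lt.
by case/orP => /injlt; rewrite Fxy eqxx.
Qed.

(** By Rolle's theorem F is injective, hence monotone. *)
Lemma derive1_neq0_sign F : (forall x, derivable F x 1 /\ derive1 F x != 0) ->
  (forall x, 0 < derive1 F x) \/ (forall x, derive1 F x < 0).
Proof.
move=> dF; have dF1 x : derivable F x 1 by case: (dF x).
have cF := derivable1_continuous dF1.
have inj : {in `]-oo, +oo[ &, injective F}.
  by move=> x y _ _; exact: derive1_neq0_injective.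
have [] := @itv_continuous_inj_mono _ F `]-oo, +oo[ (continuous_subspaceT cF) inj.
  move=> incF; left => x; rewrite lt_neqAle eq_sym; have [_ ->/=] := dF x.
  apply: (@incr_derive1_ge0 _ _ setT).
  - by move=> ? _; exact: dF1.
  - by move=> y z _ _ yz; apply: incF; rewrite ?in_itv.
  - by rewrite interiorT.
move=> decF; right => x; rewrite lt_neqAle; have [_ ->/=] := dF x.
apply: (@decr_derive1_le0 _ _ setT).
- by move=> ? _; exact: dF1.
- by move=> y z _ _ yz; apply: decF; rewrite ?in_itv.
- by rewrite interiorT.
Qed.

Lemma bernoulliXn (k : nat) (y : R) : 0 <= y -> k.+1%:R * y <= y ^+ k.+1 + k%:R.
Proof.
move=> y0; elim: k => [|k IH]; first by rewrite mul1r addr0 expr1.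
have := ler_wpM2l y0 IH; have := sqr_ge0 (y - 1).
have k0 : 0 <= k%:R :> R by [].
rewrite [y ^+ k.+2]exprS -!natr1; set z := y ^+ k.+1; set n : R := k%:R in k0 *; nra.
Qed.

(** The graph of x^-k is above its tangent at a: this is Bernoulli's
    inequality at a / x, multiplied by x / a^(k+1). *)
Lemma tangent_invXn (k : nat) (a x : R) : 0 < a -> 0 < x ->
  k.+1%:R * a^-1 ^+ k <= x^-1 ^+ k + k%:R * a^-1 ^+ k.+1 * x.
Proof.
move=> a0 x0.
have y0 : 0 <= a / x by rewrite divr_ge0// ltW.
have c0 : 0 <= x * a^-1 ^+ k.+1 by rewrite mulr_ge0 ?exprn_ge0 ?invr_ge0// ltW.
have := ler_wpM2r c0 (bernoulliXn k y0).
have -> : k.+1%:R * (a / x) * (x * a^-1 ^+ k.+1) = k.+1%:R * a^-1 ^+ k.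
  by rewrite exprS; field; rewrite !gt_eqF.
move=> /le_trans; apply; rewrite mulrDl; apply: lerD; last first.
  by rewrite mulrAC mulrA.
rewrite expr_div_n !exprVn [x ^+ k.+1]exprS; apply: eq_leW.
by rewrite [a ^+ k.+1]exprS; field; rewrite !expf_neq0// !gt_eqF.
Qed.

(** Jensen's inequality for the convex function x^-k. The tangent at the mean
    slope c bounds |F'|^-k from below by an affine function of F', with primitive
    W, to which [increment_le_integral] applies. *)
Lemma mean_inverse_slope F (k : nat) a b : a < b ->
  (forall x, derivable F x 1 /\ derive1 F x != 0) ->
  ((((b - a) / `|F b - F a|) ^+ k * (b - a))%:E <=
   \int[mu]_(x in `[a, b]) ((`|derive1 F x|^-1) ^+ k)%:E)%E.
Proof.
move=> ab; wlog pos : F / forall x, 0 < derive1 F x.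
  move=> H dF; have [pF|nF] := derive1_neq0_sign dF; first exact: H.
  have dN x : derive1 (- F) x = - derive1 F x by rewrite derive1N//; case: (dF x).
  have -> : `|F b - F a| = `|(- F) b - (- F) a|.
    by rewrite /= -opprD normrN.
  under eq_integral do rewrite -normrN -dN.
  apply: H => x; first by rewrite dN oppr_gt0.
  by rewrite dN oppr_eq0; case: (dF x) => dFx ->; split => //; exact: derivableN.
move=> dF; have dF1 x : derivable F x 1 by case: (dF x).
have FaFb : F a < F b.
  have [||c _] := @MVT _ F (derive1 F) a b ab.
  - by move=> z _; exact: derive1_is_derive.
  - by apply: continuous_subspaceT; exact: derivable1_continuous.
  by rewrite -subr_gt0 => ->; rewrite mulr_gt0// subr_gt0.
have ba0 : 0 < b - a by rewrite subr_gt0.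
have D0 : 0 < F b - F a by rewrite subr_gt0.
rewrite gtr0_norm//; pose c := (F b - F a) / (b - a).
have c0 : 0 < c by rewrite divr_gt0.
pose W x := k.+1%:R * c^-1 ^+ k * x - k%:R * c^-1 ^+ k.+1 * F x.
have -> : ((b - a) / (F b - F a)) ^+ k * (b - a) = W b - W a.
  have -> : (b - a) / (F b - F a) = c^-1 by rewrite invf_div.
  have -> : W b - W a = k.+1%:R * c^-1 ^+ k * (b - a)
                        - k%:R * (c^-1 ^+ k) * (c^-1 * (F b - F a)).
    by rewrite /W exprS; ring.
  have -> : c^-1 * (F b - F a) = b - a by rewrite invf_div divfK// gt_eqF.
  by rewrite -natr1; ring.
apply: (@increment_le_integral _ W (fun x => k.+1%:R * c^-1 ^+ k - k%:R * c^-1 ^+ k.+1 * derive1 F x)).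
- exact: ltW.
- move=> x _; have dx := derive1_is_derive (dF1 x).
  rewrite /W; apply: is_derive_eq.
  by rewrite /GRing.scale/= mulr1.
- by move=> x _; rewrite lerBlDr gtr0_norm//; exact: tangent_invXn.
- apply: measurable_funX; apply: measurable_inv.
  by apply: measurable_abs; exact: measurable_derive1.
- by move=> x; rewrite exprn_ge0.
Qed.

End derivatives.

(** * Densities of transformed variables *)

Section densities.
Context {R : realType}.
Implicit Types (F f r : R -> R) (a b : R).
Notation mu := (@lebesgue_measure R).

Lemma ge0_integral_le_itv (g : R -> \bar R) (K : \bar R) :
  measurable_fun setT g -> (forall x, 0 <= g x)%E ->
  (forall n : nat, \int[mu]_(x in `[(- n.+1%:R)%R, n.+1%:R]) g x <= K)%E ->
  (\int[mu]_x g x <= K)%E.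
Proof.
move=> mg g0 gK; pose D (n : nat) : set R := `[- n.+1%:R, n.+1%:R]%classic.
have DT : \bigcup_n D n = setT.
  apply/seteqP; split => // x _; exists (Num.truncn `|x|) => //=.
  by rewrite /D/= in_itv/= -ler_norml ltW// truncnS_gt.
rewrite -DT.
have ndD : {homo D : n m / (n <= m)%N >-> (n <= m)%O}.
  move=> n m nm; apply/subsetPset => x; rewrite /D/= !in_itv/= -!ler_norml.
  by move=> /le_trans; apply; rewrite ler_nat.
have H : (\int[mu]_(x in D i) g x)%E @[i --> \oo] --> (\int[mu]_(x in \bigcup_i D i) g x)%E.
  apply: (@ge0_nondecreasing_set_cvg_integral _ (measurableTypeR R) R D g lebesgue_measure ndD) => //.
  - by move=> i; exact: measurable_itv.
  - by move=> i; exact: (measurable_funTS mg).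
rewrite -(cvg_lim _ H)//; apply: lime_le; last by apply: nearW => n; exact: gK.
by apply/cvg_ex; eexists; exact: H.
Qed.

(** The integrand is, up to sign, the derivative of atan (a (f u - c)) / a,
    and f is monotone. *)
Lemma integral_cauchy_comp_le f a c : 0 < a ->
  (forall x, derivable f x 1 /\ derive1 f x != 0) -> continuous (derive1 f) ->
  (\int[mu]_u (`|derive1 f u| / (1 + (a * (f u - c)) ^+ 2))%:E <= (pi / a)%:E)%E.
Proof.
move=> a0 df cdf; wlog pos : f c df cdf / forall x, 0 < derive1 f x.
  move=> H; have [pF|nF] := derive1_neq0_sign df; first exact: H.
  have dN x : derive1 (- f) x = - derive1 f x by rewrite derive1N//; case: (df x).
  have := H (- f) (- c); rewrite (_ : (fun u => _) = (fun u : R => (`|derive1 f u| / (1 + (a * (f u - c)) ^+ 2))%:E)); last first.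
    apply/funext => u; rewrite dN normrN; congr (_ / (1 + _))%:E.
    by rewrite -[in RHS]sqrrN; congr (_ ^+ 2); rewrite /= -mulrN opprB opprK addrC.
  apply.
  - move=> x; rewrite dN oppr_eq0; case: (df x) => dfx fx0.
    by split; [exact: derivableN|exact: fx0].
  - rewrite (_ : derive1 (- f) = - derive1 f); last by apply/funext => x; rewrite dN.
    by move=> x; apply: cvgN; exact: cdf.
  - by move=> x; rewrite dN oppr_gt0.
have df1 x : derivable f x 1 by case: (df x).
have cf := derivable1_continuous df1.
pose g u := `|derive1 f u| / (1 + (a * (f u - c)) ^+ 2).
have den0 u : 1 + (a * (f u - c)) ^+ 2 != 0 by rewrite gt_eqF// ltr_wpDr// sqr_ge0.
have cg : continuous g.
  move=> x; apply: cvgM.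
    by apply: cvg_norm; exact: cdf.
  apply: cvgV; first exact: den0.
  apply: cvgD; first exact: cvg_cst.
  apply: (@continuous_cvg _ _ _ (nbhs x) (nbhs_filter x) (fun v => a * (f v - c)) (fun y : R => y ^+ 2) (a * (f x - c))); first exact: exprn_continuous.
  by apply: cvgM; [exact: cvg_cst|apply: cvgB; [exact: cf|exact: cvg_cst]].
have g0 u : 0 <= g u.
  by rewrite divr_ge0// addr_ge0// sqr_ge0.
apply: ge0_integral_le_itv => //.
  by apply/measurable_EFinP; exact: continuous_measurable_fun.
move=> n; pose G u := atan (a * (f u - c)) / a.
have dG (u : R) : is_derive u 1 G (g u).
  have du := derive1_is_derive (df1 u).
  have d1 : is_derive u 1 (fun v => a * (f v - c)) (a * derive1 f u).
    by apply: is_derive_eq; rewrite /GRing.scale/= ?oppr0 ?addr0 ?mulr0 ?addr0.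
  have d2 := is_derive1_comp (is_derive1_atan _) d1.
  rewrite /G; apply: (@is_derive_eq _ _ _ _ _ _ _ _ (is_deriveM d2 (is_derive_cst a^-1 u 1))).
  rewrite /g gtr0_norm// /GRing.scale/= mulr0 add0r; field.
  by rewrite den0 gt_eqF.
rewrite (@continuous_FTC2 _ g G)//.
- rewrite -EFinB lee_fin /G -mulrBl ler_wpM2r ?invr_ge0 ?(ltW a0)//.
  rewrite lerBlDr (le_trans (ltW (atan_ltpi2 _)))// -lerBlDl.
  by apply: le_trans (ltW (atan_gtNpi2 _)); lra.
- by rewrite gtrN.
- exact: continuous_subspaceT.
- have cG : continuous G by apply: derivable1_continuous => x; case: (dG x).
  split.
  + by move=> x _; case: (dG x).
  + exact/cvg_at_right_filter/cG.
  + exact/cvg_at_left_filter/cG.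
- by move=> x _; rewrite derive1E derive_val.
Qed.

Lemma integral_cauchy_le a c : 0 < a ->
  (\int[mu]_x ((1 + (a * (x - c)) ^+ 2)^-1)%:E <= (pi / a)%:E)%E.
Proof.
move=> a0; have d x : derive1 (@id R) x = 1 by rewrite derive1_id.
have := @integral_cauchy_comp_le id a c a0.
under eq_integral do rewrite d normr1 mul1r.
apply.
  by move=> x; rewrite d; split => //; exact: oner_neq0.
by rewrite (_ : derive1 _ = fun=> 1 : R); [move=> x; exact: cvg_cst|exact/funext].
Qed.

Lemma integral_translation (g : R -> \bar R) (h : R) :
  measurable_fun setT g -> (forall x, 0 <= g x)%E ->
  (\int[mu]_x g (x + h)%R = \int[mu]_x g x)%E.
Proof.
move=> mg g0.
have mh : @measurable_fun _ _ (measurableTypeR R) (measurableTypeR R) setT (fun x : R => x + h).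
  exact: measurable_funD.
pose m1 : {measure set (measurableTypeR R) -> \bar R} :=
  @measure_function_pushforward__canonical__measure_function_Measure _ _ (measurableTypeR R) (measurableTypeR R) R lebesgue_measure _ mh.
transitivity (\int[m1]_(x in setT) g x)%E.
  by rewrite ge0_integral_pushforward// preimage_setT.
apply: eq_measure_integral => A mA _.
apply/esym; apply: (@lebesgue_measure_unique R m1).
  move=> X [[x y] _ <-] /=.
  have E : (fun z : R => z + h) @^-1` `]x, y]%classic = `]x - h, y - h]%classic.
    by apply/seteqP; split => z /=; rewrite !in_itv/= ltrBlDr lerBrDr.
  rewrite -[RHS]/(mu ((fun z : R => z + h) @^-1` `]x, y]%classic)) E.
  rewrite /= !lebesgue_measure_itv/= !lte_fin ltrD2r -!EFinB.
  by case: ifP => // _; congr EFin; lra.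
exact: mA.
Qed.

Lemma ae_imply d (T : measurableType d) (m : set T -> \bar R) (P Q : T -> Prop) :
  (forall x, P x -> Q x) -> {ae m, forall x, P x} -> {ae m, forall x, Q x}.
Proof.
move=> PQ [N [mN N0 PN]]; exists N; split => // x /= nQ; apply: PN => /= Px.
exact/nQ/PQ.
Qed.

Lemma normr_increment_le_integral (W dW g : R -> R) a b : a <= b ->
  (forall x, a <= x <= b -> is_derive x 1 W (dW x)) ->
  (forall x, a <= x <= b -> `|dW x| <= g x) ->
  measurable_fun setT g -> (forall x, 0 <= g x) ->
  (`|W b - W a|%:E <= \int[mu]_(x in `[a, b]) (g x)%:E)%E.
Proof.
move=> ab dWP dWg mg g0; have [_|_] := ger0P (W b - W a).
  by apply: (increment_le_integral ab dWP) => // x /dWg; exact/le_trans/ler_norm.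
have -> : (- (W b - W a) = (- W b) - (- W a))%R by rewrite opprB opprK addrC.
apply: (@increment_le_integral _ (fun x => - W x) (fun x => - dW x)) => //.
- by move=> x /dWP ?; exact: is_deriveN.
- by move=> x /dWg; apply: le_trans; rewrite -normrN ler_norm.
Qed.

(** This says that the law of f under the density r has, tested on Cauchy
    kernels, a density at most 2 B. It follows from the bound r <= 2 B |f'|.
    Put q = r f' / (f'^2 + e). Then |q'| is at most the integrand in the last
    hypothesis, whatever e, so that q varies by at most B; moreover |q| takes
    arbitrarily small values, being at most the integrable function r / |f'|.
    Hence |q| <= B. The choice e = f'(u)^2 gives the bound at u if
    f'(u) != 0, and continuity extends it to all u. In particular f' has no
    zeros, and [integral_cauchy_comp_le] applies. *)
Lemma density_comp_le f r (B a c : R) : 0 < a ->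
  (forall u, derivable f u 1 /\ derivable (derive1 f) u 1) ->
  (forall u, 0 < r u /\ derivable r u 1) ->
  {ae mu, forall u, derive1 f u != 0} ->
  (\int[mu]_u (r u / `|derive1 f u|)%:E < +oo)%E ->
  (\int[mu]_u (r u * (`|derive1 r u / r u| / `|derive1 f u| +
       `|derive1 (derive1 f) u| / derive1 f u ^+ 2))%:E <= B%:E)%E ->
  (\int[mu]_u (r u / (1 + (a * (f u - c)) ^+ 2))%:E <= (2 * B * (pi / a))%:E)%E.
Proof.
move=> a0 df dr aef intf intB.
have df1 u : derivable f u 1 by case: (df u).
have df2 u : derivable (derive1 f) u 1 by case: (df u).
have r0 u : 0 < r u by case: (dr u).
have dr1 u : derivable r u 1 by case: (dr u).
have cf1 := derivable1_continuous df2.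
have cr := derivable1_continuous dr1.
have mf := measurable_derive1 df1.
have mf2 := measurable_derive1 df2.
have mr1 := measurable_derive1 dr1.
have mr : measurable_fun setT r by exact: continuous_measurable_fun.
pose g u := r u * (`|derive1 r u / r u| / `|derive1 f u| +
       `|derive1 (derive1 f) u| / derive1 f u ^+ 2).
have g0 u : 0 <= g u.
  by rewrite mulr_ge0 ?(ltW (r0 u))// addr_ge0// divr_ge0// sqr_ge0.
have mg : measurable_fun setT g.
  apply: measurable_funM => //; apply: measurable_funD.
    apply: measurable_funM; last by apply: measurable_inv; exact: measurable_abs.
    by apply: measurable_abs; apply: measurable_funM => //; exact: measurable_inv.
  by apply: measurable_funM; [exact: measurable_abs|apply: measurable_inv; exact: measurable_funX].
have B0 : 0 <= B.
  by rewrite -lee_fin; apply: le_trans intB; apply: integral_ge0 => u _; rewrite lee_fin; exact: g0.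
(* the regularization of r / f' by e *)
pose q (e u : R) : R := r u * derive1 f u / (derive1 f u ^+ 2 + e).
have den e u : 0 < e -> 0 < derive1 f u ^+ 2 + e.
  by move=> e0; rewrite ltr_wpDl// sqr_ge0.
pose dq (e u : R) : R := derive1 r u * derive1 f u / (derive1 f u ^+ 2 + e) +
  r u * derive1 (derive1 f) u * (e - derive1 f u ^+ 2) / (derive1 f u ^+ 2 + e) ^+ 2.
have dqP e (u : R) : 0 < e -> is_derive u 1 (q e) (dq e u).
  move=> e0.
  have d1 := derive1_is_derive (dr1 u); have d2 := derive1_is_derive (df2 u).
  have d3 : is_derive u 1 (fun v => derive1 f v ^+ 2 + e) (2 * derive1 f u * derive1 (derive1 f) u).
    apply: (@is_derive_eq _ _ _ _ _ _ _ _ (is_deriveD (is_deriveX 2 d2) (is_derive_cst e u 1))).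
    by rewrite /GRing.scale/= addr0.
  have ne : derive1 f u ^+ 2 + e != 0 by rewrite gt_eqF// den.
  have d4 := @is_deriveV _ (fun v => derive1 f v ^+ 2 + e) _ _ _ ne d3.
  have d5 := is_deriveM (is_deriveM d1 d2) d4.
  rewrite /q; apply: (@is_derive_eq _ _ _ _ _ _ _ _ d5).
  rewrite /dq /GRing.scale/= -[(r * derive1 f) u]/(r u * derive1 f u); field.
  by rewrite ne.
have dqle e u : 0 < e -> derive1 f u != 0 -> `|dq e u| <= g u.
  move=> e0 fu0.
  have := den e u e0; set D := _ + e => D0.
  have f20 : 0 < derive1 f u ^+ 2 by rewrite exprn_even_gt0.
  have fD : derive1 f u ^+ 2 <= D by rewrite lerDl ltW.
  apply: (le_trans (ler_normD _ _)).
  have -> : g u = r u * (`|derive1 r u / r u| / `|derive1 f u|) +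
      r u * (`|derive1 (derive1 f) u| / derive1 f u ^+ 2) by rewrite /g mulrDr.
  rewrite -/D; apply: lerD.
    rewrite [X in _ <= X](_ : _ = `|derive1 r u| / `|derive1 f u|); last first.
      rewrite normrM normrV ?unitfE ?gt_eqF// (gtr0_norm (r0 u)).
      by rewrite mulrA (mulrC (r u)) divfK// gt_eqF.
    rewrite !normrM normrV ?unitfE ?gt_eqF// (gtr0_norm D0) -mulrA.
    apply: ler_wpM2l => //.
    rewrite ler_pdivrMr// mulrC ler_pdivlMr ?normr_gt0//.
    by rewrite -normrM -expr2 ger0_norm// ltW.
  rewrite !normrM normrV ?unitfE ?gt_eqF ?exprn_gt0// (gtr0_norm (r0 u)).
  rewrite (@ger0_norm _ (D ^+ 2)) ?sqr_ge0// -!mulrA.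
  apply: ler_wpM2l; first exact: ltW.
  apply: ler_wpM2l => //.
  rewrite ler_pdivrMr ?exprn_gt0// mulrC ler_pdivlMr//.
  rewrite expr2; apply: ler_pM => //; first exact: ltW.
  by rewrite ler_norml /D; apply/andP; split; lra.
have mdq e : 0 < e -> measurable_fun setT (dq e).
  move=> e0; apply: measurable_funD; apply: measurable_funM.
  - exact: measurable_funM.
  - by apply: measurable_inv; apply: measurable_funD => //; exact: measurable_funX.
  - apply: measurable_funM; first exact: measurable_funM.
    by apply: measurable_funB => //; exact: measurable_funX.
  - by apply: measurable_inv; apply: measurable_funX; apply: measurable_funD => //; exact: measurable_funX.
have qB e u v : 0 < e -> u <= v -> `|q e v - q e u| <= B.
  move=> e0 uv.
  have intdq : (\int[mu]_(x in `[u, v]) (`|dq e x|)%:E <= B%:E)%E.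
    apply: le_trans intB.
    apply: (@le_trans _ _ (\int[mu]_x (`|dq e x|)%:E)%E).
      apply: ge0_subset_integral => //.
      by apply/measurable_EFinP; apply: measurable_abs; exact: mdq.
    apply: ae_ge0_le_integral => //.
    - by apply/measurable_EFinP; apply: measurable_abs; exact: mdq.
    - by move=> x _; rewrite lee_fin; exact: g0.
    - by apply/measurable_EFinP; exact: mg.
    - by apply: ae_imply aef => x fx _; rewrite lee_fin; exact: dqle.
  rewrite -lee_fin; apply: le_trans intdq.
  apply: (@normr_increment_le_integral (q e) (dq e) (fun x => `|dq e x|) u v uv) => [x _|x _||x].
  - exact: dqP.
  - exact: lexx.
  - by apply: measurable_abs; exact: mdq.
  - exact: normr_ge0.
have qsmall e d : 0 < e -> 0 < d -> exists v, `|q e v| < d.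
  move=> e0 d0; apply: contrapT => /forallNP big.
  move: intf; apply/negP; rewrite -leNgt leye_eq; apply/eqP.
  have intd : (\int[mu]_u d%:E = +oo)%E.
    rewrite integral_cst//=.
    rewrite (_ : mu setT = +oo%E) ?gt0_muley ?lte_fin//.
    by rewrite -set_itvNyy lebesgue_measure_itv.
  apply/eqP; rewrite -leye_eq -intd; apply: ae_ge0_le_integral => //.
  - by move=> u _; rewrite lee_fin ltW.
  - by move=> u _; rewrite lee_fin divr_ge0// ltW.
  - apply/measurable_EFinP; apply: measurable_funM => //.
    by apply: measurable_inv; exact: measurable_abs.
  - apply: ae_imply aef => u fu0 _; rewrite lee_fin.
    have /negP := big u; rewrite -leNgt => /le_trans; apply.
    rewrite /q !normrM normrV ?unitfE ?gt_eqF ?den// (gtr0_norm (r0 u)) (gtr0_norm (den _ _ _))// -mulrA.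
    apply: ler_wpM2l; first exact: ltW.
    rewrite ler_pdivrMr ?den// mulrC ler_pdivlMr ?normr_gt0// -normrM -expr2.
    by rewrite ger0_norm ?sqr_ge0// lerDl ltW.
have qle e u : 0 < e -> `|q e u| <= B.
  move=> e0; apply/ler_addgt0Pr => d d0; have [v qv] := qsmall e d e0 d0.
  rewrite -(subrK (q e v) (q e u)) (le_trans (ler_normD _ _))// lerD ?(ltW qv)//.
  by case: (leP v u) => [vu|/ltW uv]; [|rewrite distrC]; exact: qB.
(* the value e = f'(u)^2 turns |q| <= B into r u <= 2 B |f' u| *)
have rle0 u : derive1 f u != 0 -> r u <= 2 * B * `|derive1 f u|.
  move=> fu0; have e0 : 0 < derive1 f u ^+ 2 by rewrite exprn_even_gt0.
  have := qle _ u e0; rewrite /q.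
  have -> : r u * derive1 f u / (derive1 f u ^+ 2 + derive1 f u ^+ 2) = r u / (2 * derive1 f u).
    by field; rewrite fu0 gt_eqF//; lra.
  rewrite !normrM normrV ?unitfE ?mulf_neq0// normrM (gtr0_norm (r0 u)) (@ger0_norm _ 2)//.
  by rewrite ler_pdivrMr ?mulr_gt0 ?normr_gt0// => /le_trans; apply; lra.
have rle u : r u <= 2 * B * `|derive1 f u|.
  rewrite leNgt; apply/negP => ru.
  have /= [d d0 Hd] : \forall x \near u, 0 < r x - 2 * B * `|derive1 f x|.
    have cv : (r x - 2 * B * `|derive1 f x|) @[x --> u] --> (r u - 2 * B * `|derive1 f u|).
      apply: cvgB; first exact: cr.
      by apply: cvgM; [exact: cvg_cst|apply: cvg_norm; exact: cf1].
    by apply: (cvgr_gt _ cv); rewrite subr_gt0.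
  (* otherwise the strict inequality holds on an interval, of positive measure *)
  case: aef => N [mN N0 HN].
  have sub : (`]u - d, u + d[ `<=` N)%classic.
    move=> x /=; rewrite in_itv/= => xud; apply: HN => /=.
    by move=> /rle0; have := Hd x; rewrite /= ltr_distlC => /(_ xud); rewrite subr_gt0 => /lt_le_trans H /H; rewrite ltxx.
  have {}d0 : 0 < d := d0.
  pose I : set R := `]u - d, u + d[%classic.
  have : (mu I <= mu N)%E by apply: le_measure; rewrite ?inE//; exact: measurable_itv.
  rewrite N0 /I /= lebesgue_measure_itv/= lte_fin.
  have -> : u - d < u + d by lra.
  by rewrite -EFinB lee_fin leNgt => /negP; apply; lra.
have fn0 u : derive1 f u != 0.
  by apply/eqP => f0; have := rle u; rewrite f0 normr0 mulr0 leNgt r0.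
have fP x : derivable f x 1 /\ derive1 f x != 0 by [].
have := integral_cauchy_comp_le c a0 fP cf1.
move=> H; apply: (@le_trans _ _ ((2 * B)%:E * (pi / a)%:E)%E); last by rewrite -EFinM.
apply: le_trans (lee_wpmul2l _ H); last by rewrite lee_fin mulr_ge0.
have den2 u : 0 < 1 + (a * (f u - c)) ^+ 2 by rewrite ltr_wpDr// sqr_ge0.
have mfc : measurable_fun setT f.
  by apply: continuous_measurable_fun; exact: derivable1_continuous.
have mden : measurable_fun setT (fun u => (1 + (a * (f u - c)) ^+ 2)^-1).
  apply: measurable_inv; apply: measurable_funD => //; apply: measurable_funX.
  by apply: measurable_funM => //; exact: measurable_funB.
have mK : measurable_fun setT (fun u => `|derive1 f u| / (1 + (a * (f u - c)) ^+ 2)).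
  by apply: measurable_funM => //; exact: measurable_abs.
have K0 u : 0 <= `|derive1 f u| / (1 + (a * (f u - c)) ^+ 2).
  by rewrite divr_ge0// ltW.
rewrite -ge0_integralZl//; last 3 first.
- exact/measurable_EFinP.
- by move=> u _; rewrite lee_fin.
- by rewrite lee_fin mulr_ge0.
apply: ge0_le_integral => //.
- by move=> u _; rewrite lee_fin divr_ge0// ltW.
- by apply/measurable_EFinP; exact: measurable_funM.
- by apply/measurable_EFinP; exact: measurable_funM.
- move=> u _; rewrite -EFinM lee_fin mulrA ler_wpM2r//.
  by rewrite invr_ge0 ltW.
Qed.
End densities.

(** * Inverse slopes along one path *)

Section moments.
Context {R : realType}.
Notation mu := (@lebesgue_measure R).

(** Jensen's inequality, obtained by integrating the tangent
    4 a^3 x <= x^4 + 3 a^4; the value a = 1 shows first that B is finite. *)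
Lemma fourth_moment_ge (r X : R -> R) :
  measurable_fun setT r -> measurable_fun setT X ->
  (forall u, 0 <= r u) -> (forall u, 0 <= X u) ->
  (\int[mu]_u (r u)%:E = 1)%E ->
  (\int[mu]_u (r u * X u ^+ 4)%:E < +oo)%E ->
  exists B : R, [/\ 0 <= B, (\int[mu]_u (r u * X u)%:E = B%:E)%E &
    ((B ^+ 4)%:E <= \int[mu]_u (r u * X u ^+ 4)%:E)%E].
Proof.
move=> mr mX r0 X0 r1 fin.
have mrX : measurable_fun setT (fun u => r u * X u) by exact: measurable_funM.
have mrX4 : measurable_fun setT (fun u => r u * X u ^+ 4).
  by apply: measurable_funM => //; exact: measurable_funX.
have rX0 u : 0 <= r u * X u by rewrite mulr_ge0.
have rX40 u : 0 <= r u * X u ^+ 4 by rewrite mulr_ge0// exprn_ge0.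
have i0 := integral_real_ge0 mu setT rX0.
have i40 := integral_real_ge0 mu setT rX40.
have tangent (a x : R) : 0 <= a -> 0 <= x -> 4 * a ^+ 3 * x <= x ^+ 4 + 3 * a ^+ 4.
  move=> a0 x0; have -> : x ^+ 4 + 3 * a ^+ 4 = 4 * a ^+ 3 * x +
     (x - a) ^+ 2 * (x ^+ 2 + 2 * a * x + 3 * a ^+ 2) by ring.
  by rewrite lerDl mulr_ge0 ?sqr_ge0// !addr_ge0 ?mulr_ge0 ?sqr_ge0.
have key (a : R) : 0 <= a -> ((4 * a ^+ 3)%:E * \int[mu]_u (r u * X u)%:E <=
    \int[mu]_u (r u * X u ^+ 4)%:E + (3 * a ^+ 4)%:E)%E.
  move=> a0; have a3 : 0 <= 4 * a ^+ 3 by rewrite mulr_ge0 ?exprn_ge0.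
  have a4 : 0 <= 3 * a ^+ 4 by rewrite mulr_ge0 ?exprn_ge0.
  rewrite -[(3 * a ^+ 4)%:E]mule1 -r1.
  rewrite -(integral_realZ mu measurableT mrX rX0 a3) -(integral_realZ mu measurableT mr r0 a4).
  rewrite -(integral_realD mu measurableT mrX4 (measurable_funM (measurable_cst _) mr) rX40 (fun u => mulr_ge0 a4 (r0 u))).
  apply: integral_real_le => //.
  - exact: measurable_funM.
  - by apply: measurable_funD => //; exact: measurable_funM.
  - by move=> u; rewrite mulr_ge0.
  - move=> u _; rewrite [leLHS](_ : _ = r u * (4 * a ^+ 3 * X u)); last by ring.
    rewrite [leRHS](_ : _ = r u * (X u ^+ 4 + 3 * a ^+ 4)); last by rewrite /=; ring.
    by apply: ler_wpM2l => //; exact: tangent.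
have ifin : (\int[mu]_u (r u * X u)%:E)%E \is a fin_num.
  rewrite ge0_fin_numE//.
  have := key 1 ler01; rewrite !expr1n !mulr1 => H.
  apply: (@le_lt_trans _ _ (4%:E * \int[mu]_u (r u * X u)%:E)%E).
    by rewrite lee_pemull// lee_fin ler1n.
  by apply: (le_lt_trans H); rewrite lte_add_pinfty// ltry.
exists (fine (\int[mu]_u (r u * X u)%:E)); split.
- exact: fine_ge0.
- by rewrite fineK.
- have := key _ (fine_ge0 i0).
  rewrite -{2}(fineK ifin) -EFinM.
  have f4 : (\int[mu]_u (r u * X u ^+ 4)%:E)%E \is a fin_num by rewrite ge0_fin_numE.
  rewrite -(fineK f4) -EFinD !lee_fin.
  set B := fine _; rewrite [leLHS](_ : _ = 4 * B ^+ 4); last by ring.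
  by lra.
Qed.

(** On this set the weight r u may be traded for 2 r (u + s), so that
    translating an integral costs a factor 2. The sets exhaust the line as h tends to 0
    ([near_slowly_decreasing]). *)
Definition slowly_decreasing (r : R -> R) (h : R) : set R :=
  [set u | forall s, 0 <= s <= h -> r u <= 2 * r (u + s)].

(** An intersection of closed sets, so that the uncountably many shifts do no
    harm. *)
Lemma measurable_slowly_decreasing (r : R -> R) h : continuous r ->
  measurable (slowly_decreasing r h).
Proof.
move=> cr.
rewrite (_ : slowly_decreasing r h =
  \bigcap_(s in [set s | 0 <= s <= h]) (fun u => r u - 2 * r (u + s)) @^-1` [set x | x <= 0]); last first.
  by apply/seteqP; split => u /= H s /= /H /=; rewrite subr_le0.
apply: closed_measurable; apply: closed_bigI => s _.
apply: (@preimage_closed _ _ _ _ _ (@closed_le _ 0)) => u _.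
apply: cvgB; first exact: cr.
apply: cvgM; first exact: cvg_cst.
apply: (@continuous_comp _ _ _ (fun u : R => u + s) r); last exact: cr.
by apply: cvgD; [exact: cvg_id|exact: cvg_cst].
Qed.

Lemma near_slowly_decreasing (r : R -> R) u : continuous r -> 0 < r u ->
  \forall n \near \oo, slowly_decreasing r n.+1%:R^-1 u.
Proof.
move=> cr r0.
have /cr : (nbhs (r u)) [set y | r u / 2 < y].
  by apply: (@open_gt _ (r u / 2)) => /=; lra.
rewrite /= => -[e /= e0 He].
near=> n; move=> s /andP[s0 sn].
have : r u / 2 < r (u + s).
  apply: He => /=; rewrite opprD addNKr normrN ger0_norm//.
  apply: (le_lt_trans sn).
  by near: n; exact: near_infty_natSinv_lt (PosNum e0).
by lra.
Unshelve. all: by end_near. Qed.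

(** By [mean_inverse_slope] the inverse power of the quotient at u is at most
    the mean of |f'|^-k over [u, u + h], and on the slowly decreasing set r u is
    at most 2 r at each point of this interval. By Tonelli's theorem and
    translation invariance these means integrate to the right-hand side. The
    parameter delta makes the left-hand side a Lipschitz function of the
    quotient ([regularized_inverse_lipschitz]), for the passage from the inner
    averages to phi. *)
Lemma integral_inverse_slope_le (f r : R -> R) (h delta : R) (k : nat) :
  0 < h -> 0 < delta -> (forall u, 0 <= r u) -> continuous r ->
  (forall u, derivable f u 1 /\ derive1 f u != 0) ->
  (\int[mu]_u (\1_(slowly_decreasing r h) u *
       (`|(f (u + h) - f u) / h| + delta)^-1 ^+ k * r u)%:E <=
   2%:E * \int[mu]_u ((`|derive1 f u|^-1) ^+ k * r u)%:E)%E.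
Proof.
move=> h0 delta0 r0 cr df.
pose K := slowly_decreasing r h.
have mK : measurable K by exact: measurable_slowly_decreasing.
have df1 u : derivable f u 1 by case: (df u).
have mr : measurable_fun setT r by exact: continuous_measurable_fun.
have mf1 := measurable_derive1 df1.
pose g u := (`|derive1 f u|^-1) ^+ k.
have mg : measurable_fun setT g.
  apply: measurable_funX; apply: measurable_inv.
  exact: measurable_abs.
have g0 u : 0 <= g u by rewrite exprn_ge0 ?invr_ge0.
have mgr : measurable_fun setT (fun u => (g u * r u)%:E).
  by apply/measurable_EFinP; exact: measurable_funM.
have gr0 u : (0 <= (g u * r u)%:E)%E by rewrite lee_fin mulr_ge0.
have gr0' u : 0 <= g u * r u by rewrite mulr_ge0.
have mgr' : measurable_fun setT (fun u => g u * r u) by exact: measurable_funM.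
have mI : measurable_fun setT (\1_(`[0, h]%classic : set R) : R -> R) by exact: measurable_indic.
have mtr (s : R) : measurable_fun setT (fun u : R => g (u + s) * r (u + s)).
  have madd : measurable_fun setT (fun z : R => z + s) by exact: measurable_funD.
  exact: (measurableT_comp mgr' madd).
pose G (z : R * R) : R := g (z.1 + z.2) * r (z.1 + z.2) * \1_(`[0, h]%classic : set R) z.2.
have G0 z : 0 <= G z by rewrite !mulr_ge0.
have mG : @measurable_fun _ _ (measurableTypeR R * measurableTypeR R)%type _ setT G.
  apply: measurable_funM; last exact: (measurableT_comp mI measurable_snd).
  have madd : measurable_fun setT (fun z : R * R => z.1 + z.2) by exact: measurable_funD.
  by apply: measurable_funM; [exact: (measurableT_comp mg madd)|exact: (measurableT_comp mr madd)].
have mGE : @measurable_fun _ _ (measurableTypeR R * measurableTypeR R)%type _ setT (EFin \o G).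
  exact/measurable_EFinP.
(* each point is covered by intervals [u, u + h] with u in a set of length h *)
have swap : (\int[mu]_u \int[mu]_s (G (u, s))%:E = (\int[mu]_u (g u * r u)%:E) * h%:E)%E.
  rewrite (@fubini_tonelli _ _ (measurableTypeR R) (measurableTypeR R) R lebesgue_measure lebesgue_measure (EFin \o G) mGE (fun z => G0 z)).
  transitivity (\int[mu]_s ((\int[mu]_u (g u * r u)%:E) * (\1_(`[0, h]%classic : set R) s)%:E))%E.
    apply: eq_integral => s _.
    rewrite -(integral_translation s mgr gr0) muleC.
    rewrite -(integral_realZ mu measurableT (mtr s)) //.
    by apply: eq_integral => u _; rewrite /G/= mulrC.
  rewrite ge0_integralZl//;
    try solve [exact/measurable_EFinP | by apply: integral_real_ge0 | by move=> s _; rewrite lee_fin].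
  rewrite integral_indic// setIT; congr (_ * _)%E.
  by apply: (etrans (lebesgue_measure_itv _)); rewrite /= lte_fin h0 sube0.
have le1 u : (\1_K u * (`|(f (u + h) - f u) / h| + delta)^-1 ^+ k * r u <=
    \1_K u * (h / `|f (u + h) - f u|) ^+ k * r u).
  apply: ler_wpM2r => //; apply: ler_wpM2l => //.
  have fh : 0 < `|f (u + h) - f u|.
    rewrite normr_gt0 subr_eq0; apply/eqP => /(derive1_neq0_injective df) /eqP.
    by rewrite -subr_eq0 addrC addKr gt_eqF.
  apply: lerXn2r; rewrite ?nnegrE ?invr_ge0 ?divr_ge0 ?addr_ge0 ?(ltW delta0) ?(ltW h0)//.
  rewrite -[leRHS]invrK invfM invrK mulrC.
  rewrite normrM normfV (gtr0_norm h0) lef_pV2 ?posrE; first by rewrite lerDl ltW.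
    by rewrite ltr_wpDl// mulr_ge0// invr_ge0 ltW.
  by rewrite mulr_gt0 ?invr_gt0.
have le2 u : ((h * (\1_K u * (h / `|f (u + h) - f u|) ^+ k * r u))%:E <=
    2%:E * \int[mu]_s (G (u, s))%:E)%E.
  have [uK|uK] := pselect (K u); last first.
    rewrite indicE memNset// !mul0r mulr0 mule_ge0//.
    exact: integral_real_ge0.
  rewrite indicE mem_set// mul1r.
  have uh : u < u + h by rewrite ltrDl.
  have := mean_inverse_slope k uh df.
  rewrite (_ : u + h - u = h); last by ring.
  move=> H.
  have ru0 := r0 u.
  have := lee_wpmul2l (_ : (0 <= (r u)%:E)%E) H; rewrite lee_fin => /(_ ru0) H1.
  rewrite [leLHS](_ : _ = ((r u)%:E * ((h / `|f (u + h) - f u|) ^+ k * h)%:E)%E); last first.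
    by rewrite -EFinM; congr EFin; ring.
  apply: (le_trans H1).
  rewrite -(integral_realZ mu _ mg g0 ru0)//=.
  apply: (@le_trans _ _ (2%:E * \int[mu]_(v in `[u, (u + h)%R]) (g v * r v)%:E)%E).
    rewrite -(integral_realZ mu _ mgr' gr0')//=.
    apply: integral_real_le => //=.
    - exact: measurable_funM.
    - exact: measurable_funM.
    - by move=> v; rewrite mulr_ge0.
    - move=> v; rewrite in_itv/= => /andP[uv vu].
      have := uK (v - u); rewrite subr_ge0 uv lerBlDl vu => /(_ isT).
      rewrite [u + _]addrC subrK => rr.
      rewrite [leRHS](_ : _ = 2 * r v * g v); last by ring.
      exact: ler_wpM2r.
  apply: lee_wpmul2l => //.
  rewrite integral_mkcond -(integral_translation u); last 2 first.
  - by apply/(measurable_restrictT _ _).1 => //; exact: measurable_funTS.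
  - by move=> v; rewrite patchE; case: ifP.
  apply: eq_leW; apply: eq_integral => s _; rewrite patchE /G/= indicE.
  rewrite (_ : (s + u \in `[u, u + h]%classic) = (s \in `[0, h]%classic)); last first.
    by apply/idP/idP; rewrite !inE/= !in_itv/= => /andP[? ?]; apply/andP; split; lra.
  have -> : u + s = s + u by rewrite addrC.
  by case: ifP => _; rewrite ?mulr1 ?mulr0.
rewrite -(@lee_pmul2l _ h%:E)//= ?lte_fin//.
have swap' : (h%:E * \int[mu]_u (g u * r u)%:E = \int[mu]_u \int[mu]_s (G (u, s))%:E)%E by rewrite swap muleC.
rewrite [leRHS]muleCA [X in (_ <= _ * X)%E]swap'.
pose a u := \1_K u * (`|(f (u + h) - f u) / h| + delta)^-1 ^+ k * r u.
have mf : measurable_fun setT f.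
  by apply: continuous_measurable_fun; exact: derivable1_continuous.
have ma : measurable_fun setT a.
  have ms : measurable_fun setT (fun u : R => (f (u + h) - f u) / h).
    have madd : measurable_fun setT (fun z : R => z + h) by exact: measurable_funD.
    apply: measurable_funM => //; apply: measurable_funB => //.
    exact: (measurableT_comp mf madd).
  apply: measurable_funM => //; apply: measurable_funM; first exact: measurable_indic.
  apply: measurable_funX; apply: measurable_inv.
  apply: measurable_funD => //; exact: measurable_abs.
have a0 u : 0 <= a u.
  by rewrite !mulr_ge0// exprn_ge0// invr_ge0 addr_ge0// ltW.
rewrite -(integral_realZ mu measurableT ma a0 (ltW h0)).
have mI2 : measurable_fun setT (fun u : R => \int[mu]_s (G (u, s))%:E)%E.
  exact: (@measurable_fun_fubini_tonelli_F _ _ (measurableTypeR R) (measurableTypeR R) R lebesgue_measure _ mGE (fun z => G0 z)).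
rewrite -ge0_integralZl//;
  try solve [exact: mI2 | by move=> u _; exact: integral_real_ge0].
apply: ge0_le_integral => //.
- by move=> u _; rewrite lee_fin mulr_ge0// ltW.
- by apply/measurable_EFinP; exact: measurable_funM.
- exact: measurable_funeM.
- move=> u _; apply: le_trans (le2 u); rewrite lee_fin.
  by apply: ler_wpM2l; [exact: ltW|exact: le1].
Qed.
End moments.

(** * Elementary inequalities *)

Section scalar.
Context {R : realType}.
Implicit Types (x y z s c t : R).

(** Put w = s (x - c) and z = s (y - x). The indicators differ only if
    |w| <= |z|. If |w| <= t, the first term is at least 1; if t < |w|, then
    (1 + |z|)^4 >= t^2 (1 + w^2) and the second is. *)
Lemma indicator_gap_le x y c s t : 0 < s -> 0 < t ->
  `|(if c < y then 1 else 0) - (if c < x then 1 else 0) : R| <=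
  2 * (1 + (s / t * (x - c)) ^+ 2)^-1 +
  (t ^+ 2)^-1 * ((1 + `|s * (y - x)|) ^+ 4 / (1 + (s * (x - c)) ^+ 2)).
Proof.
move=> s0 t0; pose z := `|s * (y - x)|; pose w := s * (x - c).
have z0 : 0 <= z by exact: normr_ge0.
have e1 : 0 < 1 + (s / t * (x - c)) ^+ 2 by rewrite ltr_wpDr// sqr_ge0.
have e2 : 0 < 1 + w ^+ 2 by rewrite ltr_wpDr// sqr_ge0.
have p1 : 0 <= 2 * (1 + (s / t * (x - c)) ^+ 2)^-1 by rewrite mulr_ge0// invr_ge0 ltW.
have p2 : 0 <= (t ^+ 2)^-1 * ((1 + z) ^+ 4 / (1 + w ^+ 2)).
  apply: mulr_ge0; first by rewrite invr_ge0 sqr_ge0.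
  by apply: divr_ge0; [rewrite exprn_ge0// addr_ge0|exact: ltW].
have [wz|zw] := leP `|w| z; last first.
  suff -> : (c < y) = (c < x) by rewrite subrr normr0 addr_ge0.
  move: zw; rewrite /z /w !normrM (gtr0_norm s0) ltr_pM2l//.
  have [cx|xc] := ltP c x.
    rewrite (gtr0_norm (_ : 0 < x - c)) ?subr_gt0// ltr_norml => /andP[h1 h2].
    by apply/idP; lra.
  rewrite (ler0_norm (_ : x - c <= 0)) ?subr_le0// ltr_norml => /andP[h1 h2].
  by apply/negP/negP; rewrite -leNgt; lra.
apply: (@le_trans _ _ 1).
  by case: ifP => _; case: ifP => _; rewrite ?subrr ?subr0 ?sub0r ?normrN ?normr0 ?normr1.
have [wt|tw] := leP `|w| t.
  apply: (@le_trans _ _ (2 * (1 + (s / t * (x - c)) ^+ 2)^-1)); last by rewrite lerDl.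
  rewrite ler_pdivlMr// mul1r.
  have -> : (s / t * (x - c)) ^+ 2 = (`|w| / t) ^+ 2.
    by rewrite !exprMn real_normK ?num_real// /w exprMn; ring.
  have : (`|w| / t) ^+ 2 <= 1.
    by rewrite expr_le1 ?divr_ge0 ?(ltW t0)// ler_pdivrMr// mul1r.
  by lra.
apply: (@le_trans _ _ ((t ^+ 2)^-1 * ((1 + z) ^+ 4 / (1 + w ^+ 2)))); last by rewrite lerDr.
rewrite mulrC ler_pdivlMr ?exprn_gt0// mul1r ler_pdivlMr//.
have h1 : 1 + w ^+ 2 <= (1 + z) ^+ 2.
  have : w ^+ 2 <= z ^+ 2 by rewrite -(real_normK (num_real w)) lerXn2r ?nnegrE.
  by nra.
have h2 : t ^+ 2 <= (1 + z) ^+ 2.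
  by rewrite lerXn2r ?nnegrE ?addr_ge0 ?(ltW t0)//; lra.
have -> : (1 + z) ^+ 4 = (1 + z) ^+ 2 * (1 + z) ^+ 2 by ring.
by apply: ler_pM => //; [exact: sqr_ge0|exact: ltW].
Qed.

(** The choice t = H / (2 k b) makes the first term H / 2. If k b = 0, large
    values of t show that H = 0. *)
Lemma balance_le (H b Y k : R) : 0 <= H -> 0 <= b -> 0 <= Y -> 0 <= k ->
  (forall t, 0 < t -> H <= k * b * t + Y / t ^+ 2) ->
  H ^+ 3 <= 8 * (k * b) ^+ 2 * Y.
Proof.
move=> H0 b0 Y0 k0 Ht.
have [->|Hn0] := eqVneq H 0.
  by rewrite expr0n/= !mulr_ge0// sqr_ge0.
have Hp : 0 < H by rewrite lt_neqAle eq_sym Hn0.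
have [kb0|kbn0] := eqVneq (k * b) 0.
  (* so large that Y / t^2 <= Y / t < H *)
  exfalso; pose t := 1 + 2 * Y / H.
  have q0 : 0 <= 2 * Y / H by rewrite divr_ge0 ?mulr_ge0.
  have t1 : 1 <= t by rewrite lerDl.
  have t0 : 0 < t by apply: lt_le_trans t1.
  have := Ht t t0; rewrite kb0 mul0r add0r ler_pdivlMr ?exprn_gt0// => h.
  have : H * t <= Y.
    apply: le_trans h; rewrite ler_pM2l// -[leLHS]expr1; exact: ler_weXn2l.
  have -> : H * t = H + 2 * Y by rewrite /t; field.
  by lra.
have kb : 0 < k * b by rewrite lt_neqAle eq_sym kbn0 mulr_ge0.
have t0 : 0 < H / (2 * (k * b)) by rewrite divr_gt0// mulr_gt0.
have := Ht _ t0; move: (k * b) kb kbn0 => c c0 cn0.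
have -> : c * (H / (2 * c)) = H / 2 by field.
have -> : Y / (H / (2 * c)) ^+ 2 = 4 * c ^+ 2 * Y / H ^+ 2.
  by field; rewrite Hn0 cn0.
move=> h; have : H / 2 <= 4 * c ^+ 2 * Y / H ^+ 2 by lra.
rewrite ler_pdivlMr ?exprn_gt0// => h2.
rewrite [leLHS](_ : _ = 2 * (H / 2 * H ^+ 2)); last by field.
by lra.
Qed.

(** Otherwise (k + 1)^3 (b^2 + Y)^3 < H^6 <= k^2 b^2 Y^2, which is absurd
    because b^2 + Y is at least b^2 and at least Y. *)
Lemma cube_le_sqr (H b Y k : R) : 0 <= H -> 0 <= b -> 0 <= Y -> 0 <= k ->
  H ^+ 3 <= k * b * Y -> H ^+ 2 <= (k + 1) * (b ^+ 2 + Y).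
Proof.
move=> H0 b0 Y0 k0 h; rewrite leNgt; apply/negP => lt.
pose A := b ^+ 2 + Y.
have b20 : 0 <= b ^+ 2 by rewrite sqr_ge0.
have A0 : 0 <= A by rewrite addr_ge0.
have k1 : 0 < k + 1 by lra.
have lt6 : ((k + 1) * A) ^+ 3 < (H ^+ 2) ^+ 3.
  by rewrite ltrXn2r// ?nnegrE// ?mulr_ge0// ltW.
have le6 : (H ^+ 3) ^+ 2 <= (k * b * Y) ^+ 2.
  by rewrite lerXn2r ?nnegrE ?exprn_ge0 ?mulr_ge0.
have : (k * b * Y) ^+ 2 <= ((k + 1) * A) ^+ 3.
  have e1 : b ^+ 2 * Y ^+ 2 <= A ^+ 3.
    have -> : A ^+ 3 = A * A ^+ 2 by ring.
    apply: ler_pM => //; first exact: sqr_ge0.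
      by rewrite lerDl.
    by rewrite lerXn2r ?nnegrE// lerDr.
  have e2 : k ^+ 2 <= (k + 1) ^+ 3 by nra.
  rewrite !exprMn -mulrA; apply: ler_pM => //; rewrite ?mulr_ge0 ?sqr_ge0//.
move=> /(le_trans le6); rewrite -!exprM => le6'.
by have := lt_le_trans lt6 (le_trans _ le6'); rewrite -exprM lexx => /(_ isT); rewrite ltxx.
Qed.

(** Separates the score p, the inverse slope q and the curvature s, whose
    moments are bounded one by one. *)
Lemma fourth_power_sum_le (p q s : R) :
  0 <= p -> 0 <= q -> 0 <= s ->
  (p * q + s * q ^+ 2) ^+ 4 <= 4 * (p ^+ 8 + q ^+ 8 + s ^+ 8 + q ^+ 16).
Proof.
move=> p0 q0 s0; set a := p * q; set b := s * q ^+ 2.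
have sum4 : (a + b) ^+ 4 <= 8 * (a ^+ 4 + b ^+ 4).
  have h2 : (a + b) ^+ 2 <= 2 * (a ^+ 2 + b ^+ 2) by have := sqr_ge0 (a - b); nra.
  have h4 : ((a + b) ^+ 2) ^+ 2 <= (2 * (a ^+ 2 + b ^+ 2)) ^+ 2.
    by rewrite lerXn2r ?nnegrE ?sqr_ge0// mulr_ge0 ?addr_ge0 ?sqr_ge0.
  rewrite -exprM in h4; apply: (le_trans h4).
  have := sqr_ge0 (a ^+ 2 - b ^+ 2).
  rewrite [(a ^+ 2 - b ^+ 2) ^+ 2](_ : _ = a ^+ 4 + b ^+ 4 - 2 * (a ^+ 2 * b ^+ 2)); last by ring.
  rewrite (_ : (2 * (a ^+ 2 + b ^+ 2)) ^+ 2 = 4 * (a ^+ 4 + b ^+ 4 + 2 * (a ^+ 2 * b ^+ 2))); last by ring.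
  by lra.
have ha : 2 * a ^+ 4 <= p ^+ 8 + q ^+ 8.
  have := sqr_ge0 (p ^+ 4 - q ^+ 4); rewrite /a.
  rewrite [X in 0 <= X -> _](_ : _ = p ^+ 8 + q ^+ 8 - 2 * (p * q) ^+ 4); last by ring.
  by lra.
have hb : 2 * b ^+ 4 <= s ^+ 8 + q ^+ 16.
  have := sqr_ge0 (s ^+ 4 - q ^+ 8); rewrite /b.
  rewrite [X in 0 <= X -> _](_ : _ = s ^+ 8 + q ^+ 16 - 2 * (s * q ^+ 2) ^+ 4); last by ring.
  by lra.
by lra.
Qed.

Lemma regularized_inverse_lipschitz (delta : R) (k : nat) : 0 < delta ->
  exists2 C : R, 0 <= C & forall x y,
    (`|x| + delta)^-1 ^+ k <= (`|y| + delta)^-1 ^+ k + C * `|x - y|.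
Proof.
move=> d0.
have den0 x : 0 < `|x| + delta by rewrite ltr_wpDl.
have invd x : (`|x| + delta)^-1 <= delta^-1.
  by rewrite lef_pV2 ?posrE// lerDr.
have inv0 x : 0 <= (`|x| + delta)^-1 by rewrite invr_ge0 ltW.
have lip1 x y : (`|x| + delta)^-1 <= (`|y| + delta)^-1 + delta^-1 ^+ 2 * `|x - y|.
  have xy : `|y| - `|x| <= `|x - y|.
    by rewrite distrC lerB_dist.
  rewrite -lerBlDl.
  have -> : (`|x| + delta)^-1 - (`|y| + delta)^-1 =
      (`|x| + delta)^-1 * (`|y| + delta)^-1 * (`|y| - `|x|).
    by field; rewrite !gt_eqF.
  apply: (@le_trans _ _ ((`|x| + delta)^-1 * (`|y| + delta)^-1 * `|x - y|)).
    by apply: ler_wpM2l; rewrite ?mulr_ge0.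
  by apply: ler_wpM2r => //; rewrite expr2; exact: ler_pM.
elim: k => [|k [C C0 IH]].
  by exists 0 => // x y; rewrite !expr0 mul0r addr0.
exists (delta^-1 * C + delta^-1 ^+ k * delta^-1 ^+ 2).
  by rewrite addr_ge0 ?mulr_ge0 ?exprn_ge0 ?invr_ge0 ?(ltW d0).
move=> x y; have := IH x y; have := lip1 x y; have := invd x; have := inv0 x.
have : (`|y| + delta)^-1 ^+ k <= delta^-1 ^+ k.
  by rewrite lerXn2r ?nnegrE// invr_ge0 ltW.
have : 0 <= (`|y| + delta)^-1 ^+ k by rewrite exprn_ge0.
rewrite ![_ ^+ k.+1]exprSr; set p := (`|x| + delta)^-1; set q := (`|y| + delta)^-1.
have D0 : 0 <= `|x - y| by []; move: (`|x - y|) D0 => D D0.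
set a := p ^+ k; set b := q ^+ k; move=> b0 bd p0 pd pq ab.
have step1 : a * p <= b * p + C * D * delta^-1.
  apply: (@le_trans _ _ ((b + C * D) * p)); first exact: ler_wpM2r.
  by rewrite mulrDl lerD2l ler_wpM2l// mulr_ge0.
have step2 : b * p <= b * q + delta^-1 ^+ k * (delta^-1 ^+ 2 * D).
  apply: (@le_trans _ _ (b * (q + delta^-1 ^+ 2 * D))); first exact: ler_wpM2l.
  by rewrite mulrDr lerD2l ler_wpM2r// mulr_ge0// sqr_ge0.
by move: step1 step2; rewrite mulrDl; lra.
Qed.
End scalar.

(** * Infinite sequences of noises *)

Section infinite_paths.
Context {dW dE : measure_display}.

Definition cylinders (W : measurableType dW) (E : measurableType dE) :
    set_system (W * (nat -> E)) :=
  [set C | exists (n : nat) (A : set W) (B : nat -> set E),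
    [/\ measurable A, (forall j, measurable (B j)) &
        C = [set v | A v.1 /\ forall j, (j < n)%N -> B j (v.2 j)]]].
Arguments cylinders : clear implicits.

(** omega_(-1) together with the whole sequence of inner noises. The
    independence hypotheses concern finitely many noises at a time, that is
    cylinders, which form a pi-system and so determine a law. *)
Definition path_space (W : measurableType dW) (E : measurableType dE) :=
  g_sigma_algebraType (cylinders W E).

HB.instance Definition _ W E := Measurable.on (path_space W E).

Context (W : measurableType dW) (E : measurableType dE).

Lemma setI_closed_cylinders : setI_closed (cylinders W E).
Proof.
move=> _ _ [n [A [B [mA mB ->]]]] [n' [A' [B' [mA' mB' ->]]]].
exists (maxn n n'), (A `&` A').
exists (fun j => (if (j < n)%N then B j else setT) `&` (if (j < n')%N then B' j else setT)).
split.
- exact: measurableI.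
- by move=> j; apply: measurableI; case: ifP.
apply/seteqP; split => [[w e] /= [[Aw Be] [A'w B'e]]|[w e] /= [[Aw A'w] H]].
  by split => // j _; split; case: ifP => // jn; [exact: Be|exact: B'e].
split; split => // j jn.
- have [|] := H j; first by rewrite leq_max jn.
  by rewrite jn.
- have [|_] := H j; first by rewrite leq_max jn orbT.
  by rewrite jn.
Qed.

Lemma cylindersT : cylinders W E setT.
Proof.
exists 0%N, setT, (fun=> setT); split => //.
by apply/seteqP; split.
Qed.

Lemma measurable_path_head : @measurable_fun _ _ (path_space W E) W setT fst.
Proof.
move=> _ A mA; rewrite setTI; apply: sub_sigma_algebra.
exists 0%N, A, (fun=> setT); split => //.
by apply/seteqP; split => v //= [].
Qed.

Lemma measurable_path_coord (j : nat) :
  @measurable_fun _ _ (path_space W E) E setT (fun v => v.2 j).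
Proof.
move=> _ A mA; rewrite setTI; apply: sub_sigma_algebra.
exists j.+1, setT, (fun i => if i == j then A else setT); split => //.
  by move=> i; case: ifP.
apply/seteqP; split => v /= => [Av|[_ /(_ j)]].
  by split => // i _; case: eqP => [->|].
by rewrite eqxx; apply.
Qed.

Lemma measurable_path d (T : measurableType d) (V : T -> path_space W E) :
  measurable_fun setT (fun t => (V t).1) ->
  (forall j, measurable_fun setT (fun t => (V t).2 j)) -> measurable_fun setT V.
Proof.
move=> mV1 mV2; apply: (@measurability _ _ T (path_space W E) setT V (cylinders W E) erefl).
move=> _ [C [n [A [B [mA mB ->]]]] <-].
have -> : setT `&` V @^-1` [set v | A v.1 /\ forall j, (j < n)%N -> B j (v.2 j)] =
   (fun t => (V t).1) @^-1` A `&`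
   \bigcap_(j in [set j | (j < n)%N]) ((fun t => (V t).2 j) @^-1` B j).
  by rewrite setTI.
apply: measurableI; first by rewrite -[X in measurable X]setTI; exact: mV1.
have mB' j : measurable ((fun t => (V t).2 j) @^-1` B j).
  by rewrite -[X in measurable X]setTI; exact: mV2.
case: n => [|n].
  rewrite (_ : \bigcap_(j in _) _ = setT); first exact: measurableT.
  by apply/seteqP; split => // t _ j.
by apply: bigcap_measurable => //; exists 0%N.
Qed.
End infinite_paths.

Section independence.
Context {R : realType} d (T : measurableType d) (P : probability T R).

Lemma probability_path_unique dW dE (W : measurableType dW) (E : measurableType dE)
    (m1 m2 : {measure set (path_space W E) -> \bar R}) :
  (m1 setT < +oo)%E -> (forall C, cylinders C -> m1 C = m2 C) ->
  forall C, measurable C -> m1 C = m2 C.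
Proof.
move=> fin H; apply: (@measure_unique _ R (path_space W E) (@cylinders _ _ W E) (fun=> setT) erefl) => //.
- exact: setI_closed_cylinders.
- by move=> _; exact: cylindersT.
- by rewrite bigcup_const.
Qed.

Definition independent_maps d1 d2 (S1 : measurableType d1) (S2 : measurableType d2)
    (U : T -> S1) (V : T -> S2) :=
  forall A B, measurable A -> measurable B ->
    P (U @^-1` A `&` V @^-1` B) = (P (U @^-1` A) * P (V @^-1` B))%E.

(** Both sides are finite measures in C which agree on cylinders. *)
Lemma independent_path dW dE (W : measurableType dW) (E : measurableType dE)
    (V : {mfun T >-> path_space W E}) (A : set T) : measurable A ->
  (forall C, cylinders C -> P (A `&` V @^-1` C) = (P A * P (V @^-1` C))%E) ->
  forall C, measurable C -> P (A `&` V @^-1` C) = (P A * P (V @^-1` C))%E.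
Proof.
move=> mA H C mC.
have PA : P A = (fine (P A))%:E by rewrite fineK// fin_num_measure.
have PA0 : (0 <= fine (P A))%R by exact: fine_ge0.
have mV : measurable_fun setT V by [].
pose m1 : {measure set (path_space W E) -> \bar R} :=
  @measure_function_pushforward__canonical__measure_function_Measure _ _ _ _ _ (mrestr P mA) _ mV.
pose m2 : {measure set (path_space W E) -> \bar R} := mscale (NngNum PA0) (distribution P V).
have -> : P (A `&` V @^-1` C) = m1 C by rewrite /m1/= /pushforward /mrestr setIC.
rewrite PA -[RHS]/(m2 C).
apply: probability_path_unique => //.
  by rewrite /m1/= /pushforward/= preimage_setT /mrestr setTI (le_lt_trans (probability_le1 _ _)) ?ltry.
move=> D /H; rewrite /m1 /m2/= /pushforward /mrestr /mscale/= setIC => ->.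
by rewrite {1}PA.
Qed.

(** The law of (U, V) is a product measure; U is integrated out first. *)
Lemma expectation_independent d1 d2 (S1 : measurableType d1) (S2 : measurableType d2)
    (U : {mfun T >-> S1}) (V : {mfun T >-> S2}) (g : S1 * S2 -> \bar R) :
  independent_maps U V -> measurable_fun setT g -> (forall z, 0 <= g z)%E ->
  (\int[P]_t g (U t, V t) = \int[P]_t \int[distribution P U]_u g (u, V t))%E.
Proof.
move=> indUV mg g0.
have mUV : measurable_fun setT (fun t => (U t, V t)) by exact: measurable_fun_pair.
pose m1 : {measure set (S1 * S2) -> \bar R} :=
  @measure_function_pushforward__canonical__measure_function_Measure _ _ _ _ _ P _ mUV.
transitivity (\int[m1]_(z in setT) g z)%E.
  by rewrite ge0_integral_pushforward// preimage_setT.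
transitivity (\int[(distribution P U \x distribution P V)%E]_(z in setT) g z)%E.
  apply: eq_measure_integral => C mC _.
  by apply/esym; apply: product_measure_unique.
rewrite fubini_tonelli2// ge0_integral_distribution//.
  exact: measurable_fun_fubini_tonelli_G.
by move=> v; apply: integral_ge0.
Qed.
End independence.

(** * Laws and independence of the samples *)

Definition path_indices (n : nat) : seq (option nat) :=
  None :: [seq Some j | j <- iota 0 n].

Lemma uniq_path_indices n : uniq (path_indices n).
Proof.
rewrite /= map_inj_uniq ?iota_uniq ?andbT => [|? ? []//].
by apply/mapP => -[].
Qed.

(** Presents the preimage of a cylinder as a finite intersection, the form in
    which mutual independence applies. The index None stands for the head of the
    path. *)
Lemma path_preimage (T W E : Type)
    (X : T -> W) (Y : nat -> T -> E) n (A : set W) (B : nat -> set E) (I : eqType)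
    (p : option nat -> I) (ev : I -> set T) :
  ev (p None) = X @^-1` A -> (forall j, ev (p (Some j)) = Y j @^-1` B j) ->
  (fun t => (X t, fun j => Y j t)) @^-1`
    [set v | A v.1 /\ forall j, (j < n)%N -> B j (v.2 j)] =
  \bigcap_(i in [set` map p (path_indices n)]) ev i.
Proof.
move=> evN evS; apply/seteqP; split => t /=.
  move=> [At Bt] i /=; rewrite -[_ :: _]/(map p (path_indices n)) => /mapP[[j|] + ->].
    rewrite in_cons/= => /mapP[k]; rewrite mem_iota/= add0n => kn [->] /=.
    by rewrite evS; exact: Bt.
  by rewrite evN.
move=> H; split.
  by have := H (p None); rewrite evN; apply; exact: mem_head.
move=> j jn; have := H (p (Some j)); rewrite evS; apply.
by rewrite /= in_cons map_f ?orbT// map_f// mem_iota.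
Qed.

Section mutual_independence.
Context {R : realType} d (T : measurableType d) (P : probability T R).

Lemma mutually_independent_cat (I : eqType) (F : I -> set_system T)
    (J1 J2 : seq I) (A : I -> set T) : mutually_independent P F ->
  uniq (J1 ++ J2) -> (forall i, i \in J1 ++ J2 -> F i (A i)) ->
  P (\bigcap_(i in [set` J1]) A i `&` \bigcap_(i in [set` J2]) A i) =
  (P (\bigcap_(i in [set` J1]) A i) * P (\bigcap_(i in [set` J2]) A i))%E.
Proof.
move=> indF; rewrite cat_uniq => /and3P[u1 /hasPn disj u2] FA.
have -> : \bigcap_(i in [set` J1]) A i `&` \bigcap_(i in [set` J2]) A i =
    \bigcap_(i in [set` J1 ++ J2]) A i.
  apply/seteqP; split => t /= => [[H1 H2] i /=|H].
    by rewrite mem_cat => /orP[]; [exact: H1|exact: H2].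
  by split => i /= iJ; apply: H => /=; rewrite mem_cat iJ ?orbT.
rewrite !indF//.
- by rewrite big_cat/= EFinM.
- by move=> i iJ; apply: FA; rewrite mem_cat iJ orbT.
- by move=> i iJ; apply: FA; rewrite mem_cat iJ.
- by rewrite cat_uniq u1 u2 andbT; apply/hasPn.
Qed.

Lemma bigcap_seq1 (I : eqType) (A : I -> set T) (i : I) :
  \bigcap_(k in [set` [:: i]]) A k = A i.
Proof.
apply/seteqP; split => t /=; first by apply => /=; rewrite mem_head.
by move=> At k /=; rewrite inE => /eqP ->.
Qed.

End mutual_independence.

Section density.
Import HBNNSimple.
(** The map i is the identity in the applications. It connects the Borel
    structure of the reals with the one that carries the Lebesgue measure. *)
Lemma ge0_integral_density d d' (T : measurableType d) (T' : measurableType d')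
    (R : realType) (m : {measure set T -> \bar R}) (nu : {measure set T' -> \bar R})
    (i : T' -> T) (f : T' -> R) (g : T -> \bar R) :
  measurable_fun setT i -> measurable_fun setT f -> (forall x, 0 <= f x) ->
  (forall A, measurable A -> m A = \int[nu]_(x in i @^-1` A) (f x)%:E)%E ->
  measurable_fun setT g -> (forall x, 0 <= g x)%E ->
  (\int[m]_x g x = \int[nu]_x (g (i x) * (f x)%:E))%E.
Proof.
move=> mi mf f0 mE mg g0.
pose h := nnsfun_approx measurableT mg.
have cvgh x : ((h n x)%:E @[n --> \oo] --> g x)%E.
  exact: (cvg_nnsfun_approx measurableT mg).
have ndh x a b : (a <= b)%N -> h a x <= h b x.
  by move=> ab; exact/lefP/nd_nnsfun_approx.
have mh n : measurable_fun setT (h n) by exact: measurable_funP.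
have mhi n : measurable_fun setT (fun x => h n (i x)) by exact: measurableT_comp.
transitivity (limn (fun n => \int[m]_x (h n x)%:E))%E.
  rewrite -monotone_convergence//.
  - by apply: eq_integral => x _; apply/esym/cvg_lim => //; exact: cvgh.
  - by move=> n; apply/measurable_EFinP.
  - by move=> n x _; rewrite lee_fin.
  - by move=> x _ a b ab; rewrite lee_fin; exact: ndh.
transitivity (limn (fun n => \int[nu]_x ((h n (i x))%:E * (f x)%:E)))%E; last first.
  rewrite -monotone_convergence//.
  - apply: eq_integral => x _; apply/cvg_lim => //.
    by apply: cvgeZr => //; exact: cvgh.
  - by move=> n; apply: emeasurable_funM; apply/measurable_EFinP.
  - by move=> n x _; rewrite mule_ge0// lee_fin.
  - by move=> x _ a b ab; rewrite -!EFinM lee_fin ler_wpM2r//; exact: ndh.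
congr (limn _); apply/funext => n.
pose A y := h n @^-1` [set y].
have mA y : measurable (A y) by rewrite -[X in measurable X]setTI; exact: mh.
have A0 y : y < 0 -> A y = set0.
  move=> y0; apply/seteqP; split => // x /= hy.
  have h0 : 0 <= h n x by [].
  by move: h0; rewrite hy leNgt y0.
rewrite integralT_nnsfun sintegralE.
have fE x : ((h n (i x))%:E * (f x)%:E = \sum_(y \in range (h n)) (y * (\1_(i @^-1` A y) x * f x))%:E)%E.
  rewrite -EFinM fsumEFin//; congr EFin.
  rewrite [in LHS](fimfunE (h n) (i x)) mulr_fsuml//.
  by apply: eq_fsbigr => y _; rewrite mulrA.
under [in RHS]eq_integral do rewrite fE.
have mAi y : measurable (i @^-1` A y) by rewrite -[X in measurable X]setTI; exact: mi.
have t0 y x : 0 <= y * (\1_(i @^-1` A y) x * f x).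
  case: (ltP y 0) => [y0|y0]; first by rewrite A0// preimage_set0 indic0 mul0r mulr0.
  by rewrite mulr_ge0// mulr_ge0.
rewrite ge0_integral_fsum//; last 2 first.
- move=> y; apply/measurable_EFinP; apply: measurable_funM => //.
  by apply: measurable_funM => //; exact: measurable_indic.
- by move=> y x _; rewrite lee_fin.
apply: eq_fsbigr => y _.
case: (ltP y 0) => [y0|y0].
  rewrite -[h n @^-1` _]/(A y) A0// measure0 mule0 -[LHS](integral0 nu setT).
  by apply: eq_integral => x _; rewrite preimage_set0 indic0 mul0r mulr0.
under [in RHS]eq_integral do rewrite EFinM.
rewrite ge0_integralZl//; last 2 first.
- apply/measurable_EFinP; apply: measurable_funM => //; exact: measurable_indic.
- by move=> x _; rewrite lee_fin mulr_ge0.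
congr (_ * _)%E; rewrite -[h n @^-1` _]/(A y) mE// integral_mkcond.
apply: eq_integral => x _; rewrite /patch; case: ifPn => xA.
  by rewrite indicE xA mul1r.
by rewrite indicE (negbTE xA) mul0r.
Qed.

End density.

Section setting_laws.
Context (R : realType) (d : nat) (dT dE : measure_display)
  (T : measurableType dT) (P : probability T R) (E : measurableType dE).
Variable S : setting d P E.
Hypothesis hS : standing S.
Let W : measurableType _ := d.-1.-tuple R.

Definition base_path (t : T) : path_space W E := (omegam S t, noise_seq S t).
Definition rep_path (l i : nat) (t : T) : path_space W E :=
  (omegam_rep S l i t, fun j => noise_rep S l i j t).

Lemma measurable_base_path : measurable_fun setT base_path.
Proof. exact: measurable_path. Qed.

Lemma measurable_rep_path l i : measurable_fun setT (rep_path l i).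
Proof. exact: measurable_path. Qed.

HB.instance Definition _ := isMeasurableFun.Build _ _ _ _ base_path measurable_base_path.
HB.instance Definition _ l i :=
  isMeasurableFun.Build _ _ _ _ (rep_path l i) (measurable_rep_path l i).

Let rv_eventsP d' (S' : measurableType d') (X : T -> S') A : measurable A ->
  rv_events X (X @^-1` A).
Proof. by move=> mA; exists A => //; rewrite setTI. Qed.

(** Combines the independence of omega1 and omega_(-1) with that of omega and
    the noises. *)
Lemma omega1_base_path_independent : independent_maps P (omega1 S) base_path.
Proof.
move=> A B mA; apply: (@independent_path _ _ _ P _ _ W E base_path) => [|C].
  by rewrite -[X in measurable X]setTI; exact: measurable_funP.
move=> [n [D [F [mD mF ->]]]].
pose ev A' k := if k is Some j then noise S j @^-1` F j else omega S @^-1` (A' `*` D).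
have evE A' : omega1 S @^-1` A' `&` base_path @^-1` [set v | D v.1 /\ forall j, (j < n)%N -> F j (v.2 j)] =
    \bigcap_(k in [set` map id (path_indices n)]) ev A' k.
  have <- := @path_preimage _ _ _ (omega S) (fun j => noise S j) n (A' `*` D) F _ id (ev A') erefl (fun=> erefl).
  by apply/seteqP; split => t /= => [[? []]|[[]]].
have mev A' : measurable A' -> forall k, (if k is Some j then rv_events (noise S j) else rv_events (omega S)) (ev A' k).
  move=> mA' [j|] /=; apply: rv_eventsP => //.
  exact: measurableX.
have bE : base_path @^-1` [set v | D v.1 /\ forall j, (j < n)%N -> F j (v.2 j)] =
    \bigcap_(k in [set` path_indices n]) ev setT k.
  by rewrite -[path_indices n]map_id -evE preimage_setT setTI.
suff H : P (\bigcap_(k in [set` path_indices n]) ev A k) =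
    (P (omega1 S @^-1` A) * P (\bigcap_(k in [set` path_indices n]) ev setT k))%E.
  by have := evE A; rewrite map_id => E1; rewrite -bE -E1 in H.
rewrite !(noise_indep hS) ?uniq_path_indices//; last 2 first.
- by move=> k _; exact: mev.
- by move=> k _; exact: mev.
rewrite /path_indices !big_cons EFinM [in RHS]EFinM muleA; congr (_ * _)%E.
  have mO A' : measurable A' -> measurable (omega S @^-1` (A' `*` D)).
    by move=> mA'; apply: measurableI; rewrite -[X in measurable X]setTI; exact: measurable_funP.
  rewrite !fineK ?fin_num_measure//; try exact: mO.
  pose eb b := if b then omega1 S @^-1` A else omegam S @^-1` D.
  have := @mutually_independent_cat _ _ _ _ _ _ [:: true] [:: false] eb (omega1_indep_omegam hS) isT _.
  have -> : ev setT None = eb false by apply/seteqP; split => // t [].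
  rewrite !bigcap_seq1 => H; apply: H => -[] _; exact: rv_eventsP.
by rewrite !big_map.
Qed.

Lemma rep_path_law l i C : measurable C -> P (rep_path l i @^-1` C) = P (base_path @^-1` C).
Proof.
apply: (@probability_path_unique R _ _ W E (distribution P (rep_path l i)) (distribution P base_path)).
  by apply: (le_lt_trans (probability_le1 _ _)); rewrite ?ltry.
move=> _ [n [D [F [mD mF ->]]]]; rewrite /distribution/= /pushforward.
pose ev k := if k is Some j then noise S j @^-1` F j else omega S @^-1` (setT `*` D).
pose er (k : (nat * nat) * option nat) := if k.2 is Some j then noise_rep S k.1.1 k.1.2 j @^-1` F j
  else omegam_rep S k.1.1 k.1.2 @^-1` D.
have E1 : rep_path l i @^-1` [set v | D v.1 /\ forall j, (j < n)%N -> F j (v.2 j)] =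
    \bigcap_(k in [set` map (pair (l, i)) (path_indices n)]) er k by exact: path_preimage.
have E2 : base_path @^-1` [set v | D v.1 /\ forall j, (j < n)%N -> F j (v.2 j)] =
    \bigcap_(k in [set` map id (path_indices n)]) ev k.
  apply: path_preimage => //.
  by apply/seteqP; split => // t [].
suff H : P (\bigcap_(k in [set` map (pair (l, i)) (path_indices n)]) er k) =
    P (\bigcap_(k in [set` map id (path_indices n)]) ev k).
  by rewrite -E1 -E2 in H.
rewrite map_id (noise_indep hS) ?uniq_path_indices//; last first.
  by move=> [j|] _; apply: rv_eventsP => //; exact: measurableX.
rewrite (rep_indep hS); last 2 first.
- by rewrite map_inj_uniq ?uniq_path_indices// => ? ? [].
- by move=> _ /mapP[[j|] _ ->]; exact: rv_eventsP.
rewrite big_map; congr EFin; apply: eq_bigr => -[j|] _ /=.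
  congr fine; rewrite /er/=.
  rewrite -[LHS]/(distribution P (noise_rep S l i j) (F j)) (noise_rep_law hS)//.
  by rewrite -(noise_law hS j).
congr fine; rewrite /er/= -[LHS]/(distribution P (omegam_rep S l i) D) (omegam_rep_law hS)//.
by congr (P _); apply/seteqP; split => // t [].
Qed.

Lemma rep_path_independent (p q : nat * nat) : p != q ->
  independent_maps P (rep_path p.1 p.2) (rep_path q.1 q.2).
Proof.
move=> pq A B mA mB.
have mP (r : nat * nat) C : measurable C -> measurable (rep_path r.1 r.2 @^-1` C).
  by move=> mC; rewrite -[X in measurable X]setTI; exact: measurable_funP.
apply: (@independent_path _ _ _ P _ _ W E (rep_path q.1 q.2)) mB => [|C' cC']; first exact: mP.
rewrite setIC muleC.
have mC' : @measurable _ (path_space W E) C' by exact: sub_sigma_algebra.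
apply: (@independent_path _ _ _ P _ _ W E (rep_path p.1 p.2)) mA => [|C cC]; first exact: mP.
move: cC => [n [D [F [mD mF ->]]]]; move: cC' {mC'} => [n' [D' [F' [mD' mF' ->]]]].
pose er (k : (nat * nat) * option nat) :=
  if k.1 == q then
    if k.2 is Some j then noise_rep S k.1.1 k.1.2 j @^-1` F' j else omegam_rep S k.1.1 k.1.2 @^-1` D'
  else if k.2 is Some j then noise_rep S k.1.1 k.1.2 j @^-1` F j else omegam_rep S k.1.1 k.1.2 @^-1` D.
have -> : rep_path p.1 p.2 @^-1` [set v | D v.1 /\ forall j, (j < n)%N -> F j (v.2 j)] =
    \bigcap_(k in [set` map (pair p) (path_indices n)]) er k.
  apply: path_preimage.
- by rewrite /er/= (negbTE pq).
- by move=> j; rewrite /er/= (negbTE pq).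
have -> : rep_path q.1 q.2 @^-1` [set v | D' v.1 /\ forall j, (j < n')%N -> F' j (v.2 j)] =
    \bigcap_(k in [set` map (pair q) (path_indices n')]) er k.
  apply: path_preimage.
- by rewrite /er/= eqxx.
- by move=> j; rewrite /er/= eqxx.
apply: (mutually_independent_cat (rep_indep hS)).
  rewrite cat_uniq !map_inj_uniq ?uniq_path_indices; try by move=> ? ? [].
  rewrite andbT andTb; apply/hasPn => _ /mapP[k _ ->]; apply/mapP => -[k' _ [qp]].
  by rewrite qp eqxx in pq.
by move=> [r [j|]] _; rewrite /er /=; case: ifP => _; exact: rv_eventsP.
Qed.

(** Integrating omega1 out first is preintegration. *)
Lemma expectation_omega1_path (g : R * path_space W E -> \bar R) :
  measurable_fun setT g -> (forall z, 0 <= g z)%E ->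
  (\int[P]_t g (omega1 S t, base_path t) =
   \int[P]_t \int[lebesgue_measure]_u (g (u, base_path t) * (rho1 S u)%:E))%E.
Proof.
move=> mg g0.
rewrite (expectation_independent omega1_base_path_independent mg g0).
apply: eq_integral => t _.
have mgt : measurable_fun setT (fun u => g (u, base_path t)).
  by apply: measurableT_comp => //; exact: measurable_fun_pair.
exact: (@ge0_integral_density _ _ _ (measurableTypeR R) R (distribution P (omega1 S)) lebesgue_measure
  idfun _ (fun u => g (u, base_path t)) (@measurable_id _ _ _) (rho1_measurable hS) (rho1_ge0 hS) (rho1_density hS) mgt (fun u => g0 _)).
Qed.
End setting_laws.

(** * Means of bounded variables *)

Section bounded_expectation.
Context {R : realType} d (T : measurableType d) (P : probability T R).

Definition bounded_measurable (f : T -> R) :=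
  measurable_fun setT f /\ exists B, forall t, `|f t| <= B.

Lemma bounded_measurable_cst c : bounded_measurable (fun=> c).
Proof. by split; [exact: measurable_cst|exists `|c|]. Qed.

Lemma bounded_measurableD f g : bounded_measurable f -> bounded_measurable g ->
  bounded_measurable (fun t => f t + g t).
Proof.
move=> [mf [B Bf]] [mg [C Cg]]; split; first exact: measurable_funD.
by exists (B + C) => t; rewrite (le_trans (ler_normD _ _))// lerD.
Qed.

Lemma bounded_measurableM f g : bounded_measurable f -> bounded_measurable g ->
  bounded_measurable (fun t => f t * g t).
Proof.
move=> [mf [B Bf]] [mg [C Cg]]; split; first exact: measurable_funM.
by exists (B * C) => t; rewrite normrM ler_pM.
Qed.

Lemma bounded_measurable_sum (I : Type) (s : seq I) (f : I -> T -> R) :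
  (forall i, bounded_measurable (f i)) -> bounded_measurable (fun t => \sum_(i <- s) f i t).
Proof.
move=> bf; elim: s => [|i s IH].
  under eq_fun do rewrite big_nil; exact: bounded_measurable_cst.
under eq_fun do rewrite big_cons; exact: bounded_measurableD.
Qed.

Lemma bounded_measurable_integrable f : bounded_measurable f ->
  P.-integrable setT (EFin \o f).
Proof.
move=> [mf [B Bf]]; apply: measurable_bounded_integrable => //.
- by apply: (le_lt_trans (probability_le1 _ _)); rewrite ?ltry.
- by exists B; split; [exact: num_real|move=> x Bx t _; exact: le_trans (Bf t) (ltW Bx)].
Qed.

Local Notation EP f := (\int[P]_t f t)%R.

Lemma mean_cst c : EP (fun=> c) = c.
Proof. by rewrite Rintegral_cst//= probability_setT mulr1. Qed.

Lemma mean_D f g : bounded_measurable f -> bounded_measurable g ->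
  EP (fun t => f t + g t) = EP f + EP g.
Proof. by move=> bf bg; rewrite RintegralD//; exact: bounded_measurable_integrable. Qed.

Lemma mean_Z c f : bounded_measurable f -> EP (fun t => c * f t) = c * EP f.
Proof. by move=> bf; rewrite RintegralZl//; exact: bounded_measurable_integrable. Qed.

Lemma mean_sum (I : Type) (s : seq I) (f : I -> T -> R) :
  (forall i, bounded_measurable (f i)) ->
  EP (fun t => \sum_(i <- s) f i t) = \sum_(i <- s) EP (f i).
Proof.
move=> bf; elim: s => [|i s IH].
  by under eq_Rintegral do rewrite big_nil; rewrite mean_cst big_nil.
under eq_Rintegral do rewrite big_cons.
by rewrite mean_D// ?big_cons ?IH//; exact: bounded_measurable_sum.
Qed.

Lemma mean_ge0 f : (forall t, 0 <= f t) -> 0 <= EP f.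
Proof. by move=> f0; apply: Rintegral_ge0. Qed.

Lemma mean_sqr_ge f : bounded_measurable f -> EP f ^+ 2 <= EP (fun t => f t ^+ 2).
Proof.
move=> bf; have : 0 <= EP (fun t => (f t - EP f) ^+ 2).
  by apply: mean_ge0 => t; exact: sqr_ge0.
have bf2 := bounded_measurableM bf bf.
have -> : (fun t => (f t - EP f) ^+ 2) = (fun t => f t * f t + ((- 2 * EP f) * f t + EP f ^+ 2)).
  by apply/funext => t; ring.
have bl : bounded_measurable (fun t => (- 2 * EP f) * f t).
  by apply: bounded_measurableM => //; exact: bounded_measurable_cst.
rewrite mean_D//; last by apply: bounded_measurableD => //; exact: bounded_measurable_cst.
rewrite mean_D//; last exact: bounded_measurable_cst.
rewrite mean_Z// mean_cst (_ : EP (fun t => f t ^+ 2) = EP (fun t => f t * f t)); last first.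
  by apply: eq_Rintegral => t _; rewrite expr2.
by move=> h; nra.
Qed.

Lemma mean_sqr_sum (I : eqType) (s : seq I) (Z : I -> T -> R) (b : R) : uniq s ->
  (forall i, bounded_measurable (Z i)) -> (forall i, EP (Z i) = 0) ->
  (forall i j, i != j -> EP (fun t => Z i t * Z j t) = 0) ->
  EP (fun t => (\sum_(i <- s) Z i t + b) ^+ 2) =
  \sum_(i <- s) EP (fun t => Z i t ^+ 2) + b ^+ 2.
Proof.
move=> us bZ Z0 Zij; elim: s us => [_|i s IH /andP[ni us]].
  by under eq_Rintegral do rewrite big_nil add0r; rewrite mean_cst big_nil add0r.
rewrite big_cons -addrA -IH//.
pose Q t := \sum_(j <- s) Z j t + b.
have bQ : bounded_measurable Q.
  apply: bounded_measurableD; [exact: bounded_measurable_sum|exact: bounded_measurable_cst].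
have bZQ : bounded_measurable (fun t => Z i t * Q t) by exact: bounded_measurableM.
have bX2 f : bounded_measurable f -> bounded_measurable (fun t => f t ^+ 2).
  by move=> bf; under eq_fun do rewrite expr2; exact: bounded_measurableM.
have -> : EP (fun t => (\sum_(j <- i :: s) Z j t + b) ^+ 2) =
   EP (fun t => Z i t ^+ 2 + (2 * (Z i t * Q t) + Q t ^+ 2)).
  by apply: eq_Rintegral => t _; rewrite big_cons /Q; ring.
have b2 : bounded_measurable (fun t => 2 * (Z i t * Q t)).
  by apply: bounded_measurableM => //; exact: bounded_measurable_cst.
rewrite mean_D//; [|exact: bX2|by apply: bounded_measurableD => //; exact: bX2].
rewrite mean_D//; last exact: bX2.
rewrite mean_Z// (_ : EP (fun t => Z i t * Q t) = 0) ?mulr0 ?add0r//.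
have -> : EP (fun t => Z i t * Q t) = EP (fun t => \sum_(j <- s) Z i t * Z j t + b * Z i t).
  by apply: eq_Rintegral => t _; rewrite /Q mulrDr mulr_sumr (mulrC b).
rewrite mean_D; last 2 first.
- by apply: bounded_measurable_sum => j; exact: bounded_measurableM.
- by apply: bounded_measurableM => //; exact: bounded_measurable_cst.
rewrite mean_Z// Z0 mulr0 addr0 mean_sum => [|j]; last exact: bounded_measurableM.
rewrite big_seq big1// => j js; apply: Zij.
by apply: contraNneq ni => ->.
Qed.

Lemma mean_independent d1 d2 (S1 : measurableType d1) (S2 : measurableType d2)
    (U : {mfun T >-> S1}) (V : {mfun T >-> S2}) (f : S1 -> R) (g : S2 -> R) :
  independent_maps P U V ->
  measurable_fun setT f -> (forall u, `|f u| <= 1) ->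
  measurable_fun setT g -> (forall v, `|g v| <= 1) ->
  EP (fun t => f (U t) * g (V t)) = EP (fun t => f (U t)) * EP (fun t => g (V t)).
Proof.
move=> indUV mf f1 mg g1.
have bf : bounded_measurable (fun t => f (U t)).
  by split; [exact: measurableT_comp|exists 1].
have bg : bounded_measurable (fun t => g (V t)).
  by split; [exact: measurableT_comp|exists 1].
have b1 c := bounded_measurable_cst c.
have f0 u : 0 <= f u + 1 by have := f1 u; rewrite ler_norml => /andP[]; lra.
have g0 u : 0 <= g u + 1 by have := g1 u; rewrite ler_norml => /andP[]; lra.
have mg1 : measurable_fun setT (fun v => (g v + 1)%:E).
  by apply/measurable_EFinP; exact: measurable_funD.
have mf1 : measurable_fun setT (fun v => (f v + 1)%:E).
  by apply/measurable_EFinP; exact: measurable_funD.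
(* the shifts by 1 make both factors nonnegative *)
have key : EP (fun t => (f (U t) + 1) * (g (V t) + 1)) =
    EP (fun t => f (U t) + 1) * EP (fun t => g (V t) + 1).
  rewrite /Rintegral -fineM; last 2 first.
  - apply: integrable_fin_num => //.
    by apply: bounded_measurable_integrable; exact: bounded_measurableD.
  - apply: integrable_fin_num => //.
    by apply: bounded_measurable_integrable; exact: bounded_measurableD.
  congr fine.
  have := @expectation_independent _ _ _ P _ _ _ _ U V (fun z => ((f z.1 + 1) * (g z.2 + 1))%:E) indUV.
  move=> /= ->; last 2 first.
  - apply/measurable_EFinP; apply: measurable_funM.
      by apply: measurable_funD => //; exact: measurableT_comp.
    by apply: measurable_funD => //; exact: measurableT_comp.
  - by move=> z; rewrite lee_fin mulr_ge0.
  transitivity (\int[P]_t ((\int[distribution P U]_u (f u + 1)%:E) * (g (V t) + 1)%:E))%E.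
    apply: eq_integral => t _; under eq_integral do rewrite EFinM.
    by rewrite ge0_integralZr//; [move=> ? _|]; rewrite lee_fin.
  rewrite ge0_integralZl//.
  - by rewrite ge0_integral_distribution// => u; rewrite lee_fin.
  - exact: (measurableT_comp mg1).
  - by move=> t _; rewrite lee_fin.
  - by apply: integral_ge0 => u _; rewrite lee_fin.
have eD : EP (fun t => (f (U t) + 1) * (g (V t) + 1)) =
   EP (fun t => f (U t) * g (V t)) + (EP (fun t => f (U t)) + (EP (fun t => g (V t)) + 1)).
  have bfg := bounded_measurableM bf bg.
  rewrite -[X in _ + (_ + (_ + X))](mean_cst 1) -!mean_D//; last 2 first.
  - by apply: bounded_measurableD => //; exact: bounded_measurableD.
  - exact: bounded_measurableD.
  by apply: eq_Rintegral => t _; ring.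
move: key; rewrite eD !mean_D// mean_cst => key; lra.
Qed.
End bounded_expectation.

(** * The error of the estimator with exact preintegration *)

Section exact_estimator.
Context (R : realType) (d : nat) (dT dE : measure_display)
  (T : measurableType dT) (P : probability T R) (E : measurableType dE).
Variable S : setting d P E.
Hypothesis hS : standing S.
Let W : measurableType _ := d.-1.-tuple R.
Local Notation Omega := (path_space W E).
Local Notation EP f := (\int[P]_t f t)%R.
Local Notation mu := (@lebesgue_measure R).

Lemma measurable_phihat m : measurable_fun setT
  (fun z : R * Omega => phihat S m (z.1, z.2.1) z.2.2).
Proof.
apply: measurable_funM => //; apply: measurable_sum => j.
apply: (measurableT_comp (sim_measurable hS)
  (g := fun z : R * Omega => ((z.1, z.2.1), z.2.2 j))).
apply: measurable_fun_pair.
  apply: measurable_fun_pair => //.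
  by apply: measurableT_comp => //; exact: measurable_path_head.
exact: (measurableT_comp (measurable_path_coord j) measurable_snd).
Qed.

Lemma measurable_gt_indicator d' (X : measurableType d') (f : X -> R) (c : R) :
  measurable_fun setT f -> measurable_fun setT (fun x => if c < f x then 1 else 0 : R).
Proof.
move=> mf; apply: measurable_fun_ifT => //.
exact: measurable_fun_ltr.
Qed.

Lemma measurable_phi : measurable_fun setT (phi S).
Proof. by case: (phi_regression hS). Qed.

Lemma integral_rho1 : (\int[mu]_u (rho1 S u)%:E = 1)%E.
Proof. by rewrite -(rho1_density hS measurableT) probability_setT. Qed.

Definition weighted (g : R * Omega -> R) (v : Omega) : R :=
  (\int[mu]_u (g (u, v) * rho1 S u))%R.

Section weighted.
Variable g : R * Omega -> R.
Hypotheses (mg : measurable_fun setT g) (g01 : forall z, 0 <= g z <= 1).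

Let mgrho : measurable_fun setT (fun z : measurableTypeR R * Omega => (g z * rho1 S z.1)%:E).
Proof.
apply/measurable_EFinP; apply: measurable_funM => //.
by apply: measurableT_comp; [exact: rho1_measurable|].
Qed.

Let grho0 z : (0 <= (g z * rho1 S z.1)%:E)%E.
Proof.
by rewrite lee_fin mulr_ge0 ?(rho1_ge0 hS)//; case/andP: (g01 z).
Qed.

Lemma weighted_integral v :
  (\int[mu]_u (g (u, v) * rho1 S u)%:E = (weighted g v)%:E)%E.
Proof.
rewrite /weighted /Rintegral fineK// ge0_fin_numE; last first.
  by apply: integral_ge0 => u _; exact: (grho0 (u, v)).
apply: (@le_lt_trans _ _ 1%E); last by rewrite ltry.
rewrite -integral_rho1; apply: ge0_le_integral => //.
- exact: (measurable_fun_pair1 v mgrho).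
- by apply/measurable_EFinP; exact: rho1_measurable.
- move=> u _; rewrite lee_fin ler_piMl ?(rho1_ge0 hS)//.
  by case/andP: (g01 (u, v)).
Qed.

Lemma weighted01 v : 0 <= weighted g v <= 1.
Proof.
rewrite -!lee_fin -weighted_integral integral_ge0/=; last first.
  by move=> u _; exact: (grho0 (u, v)).
rewrite -integral_rho1; apply: ge0_le_integral => //.
- exact: (measurable_fun_pair1 v mgrho).
- by apply/measurable_EFinP; exact: rho1_measurable.
- move=> u _; rewrite lee_fin ler_piMl ?(rho1_ge0 hS)//.
  by case/andP: (g01 (u, v)).
Qed.

Lemma measurable_weighted : measurable_fun setT (weighted g).
Proof.
apply/measurable_EFinP.
rewrite (_ : EFin \o _ = fubini_G mu (fun z => (g z * rho1 S z.1)%:E)).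
  exact: measurable_fun_fubini_tonelli_G.
by apply/funext => v /=; rewrite -weighted_integral.
Qed.

Lemma expectation_weighted :
  EP (fun t => weighted g (base_path S t)) = EP (fun t => g (omega1 S t, base_path S t)).
Proof.
rewrite /Rintegral (expectation_omega1_path hS (g := EFin \o g)); last 2 first.
- exact/measurable_EFinP.
- by move=> z; rewrite lee_fin; case/andP: (g01 z).
congr fine; apply: eq_integral => t _.
by rewrite -weighted_integral.
Qed.
End weighted.

(** hhat_m as a function on the path space. *)
Definition smoothed (m : nat) : Omega -> R :=
  weighted (fun z => ghat S m (z.1, z.2.1) z.2.2).
(** The conditional probability of phi(omega) > c given omega_(-1). *)
Definition smoothed_limit : Omega -> R :=
  weighted (fun z => if thr S < phi S (z.1, z.2.1) then 1 else 0).

Let mghat m : measurable_fun setT (fun z : R * Omega => ghat S m (z.1, z.2.1) z.2.2).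
Proof. by apply: measurable_gt_indicator; exact: measurable_phihat. Qed.
Let ghat01 m z e : 0 <= ghat S m z e <= 1.
Proof. by rewrite /ghat; case: ifP => _; rewrite ?lexx ?ler01. Qed.
Let mglim : measurable_fun setT (fun z : R * Omega => if thr S < phi S (z.1, z.2.1) then 1 else 0 : R).
Proof.
apply: measurable_gt_indicator; apply: measurableT_comp; first exact: measurable_phi.
apply: measurable_fun_pair => //.
by apply: measurableT_comp => //; exact: measurable_path_head.
Qed.
Let glim01 (z : R * Omega) : 0 <= (if thr S < phi S (z.1, z.2.1) then 1 else 0 : R) <= 1.
Proof. by case: ifP => _; rewrite ?lexx ?ler01. Qed.

Lemma smoothed01 m v : 0 <= smoothed m v <= 1.
Proof. exact: weighted01. Qed.
Lemma measurable_smoothed m : measurable_fun setT (smoothed m).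
Proof. exact: measurable_weighted. Qed.
Lemma smoothed_limit01 v : 0 <= smoothed_limit v <= 1.
Proof. exact: weighted01. Qed.
Lemma measurable_smoothed_limit : measurable_fun setT smoothed_limit.
Proof. exact: measurable_weighted. Qed.

Lemma theta_smoothed : theta S = EP (fun t => smoothed_limit (base_path S t)).
Proof.
rewrite expectation_weighted// /Rintegral /theta; congr fine.
pose A := [set t | thr S < phi S (omega S t)].
have mA : measurable A.
  rewrite (_ : A = (fun t => phi S (omega S t)) @^-1` `]thr S, +oo[%classic).
    rewrite -[X in measurable X]setTI; apply: measurableT_comp => //.
      exact: measurable_phi.
    exact: measurable_fun_pair.
  by apply/seteqP; split => t /=; rewrite in_itv/= andbT.
rewrite -[LHS]/(P A) -(setIT A) -integral_indic//.
apply: eq_integral => t _; congr EFin; rewrite indicE.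
by case: ifPn => [|/negP] H; [rewrite mem_set|rewrite memNset].
Qed.

Definition smoothed_diff (l : nat) (v : Omega) : R :=
  level_diff S (hhat S) l v.1 v.2.

Lemma smoothed_diffE l v : smoothed_diff l v =
  smoothed (mlev S l) v - (if l is l'.+1 then smoothed (mlev S l') v else 0).
Proof. by case: l => [|l]; rewrite /smoothed_diff/= ?subr0. Qed.

Lemma measurable_smoothed_diff l : measurable_fun setT (smoothed_diff l).
Proof.
rewrite (_ : smoothed_diff l = fun v => smoothed (mlev S l) v -
  (if l is l'.+1 then smoothed (mlev S l') v else 0)); last by apply/funext => v; exact: smoothed_diffE.
apply: measurable_funB; first exact: measurable_smoothed.
by case: l => // l; exact: measurable_smoothed.
Qed.

Lemma smoothed_diff_le1 l v : `|smoothed_diff l v| <= 1.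
Proof.
rewrite smoothed_diffE ler_norml.
have /andP[a1 a2] := smoothed01 (mlev S l) v.
case: l a1 a2 => [|l] a1 a2; first by apply/andP; split; lra.
by have /andP[b1 b2] := smoothed01 (mlev S l) v; apply/andP; split; lra.
Qed.

Lemma mean_rep_path l i (f : Omega -> R) : measurable_fun setT f -> (forall v, `|f v| <= 1) ->
  EP (fun t => f (rep_path S l i t)) = EP (fun t => f (base_path S t)).
Proof.
move=> mf f1.
have f0 u : 0 <= f u + 1 by have := f1 u; rewrite ler_norml => /andP[]; lra.
have bf (V : {mfun T >-> Omega}) : bounded_measurable (fun t => f (V t)).
  by split; [exact: measurableT_comp|exists 1].
have mf1 : measurable_fun setT (fun v => (f v + 1)%:E).
  by apply/measurable_EFinP; exact: measurable_funD.
have : EP (fun t => f (rep_path S l i t) + 1) = EP (fun t => f (base_path S t) + 1).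
  rewrite /Rintegral; congr fine.
  have D (V : {mfun T >-> Omega}) : (\int[P]_t (f (V t) + 1)%:E = \int[distribution P V]_v (f v + 1)%:E)%E.
    by rewrite ge0_integral_distribution// => v; rewrite lee_fin.
  rewrite (D (rep_path S l i)) (D (base_path S)).
  apply: eq_measure_integral => C mC _.
  exact: (rep_path_law hS l i mC).
rewrite !mean_D ?mean_cst//; try exact: bf; try exact: bounded_measurable_cst.
by move=> /addIr.
Qed.

(** The levels telescope, so the bias is the mean of the finest smoothed
    indicator minus its limit. The samples are independent, so their variances
    add up. Both are then bounded by second moments. *)
Lemma mse_Qhat_le L N : (forall l, (l <= L)%N -> (0 < N l)%N) ->
  (mse S (Qhat S L N) <=
   (EP (fun t => (smoothed (mlev S L) (base_path S t) - smoothed_limit (base_path S t)) ^+ 2) +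
    \sum_(l < L.+1) (N l)%:R^-1 * EP (fun t => smoothed_diff l (base_path S t) ^+ 2))%:E)%E.
Proof.
move=> N0.
pose I : eqType := (nat * nat)%type.
pose mean l := EP (fun t => smoothed_diff l (base_path S t)).
pose Z (p : I) t := (N p.1)%:R^-1 * (smoothed_diff p.1 (rep_path S p.1 p.2 t) - mean p.1).
pose s : seq I := [seq (l, i) | l <- iota 0 L.+1, i <- iota 0 (N l)].
pose b := \sum_(l < L.+1) mean l - theta S.
have us : uniq s.
  apply: allpairs_uniq_dep; [exact: iota_uniq|by move=> *; exact: iota_uniq|].
  by move=> [? ?] [? ?] _ _ /= [-> ->].
have msd l : measurable_fun setT (smoothed_diff l) by exact: measurable_smoothed_diff.
have bD l i : bounded_measurable (fun t => smoothed_diff l (rep_path S l i t)).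
  by split; [exact: (measurableT_comp (msd l) (measurable_rep_path S l i))|exists 1 => t; exact: smoothed_diff_le1].
have sumsE (F : I -> R) : \sum_(p <- s) F p = \sum_(l < L.+1) \sum_(i < N l) F (nat_of_ord l, nat_of_ord i).
  have iotaE n : iota 0 n = index_iota 0 n by rewrite /index_iota subn0.
  rewrite /s big_allpairs_dep iotaE big_mkord.
  by apply: eq_bigr => l _; rewrite iotaE big_mkord.
have QE t : Qhat S L N t - theta S = \sum_(p <- s) Z p t + b.
  rewrite sumsE /b addrA; congr (_ - _).
  rewrite -big_split/=; apply: eq_bigr => l _.
  rewrite /Z/= -mulr_sumr sumrB sumr_const card_ord mulrBr.
  rewrite -[mean l *+ _]mulr_natl mulrA mulVf ?mul1r ?subrK//.
  by rewrite pnatr_eq0 -lt0n N0// -ltnS.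
have bZ p : bounded_measurable (Z p).
  apply: bounded_measurableM; first exact: bounded_measurable_cst.
  by apply: bounded_measurableD; [exact: bD|exact: bounded_measurable_cst].
have EDrep l i : EP (fun t => smoothed_diff l (rep_path S l i t)) = mean l.
  by apply: mean_rep_path => // v; exact: smoothed_diff_le1.
have bc (c : R) : bounded_measurable (fun _ : T => c) by exact: bounded_measurable_cst.
have EZ0 p : EP (Z p) = 0.
  rewrite mean_Z ?mean_D ?EDrep ?mean_cst ?subrr ?mulr0//.
  exact: bounded_measurableD.
have EZZ p q : p != q -> EP (fun t => Z p t * Z q t) = 0.
  move=> pq.
  have -> : EP (fun t => Z p t * Z q t) = EP (fun t => (N p.1)%:R^-1 * (N q.1)%:R^-1 *
      (smoothed_diff p.1 (rep_path S p.1 p.2 t) * smoothed_diff q.1 (rep_path S q.1 q.2 t) +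
      (- mean q.1 * smoothed_diff p.1 (rep_path S p.1 p.2 t) +
      (- mean p.1 * smoothed_diff q.1 (rep_path S q.1 q.2 t) + mean p.1 * mean q.1)))).
    by apply: eq_Rintegral => t _; rewrite /Z; ring.
  have b1 := bD p.1 p.2; have b2 := bD q.1 q.2.
  have b3 := bounded_measurableM b1 b2.
  have b4 := bounded_measurableM (bc (- mean q.1)) b1.
  have b5 := bounded_measurableM (bc (- mean p.1)) b2.
  have b6 := bounded_measurableD b5 (bc (mean p.1 * mean q.1)).
  have b7 := bounded_measurableD b4 b6.
  rewrite mean_Z; last exact: bounded_measurableD.
  rewrite !mean_D// !mean_Z// !EDrep mean_cst.
  rewrite (mean_independent (rep_path_independent hS pq) (msd p.1) (smoothed_diff_le1 p.1)
    (msd q.1) (smoothed_diff_le1 q.1)).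
  by rewrite !EDrep; ring.
have mseE : mse S (Qhat S L N) = (EP (fun t => (Qhat S L N t - theta S) ^+ 2))%:E.
  rewrite /mse unlock /Rintegral fineK//; apply: integrable_fin_num => //.
  apply: bounded_measurable_integrable.
  under eq_fun do rewrite QE expr2.
  by apply: bounded_measurableM; apply: bounded_measurableD => //; exact: bounded_measurable_sum.
rewrite mseE lee_fin.
under eq_Rintegral do rewrite QE.
rewrite mean_sqr_sum// addrC; apply: lerD.
  pose A l := EP (fun t => smoothed (mlev S l) (base_path S t)).
  have bs m : bounded_measurable (fun t => smoothed m (base_path S t)).
    split; first by apply: measurableT_comp => //; exact: measurable_smoothed.
    by exists 1 => t; have /andP[s0 s1] := smoothed01 m (base_path S t); rewrite ger0_norm.
  have bl : bounded_measurable (fun t => smoothed_limit (base_path S t)).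
    split; first by apply: measurableT_comp => //; exact: measurable_smoothed_limit.
    by exists 1 => t; have /andP[s0 s1] := smoothed_limit01 (base_path S t); rewrite ger0_norm.
  have EB f g : bounded_measurable f -> bounded_measurable g ->
      EP (fun t => f t - g t) = EP f - EP g.
    move=> bf bg; rewrite -[- EP g]mulN1r -mean_Z// -mean_D//; last exact: bounded_measurableM.
    by apply: eq_Rintegral => t _; rewrite mulN1r.
  have meanE l : mean l = A l - (if l is l'.+1 then A l' else 0).
    rewrite /mean; under eq_Rintegral do rewrite smoothed_diffE.
    by case: l => [|l]; rewrite EB// mean_cst.
  have sumE M : \sum_(l < M.+1) mean l = A M.
    elim: M => [|M IH]; first by rewrite big_ord1 meanE subr0.
    by rewrite big_ord_recr/= IH (meanE M.+1) [X in _ = X]/(A M.+1) addrC subrK.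
  rewrite /b sumE theta_smoothed -EB//.
  apply: mean_sqr_ge; apply: bounded_measurableD => //.
  under eq_fun do rewrite -mulN1r; exact: bounded_measurableM.
rewrite sumsE.
apply: ler_sum => l _.
have Nl0 : (0 : R) < (N l)%:R by rewrite ltr0n N0// -ltnS.
have EZ2 i : EP (fun t => Z (nat_of_ord l, i) t ^+ 2) <=
    (N l)%:R^-1 ^+ 2 * EP (fun t => smoothed_diff l (base_path S t) ^+ 2).
  have sqle1 v : `|smoothed_diff l v ^+ 2| <= 1.
    by rewrite normrX expr_le1// smoothed_diff_le1.
  have msd2 : measurable_fun setT (fun v => smoothed_diff l v ^+ 2) by exact: measurable_funX.
  rewrite -(mean_rep_path l i msd2 sqle1).
  have -> : EP (fun t => Z (nat_of_ord l, i) t ^+ 2) = EP (fun t => (N l)%:R^-1 ^+ 2 *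
     (smoothed_diff l (rep_path S l i t) ^+ 2 +
      (- 2 * mean l * smoothed_diff l (rep_path S l i t) + mean l ^+ 2))).
    by apply: eq_Rintegral => t _; rewrite /Z/=; ring.
  have b1 := bD l i.
  have b2 : bounded_measurable (fun t => smoothed_diff l (rep_path S l i t) ^+ 2).
    by under eq_fun do rewrite expr2; exact: bounded_measurableM.
  have b3 := bounded_measurableM (bc (- 2 * mean l)) b1.
  have b4 := bounded_measurableD b3 (bc (mean l ^+ 2)).
  rewrite mean_Z; last exact: bounded_measurableD.
  rewrite ler_wpM2l ?sqr_ge0// !mean_D// mean_Z// EDrep mean_cst.
  by have := sqr_ge0 (mean l); lra.
apply: (@le_trans _ _ (\sum_(i < N l) (N l)%:R^-1 ^+ 2 * EP (fun t => smoothed_diff l (base_path S t) ^+ 2))).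
  by apply: ler_sum => i _; exact: EZ2.
rewrite sumr_const card_ord -[leLHS]mulr_natl expr2 -[X in _ * X <= _]mulrA mulVKf//.
by rewrite gt_eqF.
Qed.
End exact_estimator.

(** * Choice of the parameters and complexity *)

Section parameters.
Context {R : realType}.
Implicit Types (C x TOL : R).

Lemma ln_trunc_log_le (n : nat) : (0 < n)%N ->
  (trunc_log 2 n)%:R * ln 2 <= ln (n%:R : R).
Proof.
move=> n0; rewrite mulr_natl -lnXn// ler_ln ?posrE ?exprn_gt0 ?ltr0n//.
by rewrite -natrX ler_nat trunc_logP.
Qed.

(** L is chosen such that m_L is of order TOL^-2, which controls the first
    term of the error, and N_l proportional to (L + 1) TOL^-2 / m_l, so that
    every level contributes equally to the error and to the cost. Rounding N_l up
    adds at most m_L to the cost of a level. Finally L + 1 = O(|ln TOL|), as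
    |ln TOL| is at least |ln TOL0| > 0. *)
Lemma mlmc_parameters (l0 : nat) C TOL0 : 0 < C -> 0 < TOL0 < 1 ->
  exists2 K : R, 0 < K & forall TOL, 0 < TOL <= TOL0 ->
  exists (L : nat) (N : nat -> nat),
  [/\ forall l, (0 < N l)%N,
     C / (2 ^ (L + l0))%:R + \sum_(l < L.+1) C / ((2 ^ (l + l0))%:R * (N l)%:R) <= TOL ^+ 2 &
     \sum_(l < L.+1) (N l)%:R * (2 ^ (l + l0))%:R <= K * (TOL ^- 2 * ln TOL ^+ 2)].
Proof.
move=> C0 /andP[T00 T01].
have ln2 : 0 < ln 2 :> R by rewrite ln_gt0// ltr1n.
pose lam0 := - ln TOL0.
have lam00 : 0 < lam0 by rewrite oppr_gt0 ln_lt0// T00.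
pose A := ln (2 * C + 2) + 2 * ln 2.
have A0 : 0 <= A.
  by rewrite addr_ge0// ?ln_ge0 ?mulr_ge0 ?(ltW ln2)//; lra.
pose K3 := (A / lam0 + 2) / ln 2.
have K30 : 0 < K3 by rewrite divr_gt0// ltr_wpDl// divr_ge0// ltW.
pose D := (2 * C + (2 ^ l0.+1)%:R * (2 * C + 2)).
have D0 : 0 < D.
  by rewrite addr_gt0 ?mulr_gt0 ?ltr0n ?expn_gt0// addr_gt0 ?mulr_gt0.
exists (K3 ^+ 2 * D); first by rewrite mulr_gt0 ?exprn_gt0.
move=> TOL /andP[T0 TT0].
pose lam := - ln TOL.
have lam0le : lam0 <= lam by rewrite lerN2 ler_ln ?posrE.
have lamgt0 : 0 < lam by apply: lt_le_trans lam0le.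
pose x := TOL ^- 2.
have x0 : 0 < x by rewrite invr_gt0 exprn_gt0.
have x1 : 1 <= x.
  rewrite invf_ge1 ?exprn_gt0// expr_le1 ?(ltW T0)//.
  by rewrite (le_trans TT0)// ltW.
have lnx : ln x = 2 * lam.
  by rewrite /x lnV ?posrE ?exprn_gt0// lnXn// -mulr_natl /lam; ring.
(* m_L will lie between n and 2^(l0 + 1) n *)
pose n := (Num.truncn (2 * C * x)).+1.
have n1 : 2 * C * x < n%:R by exact: truncnS_gt.
have n2 : n%:R <= (2 * C + 2) * x.
  rewrite /n -natr1; have : (Num.truncn (2 * C * x))%:R <= 2 * C * x.
    by rewrite truncn_le// mulr_ge0 ?mulr_ge0 ?ltW.
  by rewrite mulrDl; lra.
pose L := (trunc_log 2 n).+1.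
pose m l : R := (2 ^ (l + l0))%:R.
have m0 l : 0 < m l by rewrite ltr0n expn_gt0.
have mL1 : 2 * C * x <= m L.
  apply: (le_trans (ltW n1)); rewrite /m ler_nat.
  apply: (@leq_trans (2 ^ L)%N); first by rewrite ltnW// trunc_log_ltn.
  by rewrite leq_exp2l// leq_addr.
have mL2 : m L <= (2 ^ l0.+1)%:R * (2 * C + 2) * x.
  have -> : m L = (2 ^ l0.+1)%:R * (2 ^ (trunc_log 2 n))%:R.
    by rewrite /m /L -natrM -expnD addSnnS addnC.
  rewrite -mulrA ler_wpM2l//; apply: le_trans n2.
  by rewrite ler_nat trunc_logP.
have LK : L.+1%:R <= K3 * lam.
  have := @ln_trunc_log_le n isT.
  have : ln (n%:R : R) <= ln ((2 * C + 2) * x).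
    by rewrite ler_ln ?posrE ?mulr_gt0//; lra.
  rewrite lnM ?posrE//; last by lra.
  have -> : L.+1%:R = (trunc_log 2 n)%:R + 2 :> R by rewrite -[2]/(2%:R) -natrD addn2.
  rewrite lnx => h1 h2; rewrite /K3 mulrAC ler_pdivlMr// mulrDl.
  have : A <= A / lam0 * lam.
    by rewrite mulrAC ler_pdivlMr// ler_wpM2l.
  rewrite /A; lra.
pose N l := (Num.truncn (2 * C * L.+1%:R * x / m l)).+1.
have N1 l : 2 * C * L.+1%:R * x / m l < (N l)%:R by exact: truncnS_gt.
have NE l : 0 <= 2 * C * L.+1%:R * x / m l.
  by rewrite divr_ge0 ?mulr_ge0 ?(ltW (m0 l)) ?(ltW C0) ?(ltW x0).
have N2 l : (N l)%:R * m l <= 2 * C * L.+1%:R * x + m l.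
  rewrite /N -natr1 mulrDl mul1r lerD2r -ler_pdivlMr//.
  by rewrite truncn_le.
exists L, N; split => //.
- have t1 : C / m L <= TOL ^+ 2 / 2.
    rewrite ler_pdivrMr//; apply: (@le_trans _ _ (TOL ^+ 2 / 2 * (2 * C * x))).
      apply: eq_leW; rewrite /x; field.
      by rewrite gt_eqF.
    by rewrite ler_wpM2l// divr_ge0// sqr_ge0.
  have t2 : \sum_(l < L.+1) C / (m l * (N l)%:R) <= TOL ^+ 2 / 2.
    apply: (@le_trans _ _ (\sum_(l < L.+1) (2 * L.+1%:R * x)^-1)).
      apply: ler_sum => l _; rewrite ler_pdivrMr ?mulr_gt0//.
      rewrite mulrC ler_pdivlMr ?mulr_gt0//.
      by have := N1 l; rewrite ltr_pdivrMr// => /ltW; lra.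
    rewrite sumr_const card_ord -mulr_natl; apply: eq_leW.
    by rewrite /x; field; rewrite gt_eqF//= pnatr_eq0.
  by rewrite -/(m L); lra.
- apply: (@le_trans _ _ (\sum_(l < L.+1) (2 * C * L.+1%:R * x + m L))).
    apply: ler_sum => l _; apply: (le_trans (N2 l)); rewrite lerD2l.
    by rewrite /m ler_nat leq_exp2l// leq_add2r -ltnS.
  rewrite sumr_const card_ord -[leLHS]mulr_natl.
  have S1 : 1 <= L.+1%:R :> R by rewrite ler1n.
  apply: (@le_trans _ _ (L.+1%:R ^+ 2 * (D * x))).
    rewrite [leRHS](_ : _ = L.+1%:R * (L.+1%:R * (D * x))); last by ring.
    apply: ler_wpM2l => //.
    have -> : L.+1%:R * (D * x) =
        2 * C * L.+1%:R * x + L.+1%:R * ((2 ^ l0.+1)%:R * (2 * C + 2) * x).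
      by rewrite /D; ring.
    rewrite lerD2l; apply: (le_trans mL2).
    by rewrite ler_peMl// mulr_ge0 ?(ltW x0)// mulr_ge0//; lra.
  have -> : ln TOL ^+ 2 = lam ^+ 2 by rewrite sqrrN.
  rewrite -/x (_ : _ * D * _ = (K3 * lam) ^+ 2 * (D * x)); last by ring.
  apply: ler_wpM2r; first by rewrite mulr_ge0 ?ltW.
  by rewrite ler_pXn2r ?nnegrE// mulr_ge0 ?ltW.
Qed.
End parameters.

Section complexity.
Context (R : realType) (d : nat) (dT dE : measure_display)
  (T : measurableType dT) (P : probability T R) (E : measurableType dE).
Variable S : setting d P E.
Hypothesis hS : standing S.
Let W : measurableType _ := d.-1.-tuple R.
Local Notation Omega := (path_space W E).
Local Notation EP f := (\int[P]_t f t)%R.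

Definition smoothing_rate (K : R) := forall m, (0 < m)%N ->
  EP (fun t => (smoothed S m (base_path S t) - smoothed_limit S (base_path S t)) ^+ 2) <= K / m%:R.

Lemma mlev_gt0 l : (0 < mlev S l)%N.
Proof. by rewrite /mlev expn_gt0. Qed.

(** The levels l >= 1 are compared through the common limit; the first level
    is at most 1, which is at most m_0 / m_0. *)
Lemma mse_Qhat_rate (K : R) : 0 <= K -> smoothing_rate K ->
  exists2 C : R, 0 < C & forall L N, (forall l, (l <= L)%N -> (0 < N l)%N) ->
  (mse S (Qhat S L N) <= (C / (mlev S L)%:R +
     \sum_(l < L.+1) C / ((mlev S l)%:R * (N l)%:R))%:E)%E.
Proof.
move=> K0 HK; pose C := 6 * K + (mlev S 0)%:R.
have ml0 l : (0 : R) < (mlev S l)%:R by rewrite ltr0n mlev_gt0.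
exists C; first by rewrite ltr_wpDl// mulr_ge0.
move=> L N N0; apply: (le_trans (mse_Qhat_le hS N0)).
have bs m : bounded_measurable (fun t => smoothed S m (base_path S t)).
  split; first by apply: (measurableT_comp (measurable_smoothed hS m)); exact: measurable_base_path.
  by exists 1 => t; have /andP[s0 s1] := smoothed01 hS m (base_path S t); rewrite ger0_norm.
have bl : bounded_measurable (fun t => smoothed_limit S (base_path S t)).
  split; first by apply: (measurableT_comp (measurable_smoothed_limit hS)); exact: measurable_base_path.
  by exists 1 => t; have /andP[s0 s1] := smoothed_limit01 hS (base_path S t); rewrite ger0_norm.
have bN (f : T -> R) : bounded_measurable f -> bounded_measurable (fun t => - f t).
  by move=> bf; under eq_fun do rewrite -mulN1r; apply: bounded_measurableM => //; exact: bounded_measurable_cst.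
pose e m (t : T) := (smoothed S m (base_path S t) - smoothed_limit S (base_path S t)) ^+ 2.
have be m : bounded_measurable (e m).
  have b1 := bounded_measurableD (bs m) (bN _ bl).
  by rewrite /e; under eq_fun do rewrite expr2; exact: bounded_measurableM.
have var l : EP (fun t => smoothed_diff S l (base_path S t) ^+ 2) <= C / (mlev S l)%:R.
  case: l => [|l].
    apply: (@le_trans _ _ (EP (fun=> 1))).
      apply: le_Rintegral => //.
      - apply: bounded_measurable_integrable; split.
          by apply: measurable_funX; apply: (measurableT_comp (measurable_smoothed_diff hS 0)); exact: measurable_base_path.
        exists 1 => t; rewrite normrX expr_le1//; exact: smoothed_diff_le1.
      - by apply: bounded_measurable_integrable; exact: bounded_measurable_cst.
      - move=> t _; rewrite -[leLHS]ger0_norm ?sqr_ge0// normrX expr_le1//; exact: smoothed_diff_le1.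
    by rewrite mean_cst ler_pdivlMr// mul1r /C lerDr mulr_ge0.
  apply: (@le_trans _ _ (EP (fun t => 2 * e (mlev S l.+1) t + 2 * e (mlev S l) t))).
    apply: le_Rintegral => //.
    - apply: bounded_measurable_integrable; split.
        by apply: measurable_funX; apply: (measurableT_comp (measurable_smoothed_diff hS l.+1)); exact: measurable_base_path.
      exists 1 => t; rewrite normrX expr_le1//; exact: smoothed_diff_le1.
    - apply: bounded_measurable_integrable.
      by apply: bounded_measurableD; apply: bounded_measurableM => //; exact: bounded_measurable_cst.
    - move=> t _; rewrite smoothed_diffE /e.
      set a := smoothed S (mlev S l.+1) _; set b := smoothed S (mlev S l) _; set c := smoothed_limit S _.
      by have := sqr_ge0 (a - c + (b - c)); nra.
  have b2 m : bounded_measurable (fun t => 2 * e m t).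
    by apply: bounded_measurableM => //; exact: bounded_measurable_cst.
  rewrite mean_D// !mean_Z//.
  have h1 := HK _ (mlev_gt0 l.+1); have h2 := HK _ (mlev_gt0 l).
  apply: (@le_trans _ _ (2 * (K / (mlev S l.+1)%:R) + 2 * (K / (mlev S l)%:R))).
    by apply: lerD; rewrite ler_wpM2l.
  have -> : (mlev S l.+1)%:R = 2 * (mlev S l)%:R :> R.
    by rewrite -natrM /mlev addSn expnS.
  have -> : 2 * (K / (2 * (mlev S l)%:R)) + 2 * (K / (mlev S l)%:R) = 6 * K / (2 * (mlev S l)%:R).
    by field; rewrite pnatr_eq0 -lt0n mlev_gt0.
  by rewrite ler_wpM2r ?invr_ge0 ?mulr_ge0// /C lerDl.
rewrite lee_fin; apply: lerD.
  apply: (le_trans (HK _ (mlev_gt0 L))); rewrite ler_wpM2r ?invr_ge0//.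
  by rewrite /C; have := ml0 0%N; lra.
apply: ler_sum => l _; rewrite invfM mulrA mulrC ler_wpM2r ?invr_ge0//.
Qed.

Lemma complexity_exact_rate (K kappa : R) : 0 <= K -> smoothing_rate K -> 0 < kappa ->
  complexity_bigO (complexity_exact S kappa)
    (fun TOL => TOL `^ (- 2) * (ln TOL) ^+ 2).
Proof.
move=> K0 HK k0 TOL0 HT; have [C C0 HC] := mse_Qhat_rate K0 HK.
have [D D0 HD] := mlmc_parameters (lev0 S) C0 HT.
exists (kappa * D) => TOL HTOL; have [L [N [N0 Herr Hcost]]] := HD TOL HTOL.
have T0 : 0 < TOL by case/andP: HTOL.
apply: (@le_trans _ _ (cost_exact S kappa L N)%:E).
  apply: ereal_inf_lbound; exists L, N; split => //.
  by apply: le_trans (HC L N _) _ => //; rewrite lee_fin.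
rewrite lee_fin /cost_exact.
have -> : \sum_(l < L.+1) (N l)%:R * (kappa * (mlev S l)%:R) =
    kappa * \sum_(l < L.+1) (N l)%:R * (2 ^ (l + lev0 S))%:R.
  by rewrite mulr_sumr; apply: eq_bigr => l _; rewrite mulrCA.
by rewrite -mulrA ler_pM2l// powRN powR_mulrn ?(ltW T0)//.
Qed.

Section numerical.
Variable V : numerical_scheme R d.

Lemma measurable_Qbar L N M tol : measurable_fun setT (ybar V tol) ->
  measurable_fun setT (Qbar S V L N M tol).
Proof.
move=> my.
have mz k : measurable_fun setT (fun v : Omega => zeta (quad V M) (ybar V tol v.1) k).
  have my1 : measurable_fun setT (fun v : Omega => ybar V tol v.1).
    exact: (measurableT_comp my (@measurable_path_head _ _ W E)).
  by rewrite /zeta; case: (k <= lag_n (ruleL (quad V M)))%N; [exact: measurable_funB|exact: measurable_funD].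
have mh m : measurable_fun setT (fun v : Omega => hbar S V M tol m v.1 v.2).
  rewrite /hbar; apply: measurable_sum => k; apply: measurable_funM.
    rewrite /eta; apply: measurable_funM; last exact: measurable_cst.
    exact: (measurableT_comp (rho1_measurable hS) (mz k)).
  have mg : measurable_fun setT (fun z : R * Omega => ghat S m (z.1, z.2.1) z.2.2).
    by apply: measurable_gt_indicator; exact: measurable_phihat.
  apply: (measurableT_comp mg (g := fun v : Omega => (zeta (quad V M) (ybar V tol v.1) k, v))).
  exact: measurable_fun_pair.
apply: measurable_sum => l; apply: measurable_funM => //; apply: measurable_sum => i.
have md : measurable_fun setT (fun v : Omega => level_diff S (hbar S V M tol) l v.1 v.2).
  by rewrite /level_diff; case: (nat_of_ord l) => [|l']; [exact: mh|apply: measurable_funB; exact: mh].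
exact: (measurableT_comp md (measurable_rep_path S l i)).
Qed.

Lemma measurable_Qhat L N : measurable_fun setT (Qhat S L N).
Proof.
apply: measurable_sum => l; apply: measurable_funM => //; apply: measurable_sum => i.
exact: (measurableT_comp (measurable_smoothed_diff hS l) (measurable_rep_path S l i)).
Qed.

(** The exact estimator and the preintegration each get the mean square error
    TOL^2 / 4. The latter takes M of order TOL^(-2/s) and tol of order TOL, and
    the logarithm of 1/tol, too, is O(TOL^(-2/s)). *)
Lemma complexity_num_rate (K s kappa : R) : 0 <= K -> smoothing_rate K ->
  newton_approximation S V -> 0 < s -> preintegration_error S V s -> 0 < kappa ->
  complexity_bigO (complexity_num S V kappa)
    (fun TOL => TOL `^ (- 2 - 2 / s) * (ln TOL) ^+ 2).
Proof.
move=> K0 HK [my _] s0 [K1' [M0 [tol0 [tol00 Hpre]]]] k0 TOL0 HT.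
have [C C0 HC] := mse_Qhat_rate K0 HK.
have C40 : 0 < 4 * C by rewrite mulr_gt0.
have [D D0 HD] := mlmc_parameters (lev0 S) C40 HT.
(* each of the two error terms K1 M^-s and K1 tol^2 gets the share TOL^2 / 8 *)
pose K1 := Num.max K1' 1.
have K11 : 1 <= K1 by rewrite le_max lexx orbT.
have K1K : K1' <= K1 by rewrite le_max lexx.
have K10 : 0 < K1 by apply: lt_le_trans K11.
pose c := Num.min tol0 (8 * K1)^-1.
have c0 : 0 < c by rewrite lt_min tol00 invr_gt0 mulr_gt0.
have c8 : c <= (8 * K1)^-1 by rewrite ge_min lexx orbT.
have c1 : c <= 1.
  by apply: (le_trans c8); rewrite invf_le1 ?mulr_gt0//; lra.
have ct : c <= tol0 by rewrite ge_min lexx.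
have is0 : 0 < s^-1 by rewrite invr_gt0.
pose K4 := (8 * K1) `^ s^-1 + 1 + M0%:R.
have K40 : 0 < K4 by rewrite ltr_wpDr// ltr_wpDl// powR_ge0.
pose K5 := K4 + ln c^-1 + s / 2.
exists (kappa * (K5 * D)) => TOL HTOL.
have [L [N [N0 Herr Hcost]]] := HD TOL HTOL.
have /andP[T0 TT0] := HTOL.
have T1 : TOL < 1 by apply: le_lt_trans TT0 _; case/andP: HT.
pose x := TOL ^- 2.
have x0 : 0 < x by rewrite invr_gt0 exprn_gt0.
have x1 : 1 <= x.
  by rewrite invf_ge1 ?exprn_gt0// expr_le1 ?(ltW T0)// ltW.
pose y := x `^ s^-1.
have y1 : 1 <= y by rewrite -(powRr0 x) ler_powR// ltW.
pose M := ((Num.truncn ((8 * K1 * x) `^ s^-1)).+1 + M0)%N.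
have M1 : (8 * K1 * x) `^ s^-1 <= M%:R.
  apply: le_trans (ltW (truncnS_gt _)) _.
  by rewrite /M ler_nat leq_addr.
have M2 : M%:R <= K4 * y.
  have h1 : (Num.truncn ((8 * K1 * x) `^ s^-1))%:R <= (8 * K1) `^ s^-1 * y.
    rewrite -powRM ?(ltW x0)//; last by rewrite ltW// mulr_gt0.
    by rewrite truncn_le// powR_ge0.
  have h3 : 0 <= M0%:R :> R by [].
  have h4 : M0%:R <= M0%:R * y by rewrite ler_peMr.
  have -> : M%:R = (Num.truncn ((8 * K1 * x) `^ s^-1))%:R + 1 + M0%:R :> R.
    by rewrite /M natrD natr1.
  have -> : K4 * y = (8 * K1) `^ s^-1 * y + y + M0%:R * y by rewrite /K4; ring.
  lra.
pose tol := c * TOL.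
have tolp : 0 < tol by rewrite mulr_gt0.
have tol1 : tol < 1.
  by apply: (@le_lt_trans _ _ (1 * TOL)); [rewrite ler_wpM2r// ltW|rewrite mul1r].
have tolt : tol <= tol0.
  by apply: (@le_trans _ _ (tol0 * 1)); [rewrite ler_pM// ltW|rewrite mulr1].
have pre : ('E_P[fun t => ((Qhat S L N t - Qbar S V L N M tol t) ^+ 2)%R] <= (TOL ^+ 2 / 4)%:E)%E.
  have := Hpre L N M tol (fun l _ => N0 l) (leq_addl _ _) isT (introT andP (conj tolp tol1)) tolt.
  move=> /le_trans; apply; rewrite lee_fin.
  have e1 : tol ^+ 2 <= TOL ^+ 2 / (8 * K1).
    rewrite /tol exprMn mulrC ler_wpM2l ?sqr_ge0//; apply: le_trans c8.
    by rewrite expr2 ler_piMl// ltW.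
  have e2 : M%:R `^ (- s) <= TOL ^+ 2 / (8 * K1).
    have -> : TOL ^+ 2 / (8 * K1) = ((8 * K1 * x) `^ s^-1) `^ (- s).
      rewrite -powRrM mulrN mulVf ?gt_eqF// powRN powRr1 ?invfM ?invrK; last by rewrite ltW// !mulr_gt0.
      by rewrite mulrC.
    rewrite !powRN lef_pV2 ?posrE ?powR_gt0 ?mulr_gt0//.
      by apply: ge0_ler_powR => //; rewrite ?nnegrE ?powR_ge0// ltW.
  have e0 : 0 <= M%:R `^ (- s) + tol ^+ 2 by rewrite addr_ge0 ?powR_ge0// sqr_ge0.
  apply: (@le_trans _ _ (K1 * (M%:R `^ (- s) + tol ^+ 2))); first by rewrite ler_wpM2r.
  apply: (@le_trans _ _ (K1 * (TOL ^+ 2 / (8 * K1) + TOL ^+ 2 / (8 * K1)))).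
    by rewrite ler_wpM2l ?(ltW K10)// lerD.
  by apply: eq_leW; field; rewrite gt_eqF.
have exact_err : (mse S (Qhat S L N) <= (TOL ^+ 2 / 4)%:E)%E.
  apply: le_trans (HC L N (fun l _ => N0 l)) _; rewrite lee_fin.
  have -> : C / (mlev S L)%:R + \sum_(l < L.+1) C / ((mlev S l)%:R * (N l)%:R) =
     (4 * C / (mlev S L)%:R + \sum_(l < L.+1) 4 * C / ((mlev S l)%:R * (N l)%:R)) / 4.
    rewrite mulrDl mulr_suml; congr (_ + _).
      by field; rewrite pnatr_eq0 -lt0n mlev_gt0.
    apply: eq_bigr => l _; field.
    by rewrite !pnatr_eq0 -!lt0n N0 mlev_gt0.
  by rewrite ler_wpM2r// invr_ge0.
have mQb : measurable_fun setT (Qbar S V L N M tol).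
  by apply: measurable_Qbar; apply: my; rewrite tolp.
have mQh := measurable_Qhat L N.
have err : (mse S (Qbar S V L N M tol) <= (TOL ^+ 2)%:E)%E.
  rewrite /mse unlock; rewrite unlock in pre; rewrite /mse unlock in exact_err.
  have m1 : measurable_fun setT (fun t => ((Qhat S L N t - theta S) ^+ 2)%:E).
    by apply/measurable_EFinP; apply: measurable_funX; exact: measurable_funB.
  have m2 : measurable_fun setT (fun t => ((Qhat S L N t - Qbar S V L N M tol t) ^+ 2)%:E).
    by apply/measurable_EFinP; apply: measurable_funX; exact: measurable_funB.
  have m3 : measurable_fun setT (fun t => ((Qbar S V L N M tol t - theta S) ^+ 2)%:E).
    by apply/measurable_EFinP; apply: measurable_funX; exact: measurable_funB.
  apply: (@le_trans _ _ (\int[P]_t (2%:E * ((Qhat S L N t - theta S) ^+ 2)%:E +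
      2%:E * ((Qhat S L N t - Qbar S V L N M tol t) ^+ 2)%:E))%E).
    apply: ge0_le_integral => //.
    - by move=> t _; rewrite lee_fin sqr_ge0.
    - by apply: emeasurable_funD; apply: measurable_funeM.
    - move=> t _; rewrite -!EFinM -EFinD lee_fin.
      by have := sqr_ge0 (Qhat S L N t - theta S + (Qhat S L N t - Qbar S V L N M tol t)); nra.
  rewrite ge0_integralD//; last 4 first.
  - by move=> t _; rewrite mule_ge0// lee_fin sqr_ge0.
  - exact: measurable_funeM.
  - by move=> t _; rewrite mule_ge0// lee_fin sqr_ge0.
  - exact: measurable_funeM.
  rewrite !ge0_integralZl//; last 2 first.
  - by move=> t _; rewrite lee_fin sqr_ge0.
  - by move=> t _; rewrite lee_fin sqr_ge0.
  apply: (@le_trans _ _ (2%:E * (TOL ^+ 2 / 4)%:E + 2%:E * (TOL ^+ 2 / 4)%:E)%E).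
    by apply: leeD; apply: lee_wpmul2l.
  by rewrite -!EFinM -EFinD lee_fin; lra.
apply: (@le_trans _ _ (cost_num S kappa L N M tol)%:E).
  apply: ereal_inf_lbound; exists L, N, M, tol; split => //.
  by rewrite tolp.
rewrite lee_fin /cost_num.
have -> : \sum_(l < L.+1) (N l)%:R * (kappa * ((mlev S l)%:R * (M%:R + ln tol^-1))) =
    kappa * ((M%:R + ln tol^-1) * \sum_(l < L.+1) (N l)%:R * (2 ^ (l + lev0 S))%:R).
  by rewrite !mulr_sumr; apply: eq_bigr => l _; rewrite -/(mlev S l); ring.
have lnc : 0 <= ln c^-1 by rewrite ln_ge0// invf_ge1.
have lntol : ln tol^-1 <= (ln c^-1 + s / 2) * y.
  rewrite /tol invfM lnM ?posrE ?invr_gt0// mulrDl; apply: lerD.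
    by rewrite ler_peMr.
  have -> : ln TOL^-1 = s / 2 * ln y.
    rewrite /y ln_powR /x -exprVn lnXn ?invr_gt0// -mulr_natr.
    by field; rewrite gt_eqF.
  apply: ler_wpM2l; first by rewrite divr_ge0 ?(ltW s0).
  have := @le_ln1Dx _ (y - 1); rewrite [(1 + _)%R]addrC subrK => H.
  by apply: (le_trans (H _)); lra.
have yE : TOL `^ (- 2 - 2 / s) = x * y.
  rewrite powRD; last by rewrite (gt_eqF T0) implybT.
  rewrite powRN powR_mulrn ?(ltW T0)//; congr (_ * _).
  by rewrite /y /x -powR_mulrn ?(ltW T0)// -powRN -powRrM mulNr.
rewrite -[leRHS]mulrA ler_wpM2l ?(ltW k0)// yE.
have Mln : 0 <= M%:R + ln tol^-1 by rewrite addr_ge0// ln_ge0// invf_ge1// ltW.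
apply: (@le_trans _ _ ((M%:R + ln tol^-1) * (D * (x * ln TOL ^+ 2)))).
  by rewrite ler_wpM2l.
have -> : K5 * D * (x * y * ln TOL ^+ 2) = (K5 * y) * (D * (x * ln TOL ^+ 2)) by ring.
apply: ler_wpM2r.
  by apply: mulr_ge0; [exact: ltW|apply: mulr_ge0; [exact: ltW|exact: sqr_ge0]].
rewrite /K5 -addrA mulrDl; exact: lerD.
Qed.
End numerical.
End complexity.

(** * Moments of the scaled error *)

Section joint_density.
Context (R : realType) (dT : measure_display) (T : measurableType dT) (P : probability T R).
Local Notation mu := (@lebesgue_measure R).

(** Tonelli's theorem: x is integrated first, at density at most f y. *)
Lemma joint_density_moment (X Z : T -> R) (p : R -> R -> R) (f psi : R -> R) (K : R) :
  measurable_fun setT X -> measurable_fun setT Z ->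
  measurable_fun setT (fun z : R * R => p z.1 z.2) ->
  (forall x y, 0 <= p x y) -> (forall x y, p x y <= f y) ->
  (forall A : set (R * R), measurable A ->
    P [set t | A (X t, Z t)] =
    (\int[(lebesgue_measure \x lebesgue_measure)%E]_(z in A) (p z.1 z.2)%:E)%E) ->
  measurable_fun setT f ->
  (\int[mu]_y ((1 + `|y|) ^+ 4 * f y)%:E <= K%:E)%E ->
  measurable_fun setT psi -> (forall x, 0 <= psi x) ->
  (\int[P]_t ((1 + `|Z t|) ^+ 4 * psi (X t))%:E <= K%:E * \int[mu]_x (psi x)%:E)%E.
Proof.
move=> mX mZ mp p0 pf XZp mf fK mpsi psi0.
have f0 y : 0 <= f y by apply: le_trans (pf 0 y).
have mXZ : measurable_fun setT (fun t => (X t, Z t)) by exact: measurable_fun_pair.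
pose m1 : {measure set (R * R) -> \bar R} :=
  @measure_function_pushforward__canonical__measure_function_Measure _ _ _ _ _ P _ mXZ.
pose w (y : R) := (1 + `|y|) ^+ 4.
have w0 y : 0 <= w y by rewrite exprn_ge0// addr_ge0.
have mw : measurable_fun setT w.
  by apply: measurable_funX; apply: measurable_funD => //; exact: measurable_abs.
pose g (z : R * R) := w z.2 * psi z.1.
have g0 z : 0 <= g z by rewrite mulr_ge0.
have mg : measurable_fun setT g.
  by apply: measurable_funM; [exact: (measurableT_comp mw measurable_snd)|exact: (measurableT_comp mpsi measurable_fst)].
have mgE : measurable_fun setT (EFin \o g) by exact/measurable_EFinP.
have -> : (\int[P]_t (w (Z t) * psi (X t))%:E = \int[m1]_(z in setT) (g z)%:E)%E.
  rewrite (ge0_integral_pushforward mXZ P measurableT mgE) ?preimage_setT//.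
  by move=> z _; exact: g0.
rewrite (@ge0_integral_density _ _ _ (measurableTypeR R * measurableTypeR R)%type R m1
  (lebesgue_measure \x lebesgue_measure)%E idfun _ (EFin \o g) (@measurable_id _ _ _) mp (fun z => p0 _ _) XZp mgE (fun z => g0 z)).
pose G (z : R * R) := g z * p z.1 z.2.
have G0 z : 0 <= G z by rewrite mulr_ge0.
have mG : @measurable_fun _ _ (measurableTypeR R * measurableTypeR R)%type _ setT (EFin \o G).
  by apply/measurable_EFinP; apply: measurable_funM => //; exact: mg.
rewrite (@fubini_tonelli2 _ _ (measurableTypeR R) (measurableTypeR R) R lebesgue_measure lebesgue_measure (EFin \o G) mG (fun z => G0 z)).
set I := (\int[mu]_x (psi x)%:E)%E.
have I0 : (0 <= I)%E by exact: integral_real_ge0.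
apply: (@le_trans _ _ (\int[mu]_y ((w y * f y)%:E * I))%E); last first.
  rewrite ge0_integralZr//;
   try solve [by move=> y _; rewrite lee_fin mulr_ge0 | by apply/measurable_EFinP; exact: measurable_funM].
  exact: lee_wpmul2r.
apply: ge0_le_integral => //.
- by move=> y _; exact: integral_real_ge0.
- exact: (@measurable_fun_fubini_tonelli_G _ _ (measurableTypeR R) (measurableTypeR R) R lebesgue_measure _ mG (fun z => G0 z)).
- by apply: emeasurable_funM => //; apply/measurable_EFinP; exact: measurable_funM.
- move=> y _; rewrite /fubini_G /I -(integral_realZ mu measurableT mpsi psi0)//; last by rewrite mulr_ge0.
  apply: integral_real_le => //.
  + by have /measurable_EFinP := @measurable_fun_pair1 _ _ _ (measurableTypeR R) (measurableTypeR R) _ _ y mG.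
  + exact: measurable_funM.
  + move=> x _; suff : w y * psi x * p x y <= w y * f y * psi x by [].
    move: (w y) (w0 y) => c c0; rewrite -!mulrA; apply: ler_wpM2l => //.
    by rewrite [leRHS]mulrC; apply: ler_wpM2l.
Qed.

End joint_density.

Section setting.
Context (R : realType) (d : nat) (dT dE : measure_display)
  (T : measurableType dT) (P : probability T R) (E : measurableType dE).
Variable S : setting d P E.
Hypothesis hS : standing S.
Let W : measurableType _ := d.-1.-tuple R.
Local Notation Omega := (path_space W E).
Local Notation mu := (@lebesgue_measure R).

(** The arguments omega1, omega_(-1) and noises of all the functions below. *)
Definition sample_point (t : T) : R * Omega := (omega1 S t, base_path S t).

Lemma measurable_sample_point : measurable_fun setT sample_point.
Proof. by apply: measurable_fun_pair => //; exact: measurable_base_path. Qed.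

Definition phi_path (z : R * Omega) : R := phi S (z.1, z.2.1).
Definition scaled_path (m : nat) (z : R * Omega) : R :=
  Num.sqrt m%:R * (phihat S m (z.1, z.2.1) z.2.2 - phi_path z).

Lemma measurable_phi_path : measurable_fun setT phi_path.
Proof.
apply: (measurableT_comp (measurable_phi hS)).
apply: measurable_fun_pair => //.
by apply: measurableT_comp => //; exact: measurable_path_head.
Qed.

Lemma measurable_scaled_path m : measurable_fun setT (scaled_path m).
Proof.
apply: measurable_funM => //; apply: measurable_funB; first exact: measurable_phihat.
exact: measurable_phi_path.
Qed.

(** The bounds for r = 0 and r = 4 combine to one for (1 + |y|)^4, which is
    at most 8 (1 + |y|^4). *)
Lemma scaled_error_moment : assumptionA S ->
  exists2 K : R, 0 <= K & forall m, (0 < m)%N -> forall psi : R -> R,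
  measurable_fun setT psi -> (forall x, 0 <= psi x) ->
  (\int[P]_t ((1 + `|scaled_path m (sample_point t)|) ^+ 4 * psi (phi_path (sample_point t)))%:E
    <= K%:E * \int[mu]_x (psi x)%:E)%E.
Proof.
move=> [p [f [pP _ fP supf]]].
have bound r : 0 <= r <= 4 -> exists2 K : R, 0 <= K & forall m, (0 < m)%N ->
    (\int[mu]_y (`|y| `^ r * f 0 m y)%:E <= K%:E)%E.
  move=> r4; have := supf 0%N r isT r4.
  set s := ereal_sup _ => sfin.
  have ub m : (0 < m)%N -> (\int[mu]_y (`|y| `^ r * f 0 m y)%:E <= s)%E.
    by move=> m0; apply: ereal_sup_ubound; exists m.
  have s0 : (0 <= s)%E.
    apply: (le_trans _ (ub 1%N isT)); apply: integral_real_ge0 => y.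
    rewrite mulr_ge0 ?powR_ge0//.
    by have [_ /(_ 0 y)] := fP 0%N 1%N isT isT; exact: le_trans.
  exists (fine s); first exact: fine_ge0.
  by move=> m m0; rewrite fineK ?ge0_fin_numE//; exact: ub.
have [K0 K00 HK0] := bound 0 (introT andP (conj (lexx 0) (ler0n _ 4))).
have [K4 K40 HK4] := bound 4 (introT andP (conj (ler0n _ 4) (lexx _))).
exists (8 * (K0 + K4)); first by rewrite mulr_ge0// addr_ge0.
move=> m m0 psi mpsi psi0.
have [mp p0 pA] := pP m m0; have [mf fm] := fP 0%N m isT m0.
have pf x y : p m x y <= f 0%N m y.
  by apply: le_trans (fm x y) => /=; exact: ler_norm.
have f0 y : 0 <= f 0%N m y by exact: le_trans (p0 0 y) (pf 0 y).
have msp := measurable_sample_point.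
apply: (@joint_density_moment _ _ _ P (phi_path \o sample_point) (scaled_path m \o sample_point) (p m) (f 0%N m)) => //.
- exact: (measurableT_comp measurable_phi_path msp).
- exact: (measurableT_comp (measurable_scaled_path m) msp).
have mpow r : measurable_fun setT (fun y : R => `|y| `^ r * f 0%N m y).
  apply: measurable_funM => //.
  exact: (measurableT_comp (@measurable_powR R r) (@normr_measurable _ _)).
have pow0 r y : 0 <= `|y| `^ r * f 0%N m y by rewrite mulr_ge0 ?powR_ge0.
apply: (@le_trans _ _ (\int[mu]_y (8 * (`|y| `^ 0 * f 0%N m y + `|y| `^ 4 * f 0%N m y))%:E)%E).
  have m1 : measurable_fun setT (fun y : R => (1 + `|y|) ^+ 4 * f 0%N m y).
    by apply: measurable_funM => //; apply: measurable_funX; apply: measurable_funD => //; exact: measurable_abs.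
  have m2 : measurable_fun setT (fun y : R => 8 * (`|y| `^ 0 * f 0%N m y + `|y| `^ 4 * f 0%N m y)).
    by apply: measurable_funM => //; exact: measurable_funD.
  apply: (integral_real_le mu measurableT m1 m2) => [y|].
  - by rewrite mulr_ge0// exprn_ge0// addr_ge0.
  - move=> y _; rewrite powRr0 mul1r -[4]/(4%:R) powR_mulrn//.
    rewrite (_ : 8 * _ = (8 * (1 + `|y| ^+ 4)) * f 0%N m y); last by ring.
    apply: ler_wpM2r => //; have : 0 <= `|y| by [].
    move: `|y| => x x0.
    have h2 : (1 + x) ^+ 2 <= 2 * (1 + x ^+ 2) by have := sqr_ge0 (1 - x); nra.
    have h4 : ((1 + x) ^+ 2) ^+ 2 <= (2 * (1 + x ^+ 2)) ^+ 2.
      by rewrite lerXn2r ?nnegrE ?sqr_ge0// mulr_ge0 ?addr_ge0 ?sqr_ge0.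
    rewrite -exprM in h4; apply: (le_trans h4).
    have := sqr_ge0 (1 - x ^+ 2).
    rewrite [X in 0 <= X -> _](_ : _ = 1 + x ^+ 4 - 2 * x ^+ 2); last by ring.
    rewrite (_ : (2 * (1 + x ^+ 2)) ^+ 2 = 4 * (1 + x ^+ 4 + 2 * x ^+ 2)); last by ring.
    by lra.
have m3 : measurable_fun setT (fun y : R => `|y| `^ 0 * f 0%N m y + `|y| `^ 4 * f 0%N m y).
  exact: (measurable_funD (mpow 0) (mpow 4)).
have p3 y : 0 <= `|y| `^ 0 * f 0%N m y + `|y| `^ 4 * f 0%N m y by rewrite addr_ge0.
rewrite (integral_realZ mu measurableT m3 p3 (ler0n _ 8)).
rewrite (integral_realD mu measurableT (mpow 0) (mpow 4) (pow0 0) (pow0 4)).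
rewrite EFinM; apply: lee_wpmul2l; first by rewrite lee_fin (ler0n _ 8).
by rewrite EFinD; apply: leeD; [exact: HK0|exact: HK4].
Qed.
End setting.

(** * Means at a random point of a path *)

Section stochO1.
Context (R : realType) (dT : measure_display) (T : measurableType dT) (P : probability T R).

Lemma stochO1_moment (I : Type) (F : I -> T -> R) (k : nat) : stochO1 P F ->
  exists2 M : R, 0 <= M & forall i (G : T -> R), measurable_fun setT G ->
    {ae P, forall t, G t = F i t} -> (\int[P]_t (`|G t| ^+ k)%:E <= M%:E)%E.
Proof.
move=> [C [Cint FC]].
have mabs (G : T -> R) : measurable_fun setT G -> measurable_fun setT (fun t => (`|G t| ^+ k)%:E).
  move=> mG; apply/measurable_EFinP; apply: measurable_funX.
  exact: (measurable_abs mG).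
have C0 : (0 <= \int[P]_t (`|C t| ^+ k)%:E)%E.
  by apply: integral_real_ge0 => t; rewrite exprn_ge0.
exists (fine (\int[P]_t (`|C t| ^+ k)%:E)); first exact: fine_ge0.
move=> i G mG GF; rewrite fineK; last exact: (integrable_fin_num measurableT (Cint k)).
apply: (ae_ge0_le_integral measurableT _ (mabs _ mG) _ (mabs _ (measurable_funP C))).
- by move=> t _; rewrite lee_fin exprn_ge0.
- by move=> t _; rewrite lee_fin exprn_ge0.
have := FC i; apply: filterS2 GF => t -> FCt _.
rewrite lee_fin lerXn2r ?nnegrE//; apply: (le_trans FCt); exact: ler_norm.
Qed.
End stochO1.

Section setting.
Context (R : realType) (d : nat) (dT dE : measure_display)
  (T : measurableType dT) (P : probability T R) (E : measurableType dE).
Variable S : setting d P E.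
Hypothesis hS : standing S.
Let W : measurableType _ := d.-1.-tuple R.
Local Notation Omega := (path_space W E).
Local Notation mu := (@lebesgue_measure R).
Local Notation ES g := (\int[P]_t (g (sample_point S t))%:E)%E.

Lemma measurable_at_sample (g : R * Omega -> R) : measurable_fun setT g ->
  measurable_fun setT (fun t => g (sample_point S t)).
Proof. by move=> mg; exact: (measurableT_comp mg (measurable_sample_point S)). Qed.

Lemma measurable_section (g : R * Omega -> R) v : measurable_fun setT g ->
  measurable_fun setT (fun u : R => g (u, v)).
Proof. by move=> mg; exact: (measurable_fun_pair1 v mg). Qed.

Lemma measurable_path_integral (g : R * Omega -> R) : measurable_fun setT g ->
  (forall z, 0 <= g z) ->
  measurable_fun setT (fun t => \int[mu]_u (g (u, base_path S t) * rho1 S u)%:E)%E.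
Proof.
move=> mg g0.
have m : measurable_fun setT (fun z : measurableTypeR R * Omega => (g z * rho1 S z.1)%:E).
  apply/measurable_EFinP; apply: measurable_funM => //.
  by apply: measurableT_comp; [exact: rho1_measurable|].
have p z : (0 <= (g z * rho1 S z.1)%:E)%E by rewrite lee_fin mulr_ge0// (rho1_ge0 hS).
have := @measurable_fun_fubini_tonelli_G _ _ (measurableTypeR R) _ R lebesgue_measure _ m p.
by move=> /measurableT_comp /(_ (measurable_base_path S)).
Qed.

Lemma expectation_path (g : R * Omega -> R) :
  measurable_fun setT g -> (forall z, 0 <= g z) ->
  (ES g = \int[P]_t \int[mu]_u (g (u, base_path S t) * rho1 S u)%:E)%E.
Proof.
move=> mg g0; apply: (expectation_omega1_path hS (g := EFin \o g)) => [|z].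
  exact/measurable_EFinP.
by rewrite lee_fin.
Qed.

Definition error_path m (z : R * Omega) : R := phihat S m (z.1, z.2.1) z.2.2 - phi_path S z.

Lemma measurable_error_path m : measurable_fun setT (error_path m).
Proof.
apply: measurable_funB; first exact: measurable_phihat.
exact: measurable_phi_path.
Qed.

Lemma phi_moment (k : nat) : assumptionB S ->
  exists2 M : R, 0 <= M & (ES (fun z => `|phi_path S z| ^+ k) <= M%:E)%E.
Proof.
move=> [_ H _ _]; have [M M0 HM] := stochO1_moment k H.
exists M => //; apply: (HM tt (fun t => phi_path S (sample_point S t))).
  exact: measurable_at_sample (measurable_phi_path hS).
exact: aeW.
Qed.

(** Since |Z| <= (1 + |Z|)^4 / (1 + phi^2) + (1 + phi^2), the mean of |Z| is
    bounded in m: the first term by [scaled_error_moment], the Cauchy kernel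
    being integrable, and the second because phi(omega) has moments. *)
Lemma error_mean : assumptionA S -> assumptionB S ->
  exists2 K : R, 0 <= K & forall m, (0 < m)%N ->
    (ES (fun z => `|error_path m z|) <= (K / Num.sqrt m%:R)%:E)%E.
Proof.
move=> hA hB; have [KA KA0 HA] := scaled_error_moment hS hA.
have [M M0 HM] := phi_moment 2 hB.
exists (KA * pi + (1 + M)); first by rewrite !addr_ge0// mulr_ge0// pi_ge0.
move=> m m0; have s0 : 0 < Num.sqrt m%:R :> R by rewrite sqrtr_gt0 ltr0n.
pose psi (x : R) := (1 + (1 * (x - 0)) ^+ 2)^-1.
have psi0 x : 0 <= psi x by rewrite invr_ge0 addr_ge0 ?sqr_ge0.
have mpsi : measurable_fun setT psi.
  apply: measurable_inv; apply: measurable_funD => //.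
  by apply: measurable_funX; apply: measurable_funM => //; exact: measurable_funB.
have mE := measurable_at_sample (measurable_error_path m).
have mZ := measurable_at_sample (measurable_scaled_path hS m).
have mphi := measurable_at_sample (measurable_phi_path hS).
rewrite [X in (_ <= X%:E)%E]mulrC EFinM -lee_pdivrMl ?invr_gt0// invrK.
rewrite -(integral_realZ P measurableT (measurable_abs mE) (fun t => normr_ge0 _) (ltW s0)).
pose z4 t := (1 + `|scaled_path S m (sample_point S t)|) ^+ 4 * psi (phi_path S (sample_point S t)).
pose q t := 1 + `|phi_path S (sample_point S t)| ^+ 2.
have mz4 : measurable_fun setT z4.
  apply: measurable_funM; last exact: measurableT_comp.
  by apply: measurable_funX; apply: measurable_funD => //; exact: measurable_abs.
have mq2 : measurable_fun setT (fun t => `|phi_path S (sample_point S t)| ^+ 2).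
  by apply: measurable_funX; exact: measurable_abs.
have mq : measurable_fun setT q by apply: measurable_funD.
have z40 t : 0 <= z4 t by rewrite mulr_ge0// exprn_ge0// addr_ge0.
have q0 t : 0 <= q t by rewrite addr_ge0// exprn_ge0.
apply: (@le_trans _ _ (\int[P]_t (z4 t + q t)%:E)%E).
  apply: integral_real_le => //.
  - by apply: measurable_funM => //; exact: measurable_abs.
  - exact: measurable_funD.
  - move=> t _; rewrite /z4 /q /psi subr0 mul1r.
    have -> : Num.sqrt m%:R * `|error_path m (sample_point S t)| = `|scaled_path S m (sample_point S t)|.
      by rewrite /scaled_path normrM (gtr0_norm s0).
    rewrite real_normK ?num_real//.
    set x := phi_path S _; have : 0 <= `|scaled_path S m (sample_point S t)| by [].
    move: `|scaled_path S m (sample_point S t)| => z z0.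
    have q1 : 0 < 1 + x ^+ 2 by rewrite ltr_wpDr// sqr_ge0.
    rewrite -(ler_pM2r q1) mulrDl divfK ?gt_eqF//.
    move: (1 + x ^+ 2) q1 => b b0.
    have := sqr_ge0 ((1 + z) ^+ 2 - b).
    rewrite [X in 0 <= X -> _](_ : _ = (1 + z) ^+ 4 + b * b - 2 * ((1 + z) ^+ 2 * b)); last by ring.
    have : z * b <= 2 * ((1 + z) ^+ 2 * b).
      by rewrite mulrA; apply: ler_wpM2r; [exact: ltW|nra].
    by lra.
rewrite integral_realD// EFinD; apply: leeD.
  apply: (le_trans (HA m m0 psi mpsi psi0)); rewrite EFinM.
  apply: lee_wpmul2l; first by rewrite lee_fin.
  by have := @integral_cauchy_le R 1 0 ltr01; rewrite divr1.
rewrite /q integral_realD// EFinD; apply: leeD => //.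
by rewrite integral_cst// mul1e probability_le1.
Qed.
End setting.

(** * Slopes of the inner averages *)

Section setting.
Context (R : realType) (d : nat) (dT dE : measure_display)
  (T : measurableType dT) (P : probability T R) (E : measurableType dE).
Variable S : setting d P E.
Hypothesis hS : standing S.
Let W : measurableType _ := d.-1.-tuple R.
Local Notation Omega := (path_space W E).
Local Notation mu := (@lebesgue_measure R).
Local Notation ES g := (\int[P]_t (g (sample_point S t))%:E)%E.

Local Notation slow h := (\1_(slowly_decreasing (rho1 S) h) : R -> R).

Definition inner_path m (z : R * Omega) : R := phihat S m (z.1, z.2.1) z.2.2.

Lemma measurable_inner_path m : measurable_fun setT (inner_path m).
Proof. exact: measurable_phihat. Qed.

Lemma measurable_shift (f : R * Omega -> R) (h : R) : measurable_fun setT f ->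
  measurable_fun setT (fun z : R * Omega => f (z.1 + h, z.2)).
Proof.
move=> mf; apply: (measurableT_comp mf (g := fun z : R * Omega => (z.1 + h, z.2))).
by apply: measurable_fun_pair => //; exact: measurable_funD.
Qed.

(** The derivative of the inner average as an everywhere defined measurable
    function; the inner average is differentiable along almost all paths
    only. *)
Definition inner_slope m (z : R * Omega) : R :=
  fine (limn_esup (fun n =>
    (n.+1%:R * (inner_path m (z.1 + n.+1%:R^-1, z.2) - inner_path m z))%:E)).

Lemma measurable_inner_slope m : measurable_fun setT (inner_slope m).
Proof.
apply: measurableT_comp; first exact: fine_measurable.
apply: measurable_fun_limn_esup => n; apply/measurable_EFinP.
apply: measurable_funM => //; apply: measurable_funB; last exact: measurable_inner_path.
by apply: measurable_shift; exact: measurable_inner_path.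
Qed.

Lemma inner_slopeE l t u : derivable (phihat_path S l t) u 1 ->
  inner_slope (mlev S l) (u, base_path S t) = derive1 (phihat_path S l t) u.
Proof.
move=> df; rewrite /inner_slope.
have /cvg_limn_einf_sup[_ ->//] :
  ((n.+1%:R * (inner_path (mlev S l) (u + n.+1%:R^-1, base_path S t) -
       inner_path (mlev S l) (u, base_path S t)))%:E @[n --> \oo] -->
     (derive1 (phihat_path S l t) u)%:E)%E.
apply: cvg_EFin; first exact: nearW.
exact: (derive1_quotient_cvg df).
Qed.

Lemma inner_slope_moment (k : nat) : assumptionC S ->
  exists2 M : R, 0 <= M & forall l,
    (ES (fun z => (`|inner_slope (mlev S l) z|^-1) ^+ k) <= M%:E)%E.
Proof.
move=> [dC OC]; have [M M0 HM] := stochO1_moment k OC.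
exists M => // l.
have := HM l (fun t => (inner_slope (mlev S l) (sample_point S t))^-1).
under eq_integral do rewrite normfV; apply.
  apply: measurable_inv.
  by apply: measurable_at_sample; exact: measurable_inner_slope.
by apply: filterS (dC l) => t Ht; rewrite inner_slopeE//; case: (Ht (omega1 S t)).
Qed.

(** A function of the difference quotient of f, bounded thanks to delta, which
    approximates |f'|^-k as h and delta tend to 0. *)
Definition slope_test (f : R * Omega -> R) (h delta : R) (k : nat) (z : R * Omega) : R :=
  slow h z.1 *
    (`|(f (z.1 + h, z.2) - f z) / h| + delta)^-1 ^+ k.

Lemma slope_test_ge0 f h delta k z : 0 < delta -> 0 <= slope_test f h delta k z.
Proof.
by move=> d0; rewrite mulr_ge0// exprn_ge0// invr_ge0 addr_ge0// ltW.
Qed.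

Lemma measurable_slow_indicator h : continuous (rho1 S) ->
  measurable_fun setT (fun z : R * Omega => slow h z.1 : R).
Proof.
move=> cr; apply: measurableT_comp => //; apply: measurable_indic.
exact: measurable_slowly_decreasing.
Qed.

Lemma measurable_slope_test f h delta k : continuous (rho1 S) ->
  measurable_fun setT f -> measurable_fun setT (slope_test f h delta k).
Proof.
move=> cr mf; apply: measurable_funM; first exact: measurable_slow_indicator.
apply: measurable_funX; apply: measurable_inv.
apply: measurable_funD => //; apply: measurable_abs.
by apply: measurable_funM => //; apply: measurable_funB => //; exact: measurable_shift.
Qed.

Lemma inner_slope_test_le l h delta k : continuous (rho1 S) -> 0 < h -> 0 < delta ->
  assumptionC S ->
  (ES (slope_test (inner_path (mlev S l)) h delta k) <=
   2%:E * ES (fun z => (`|inner_slope (mlev S l) z|^-1) ^+ k))%E.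
Proof.
move=> cr h0 d0 [dC _].
have mt := measurable_slope_test h delta k cr (measurable_inner_path (mlev S l)).
have t0 z := slope_test_ge0 (inner_path (mlev S l)) h k z d0.
have mi : measurable_fun setT (fun z => (`|inner_slope (mlev S l) z|^-1) ^+ k).
  apply: measurable_funX; apply: measurable_inv.
  apply: measurable_abs; exact: measurable_inner_slope.
have i0 z : 0 <= (`|inner_slope (mlev S l) z|^-1) ^+ k by rewrite exprn_ge0// invr_ge0.
rewrite (expectation_path hS mt t0) (expectation_path hS mi i0).
have mIt := measurable_path_integral hS mt t0.
have mIi := measurable_path_integral hS mi i0.
rewrite -ge0_integralZl//; last first.
  by move=> t _; apply: integral_real_ge0 => u; rewrite mulr_ge0// (rho1_ge0 hS).
apply: (ae_ge0_le_integral measurableT _ mIt _ (measurable_funeM _ mIi)).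
- by move=> t _; apply: integral_real_ge0 => u; rewrite mulr_ge0// (rho1_ge0 hS).
- by move=> t _; apply: mule_ge0 => //; apply: integral_real_ge0 => u; rewrite mulr_ge0// (rho1_ge0 hS).
apply: filterS (dC l) => t Ht _.
have := integral_inverse_slope_le k h0 d0 (rho1_ge0 hS) cr Ht.
move=> /le_trans; apply; apply: lee_wpmul2l => //.
apply: eq_leW; apply: eq_integral => u _.
by rewrite inner_slopeE//; case: (Ht u).
Qed.

(** On the slowly decreasing set the density at omega1 is at most twice the
    density at omega1 + h. *)
Lemma shifted_error_le m h : continuous (rho1 S) -> 0 < h ->
  (ES (fun z => slow h z.1 * `|error_path S m (z.1 + h, z.2)|) <=
   2%:E * ES (fun z => `|error_path S m z|))%E.
Proof.
move=> cr h0.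
have me : measurable_fun setT (fun z => `|error_path S m z|).
  by apply: measurable_abs; exact: measurable_error_path.
have ms : measurable_fun setT (fun z : R * Omega =>
    slow h z.1 * `|error_path S m (z.1 + h, z.2)|).
  by apply: measurable_funM; [exact: measurable_slow_indicator|exact: (measurable_shift h me)].
rewrite (expectation_path hS ms) => [|z]; last by rewrite mulr_ge0.
rewrite (expectation_path hS me)//.
have ms0 (z : R * Omega) : 0 <= slow h z.1 * `|error_path S m (z.1 + h, z.2)| by rewrite mulr_ge0.
have me0 z : 0 <= `|error_path S m z| by [].
have mIs := measurable_path_integral hS ms ms0.
have mIe := measurable_path_integral hS me me0.
rewrite -ge0_integralZl//; last first.
  by move=> t _; apply: integral_real_ge0 => u; rewrite mulr_ge0// (rho1_ge0 hS).
apply: ge0_le_integral => //.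
- by move=> t _; apply: integral_real_ge0 => u; rewrite mulr_ge0// (rho1_ge0 hS).
- exact: measurable_funeM.
move=> t _.
have mr := rho1_measurable hS.
have mg : measurable_fun setT (fun u => `|error_path S m (u, base_path S t)| * rho1 S u).
  by apply: measurable_funM => //; exact: (measurable_section (base_path S t) me).
have g0 u : 0 <= `|error_path S m (u, base_path S t)| * rho1 S u by rewrite mulr_ge0// (rho1_ge0 hS).
have mgE : measurable_fun setT (fun u => (`|error_path S m (u, base_path S t)| * rho1 S u)%:E).
  exact/measurable_EFinP.
rewrite -(integral_translation h mgE (fun u => g0 u)).
have madd : measurable_fun setT (fun u : R => u + h) by exact: measurable_funD.
have mgh := measurableT_comp mg madd.
rewrite -(integral_realZ mu measurableT mgh (fun u => g0 _) (ler0n _ 2)).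
apply: (integral_real_le mu measurableT).
- by apply: measurable_funM => //; exact: (measurable_section (base_path S t) ms).
- exact: measurable_funM.
- by move=> u; rewrite mulr_ge0// (rho1_ge0 hS).
move=> u _ /=; have [uK|uK] := pselect (slowly_decreasing (rho1 S) h u); last first.
  by rewrite indicE memNset// !mul0r mulr_ge0.
rewrite indicE mem_set// mul1r mulrCA; apply: ler_wpM2l => //.
by apply: uK; rewrite lexx andbT ltW.
Qed.

(** The bound holds for the inner averages by [inner_slope_test_le]. It passes
    to phi because the test function is Lipschitz in the difference quotient
    and the error at omega1 and at omega1 + h tends to 0 in mean; the Lipschitz
    constant depends on h and delta, the final bound does not. *)
Lemma slope_test_moment (k : nat) : assumptionA S -> assumptionB S -> assumptionC S ->
  continuous (rho1 S) ->
  exists2 M : R, 0 <= M & forall h delta, 0 < h -> 0 < delta ->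
    (ES (slope_test (phi_path S) h delta k) <= M%:E)%E.
Proof.
move=> hA hB hC cr.
have [M M0 HM] := inner_slope_moment k hC.
have [K K0 HK] := error_mean hS hA hB.
exists (2 * M); first by rewrite mulr_ge0.
move=> h delta h0 d0.
have [C C0 HC] := regularized_inverse_lipschitz k d0.
pose b := C / h * (3 * K).
have Ch0 : 0 <= C / h by rewrite divr_ge0// ltW.
have b0 : 0 <= b by rewrite mulr_ge0// mulr_ge0.
have step l : (ES (slope_test (phi_path S) h delta k) <= (2 * M + b / Num.sqrt (mlev S l)%:R)%:E)%E.
  pose m := mlev S l; have m0 : (0 < m)%N by rewrite /m /mlev expn_gt0.
  have me : measurable_fun setT (fun z => `|error_path S m z|).
    by apply: measurable_abs; exact: measurable_error_path.
  have ms : measurable_fun setT (fun z : R * Omega =>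
      slow h z.1 * `|error_path S m (z.1 + h, z.2)|).
    by apply: measurable_funM; [exact: measurable_slow_indicator|exact: (measurable_shift h me)].
  have ms0 (z : R * Omega) : 0 <= slow h z.1 * `|error_path S m (z.1 + h, z.2)| by rewrite mulr_ge0.
  have mi := measurable_slope_test h delta k cr (measurable_inner_path m).
  have mp := measurable_slope_test h delta k cr (measurable_phi_path hS).
  have msum : measurable_fun setT (fun z : R * Omega =>
      slow h z.1 * `|error_path S m (z.1 + h, z.2)| + `|error_path S m z|).
    exact: measurable_funD.
  apply: (@le_trans _ _ (ES (fun z => slope_test (inner_path m) h delta k z +
      C / h * (slow h z.1 * `|error_path S m (z.1 + h, z.2)| + `|error_path S m z|)))).
    apply: (integral_real_le P measurableT).
    - exact: measurable_at_sample.
    - apply: (measurable_at_sample S (g := fun z : R * Omega => slope_test (inner_path m) h delta k z +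
      C / h * (slow h z.1 * `|error_path S m (z.1 + h, z.2)| + `|error_path S m z|))).
      by apply: measurable_funD => //; exact: measurable_funM.
    - by move=> t; exact: slope_test_ge0.
    move=> t _; move: (sample_point S t) => z; rewrite /slope_test.
    have [uK|uK] := pselect (slowly_decreasing (rho1 S) h z.1); last first.
      by rewrite indicE memNset// !mul0r !add0r mulr_ge0.
    rewrite indicE mem_set// !mul1r; apply: (le_trans (HC _ ((inner_path m (z.1 + h, z.2) - inner_path m z) / h))); rewrite lerD2l.
    rewrite -mulrA; apply: ler_wpM2l => //.
    rewrite -mulrBl normrM (ger0_norm (_ : 0 <= h^-1)) ?invr_ge0 ?(ltW h0)// mulrC.
    apply: ler_wpM2l; first by rewrite invr_ge0 ltW.
    apply: le_trans (ler_normB _ _).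
    rewrite -normrN /error_path -/(inner_path m z) -/(inner_path m (z.1 + h, z.2)).
    by apply: eq_leW; congr `|_|; ring.
  have i0 z := slope_test_ge0 (inner_path m) h k z d0.
  rewrite (integral_realD P measurableT (measurable_at_sample S mi)
     (measurable_at_sample S (measurable_funM (measurable_cst (C / h)) msum)) (fun t => i0 _)); last first.
    by move=> t /=; rewrite mulr_ge0// addr_ge0.
  rewrite EFinD; apply: leeD.
    apply: (le_trans (inner_slope_test_le l k cr h0 d0 hC)); rewrite EFinM.
    by apply: lee_wpmul2l => //; exact: HM.
  rewrite /= (integral_realZ P measurableT (measurable_at_sample S msum)) //.
  have -> : b / Num.sqrt (mlev S l)%:R = C / h * (3 * K / Num.sqrt m%:R) by rewrite /b /m; ring.
  rewrite [leRHS]EFinM; apply: lee_wpmul2l; first by rewrite lee_fin.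
  rewrite (integral_realD P measurableT (measurable_at_sample S ms) (measurable_at_sample S me)) //.
  rewrite [X in (_ <= X%:E)%E](_ : _ = 2 * (K / Num.sqrt m%:R) + K / Num.sqrt m%:R); last by rewrite /m; ring.
  rewrite EFinD; apply: leeD; last exact: HK.
  apply: (le_trans (shifted_error_le m cr h0)); rewrite EFinM.
  by apply: lee_wpmul2l => //; exact: HK.
apply/lee_addgt0Pr => e e0.
(* 2^l exceeds (b / e)^2 *)
pose l := (Num.truncn ((b / e) ^+ 2)).+1.
apply: (le_trans (step l)); rewrite -EFinD lee_fin lerD2l.
have s0 : 0 < Num.sqrt (mlev S l)%:R :> R by rewrite sqrtr_gt0 ltr0n /mlev expn_gt0.
rewrite ler_pdivrMr// mulrC -ler_pdivrMr//.
have be0 : 0 <= b / e by rewrite divr_ge0// ltW.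
rewrite -(ger0_norm be0) -sqrtr_sqr; apply: ler_wsqrtr.
apply: (le_trans (ltW (truncnS_gt _))); rewrite ler_nat -/l.
apply: (leq_trans (ltnW (ltn_expl l (ltnSn 1)))).
by rewrite /mlev leq_exp2l// leq_addr.
Qed.
End setting.

(** * Slopes of the regression function *)

Section setting.
Context (R : realType) (d : nat) (dT dE : measure_display)
  (T : measurableType dT) (P : probability T R) (E : measurableType dE).
Variable S : setting d P E.
Hypothesis hS : standing S.
Let W : measurableType _ := d.-1.-tuple R.
Local Notation Omega := (path_space W E).
Local Notation mu := (@lebesgue_measure R).
Local Notation ES g := (\int[P]_t (g (sample_point S t))%:E)%E.

Definition slope_path (z : R * Omega) : R := dphi S z.2.1 z.1.
Definition curvature_path (z : R * Omega) : R := derive1 (dphi S z.2.1) z.1.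

Local Notation flat := (\1_[set z | slope_path z = 0] : R * Omega -> R).
Local Notation steep := (\1_[set z | slope_path z != 0] : R * Omega -> R).

Section derivatives.
Hypothesis hB : assumptionB S.

Lemma derivable_phi_path (v : Omega) u : derivable (fun x => phi_path S (x, v)) u 1.
Proof. by have [df _ _ _] := hB; case: (df u v.1). Qed.

Lemma measurable_slope_path : measurable_fun setT slope_path.
Proof.
apply: (measurable_derive1_pair (measurable_phi_path hS)) => u v; exact: derivable_phi_path.
Qed.

Lemma measurable_curvature_path : measurable_fun setT curvature_path.
Proof.
apply: (measurable_derive1_pair measurable_slope_path) => u v.
by have [df _ _ _] := hB; case: (df u v.1).
Qed.

Lemma curvature_moment (k : nat) :
  exists2 M : R, 0 <= M & (ES (fun z => `|curvature_path z| ^+ k) <= M%:E)%E.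
Proof.
have [_ _ _ H] := hB; have [M M0 HM] := stochO1_moment k H.
exists M => //; apply: (HM tt (fun t => curvature_path (sample_point S t))).
  exact: measurable_at_sample measurable_curvature_path.
exact: aeW.
Qed.

Hypotheses (hA : assumptionA S) (hC : assumptionC S)
  (rho_gt0 : forall u, 0 < rho1 S u) (cr : continuous (rho1 S)).

(** Fatou's lemma along h = 1 / (n + 1). *)
Lemma regularized_slope_moment (k : nat) :
  exists2 M : R, 0 <= M & forall delta, 0 < delta ->
    (ES (fun z => (`|slope_path z| + delta)^-1 ^+ k) <= M%:E)%E.
Proof.
have [M M0 HM] := slope_test_moment hS k hA hB hC cr.
exists M => // delta d0.
apply: (@integral_real_cvg_le _ _ _ P
  (fun n t => slope_test S (phi_path S) n.+1%:R^-1 delta k (sample_point S t))) => [n|n t|t|n].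
- apply: measurable_at_sample; apply: measurable_slope_test => //.
  exact: measurable_phi_path.
- exact: slope_test_ge0.
- move: (sample_point S t) => [u v].
  pose q n := (phi_path S (u + n.+1%:R^-1, v) - phi_path S (u, v)) / n.+1%:R^-1 : R.
  have qE : q = fun n : nat => n.+1%:R * (phi_path S (u + n.+1%:R^-1, v) - phi_path S (u, v)).
    by apply/funext => n; rewrite /q invrK mulrC.
  have ql : q n @[n --> \oo] --> slope_path (u, v).
    rewrite qE; exact: (@derive1_quotient_cvg R (fun x => phi_path S (x, v)) u (@derivable_phi_path v u)).
  have lim : (`|q n| + delta)^-1 ^+ k @[n --> \oo] --> (`|slope_path (u, v)| + delta)^-1 ^+ k.
    apply: (@continuous_cvg _ _ _ _ _ (fun n : nat => (`|q n| + delta)^-1) (fun y : R => y ^+ k)).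
      exact: exprn_continuous.
    apply: cvgV; first by rewrite gt_eqF// ltr_wpDl.
    by apply: cvgD; [exact: (cvg_norm ql)|exact: cvg_cst].
  apply: cvg_trans lim; apply: near_eq_cvg.
  near=> n; rewrite /slope_test indicE mem_set ?mul1r//=.
  by near: n; exact: near_slowly_decreasing.
- exact: HM.
Unshelve. all: by end_near. Qed.

(** Where the slope vanishes, delta times the regularized inverse is 1, while
    its mean is O(delta). *)
Lemma slope_neq0_as : (ES (fun z => flat z) = 0)%E.
Proof.
have [M M0 HM] := regularized_slope_moment 1.
have mZ : measurable [set z | slope_path z = 0].
  rewrite -[X in measurable X]setTI.
  exact: (measurable_slope_path measurableT (measurable_set1 0)).
have mI : measurable_fun setT flat by exact: measurable_indic.
apply/eqP; rewrite eq_le integral_real_ge0// andbT.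
apply/lee_addgt0Pr => e e0; rewrite add0e.
have M1 : 0 < M + 1 by lra.
pose delta := e / (M + 1); have d0 : 0 < delta by rewrite divr_gt0.
apply: (@le_trans _ _ (ES (fun z => delta * (`|slope_path z| + delta)^-1 ^+ 1))).
  apply: (integral_real_le P measurableT) => //.
  - exact: measurable_at_sample.
  - apply: (measurable_at_sample S (g := fun z => delta * (`|slope_path z| + delta)^-1 ^+ 1)).
    apply: measurable_funM => //; apply: measurable_funX.
    apply: measurable_inv; apply: measurable_funD => //.
    exact: (measurable_abs measurable_slope_path).
  - move=> t _; move: (sample_point S t) => z; rewrite expr1 indicE.
    have [zZ|zZ] := boolP (z \in [set z | slope_path z = 0]).
      move: zZ; rewrite inE /= => ->; rewrite normr0 add0r mulfV// gt_eqF//.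
    by rewrite mulr_ge0 ?invr_ge0 ?addr_ge0// ltW.
have mr : measurable_fun setT (fun z => (`|slope_path z| + delta)^-1 ^+ 1).
  apply: measurable_funX.
  apply: measurable_inv; apply: measurable_funD => //.
  exact: (measurable_abs measurable_slope_path).
rewrite (integral_realZ P measurableT (measurable_at_sample S mr)) ?(ltW d0)//; last first.
  by move=> t; rewrite exprn_ge0// invr_ge0 addr_ge0// ltW.
apply: (@le_trans _ _ (delta%:E * M%:E)%E).
  by apply: lee_wpmul2l; [rewrite lee_fin ltW|exact: HM].
rewrite -EFinM lee_fin /delta mulrAC ler_pdivrMr// ler_wpM2l ?(ltW e0)//.
by lra.
Qed.

(** Fatou's lemma along delta = 1 / (n + 1), on the set where the slope does
    not vanish. *)
Lemma inverse_slope_moment (k : nat) :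
  exists2 M : R, 0 <= M & (ES (fun z => (`|slope_path z|^-1) ^+ k.+1) <= M%:E)%E.
Proof.
have [M M0 HM] := regularized_slope_moment k.+1.
exists M => //.
have mZ : measurable [set z | slope_path z != 0].
  rewrite (_ : [set z | _] = ~` [set z | slope_path z = 0]); last first.
    by apply/seteqP; split => z /= /eqP.
  apply: measurableC; rewrite -[X in measurable X]setTI.
  exact: (measurable_slope_path measurableT (measurable_set1 0)).
have mI : measurable_fun setT steep by exact: measurable_indic.
have mreg (delta : R) : measurable_fun setT (fun z => (`|slope_path z| + delta)^-1 ^+ k.+1).
  apply: measurable_funX.
  apply: measurable_inv; apply: measurable_funD => //.
  exact: (measurable_abs measurable_slope_path).
have n0 n : 0 < n.+1%:R^-1 :> R by rewrite invr_gt0.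
have reg0 n z : 0 <= (`|slope_path z| + n.+1%:R^-1)^-1 ^+ k.+1.
  by rewrite exprn_ge0// invr_ge0 addr_ge0// ltW.
apply: (@integral_real_cvg_le _ _ _ P (fun n t => steep (sample_point S t) *
   (`|slope_path (sample_point S t)| + n.+1%:R^-1)^-1 ^+ k.+1)) => [n|n t|t|n].
- apply: (measurable_at_sample S (g := fun z => steep z * (`|slope_path z| + n.+1%:R^-1)^-1 ^+ k.+1)).
  exact: (measurable_funM mI (mreg _)).
- by rewrite mulr_ge0.
- move: (sample_point S t) => z; rewrite indicE.
  have [z0|z0] := eqVneq (slope_path z) 0.
    rewrite memNset/=; last by rewrite z0 eqxx.
    rewrite z0 normr0 invr0 expr0n/=; under eq_fun do rewrite mul0r; exact: cvg_cst.
  rewrite mem_set//=; under eq_fun do rewrite mul1r.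
  apply: (@continuous_cvg _ _ _ _ _ (fun n : nat => (`|slope_path z| + n.+1%:R^-1)^-1) (fun y : R => y ^+ k.+1)).
    exact: exprn_continuous.
  apply: cvgV; first by rewrite normr_eq0.
  rewrite -[X in _ --> X]addr0; apply: cvgD; [exact: cvg_cst|exact: cvg_harmonic].
- apply: le_trans (HM _ (n0 n)).
  apply: (integral_real_le P measurableT) => //.
  + apply: (measurable_at_sample S (g := fun z => steep z * (`|slope_path z| + n.+1%:R^-1)^-1 ^+ k.+1)).
    exact: (measurable_funM mI (mreg _)).
  + exact: (measurable_at_sample S (mreg _)).
  + by move=> t _; rewrite indicE; case: (_ \in _); rewrite ?mul1r ?mul0r.
Qed.
End derivatives.

Definition score (u : R) : R := derive1 (rho1 S) u / rho1 S u.

Lemma score_moment (k : nat) : assumptionD S -> (0 < k)%N ->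
  exists2 M : R, 0 <= M & (ES (fun z => `|score z.1| ^+ k) <= M%:E)%E.
Proof.
move=> [rP HD] k0; have rho0 u : 0 < rho1 S u by case: (rP u).
have dr u : derivable (rho1 S) u 1 by case: (rP u).
have k1 : 1 <= k%:R :> R by rewrite ler1n.
have := HD _ k1; set I := (\int[mu]_u _)%E => Ifin.
have mscore : measurable_fun setT score.
  apply: measurable_funM; first exact: measurable_derive1.
  by apply: measurable_inv; exact: rho1_measurable.
have mabs : measurable_fun setT (fun u => `|score u|) by exact: measurable_abs.
have I0 : (0 <= I)%E.
  by apply: integral_real_ge0 => u; rewrite mulr_ge0 ?powR_ge0// ltW.
exists (fine I); first exact: fine_ge0.
rewrite fineK ?ge0_fin_numE//.
have mg : measurable_fun setT (fun z : R * Omega => `|score z.1| ^+ k).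
  by apply: measurable_funX; exact: (measurableT_comp mabs measurable_fst).
rewrite (expectation_path hS mg) => [|z]; last by rewrite exprn_ge0.
rewrite (eq_integral (fun=> (\int[mu]_u (`|score u| ^+ k * rho1 S u)%:E)%E))//.
pose J := (\int[mu]_u (`|score u| ^+ k * rho1 S u)%:E)%E.
rewrite -[X in (X <= _)%E]/(\int[P]_(t in setT) (cst J t))%E integral_cst//.
have J0 : (0 <= J)%E.
  by apply: integral_real_ge0 => u; rewrite mulr_ge0 ?exprn_ge0// ltW.
apply: (@le_trans _ _ J).
  by rewrite -[leRHS]mule1; apply: lee_wpmul2l => //; exact: probability_le1.
apply: (integral_real_le mu measurableT).
- by apply: measurable_funM; [exact: measurable_funX|exact: rho1_measurable].
- apply: measurable_funM; last exact: rho1_measurable.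
  apply: (measurableT_comp (@measurable_powR R k%:R)).
  exact: measurable_funD.
- by move=> u; rewrite mulr_ge0 ?exprn_ge0// ltW.
- move=> u _; rewrite powR_mulrn ?addr_ge0//; apply: ler_wpM2r; first exact: ltW.
  by rewrite lerXn2r ?nnegrE ?addr_ge0// lerDr.
Qed.
End setting.

(** * The rate of convergence of the smoothed indicators *)

Section setting.
Context (R : realType) (d : nat) (dT dE : measure_display)
  (T : measurableType dT) (P : probability T R) (E : measurableType dE).
Variable S : setting d P E.
Hypothesis hS : standing S.
Let W : measurableType _ := d.-1.-tuple R.
Local Notation Omega := (path_space W E).
Local Notation mu := (@lebesgue_measure R).
Local Notation ES g := (\int[P]_t (g (sample_point S t))%:E)%E.

Lemma weighted_gap_le (g1 g2 : R * Omega -> R) (v : Omega) (N : R) :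
  measurable_fun setT g1 -> (forall z, 0 <= g1 z <= 1) ->
  measurable_fun setT g2 -> (forall z, 0 <= g2 z <= 1) ->
  (\int[mu]_u (`|g1 (u, v) - g2 (u, v)| * rho1 S u)%:E <= N%:E)%E ->
  `|weighted S g1 v - weighted S g2 v| <= N.
Proof.
wlog le12 : g1 g2 / weighted S g2 v <= weighted S g1 v => [wl|m1 b1 m2 b2 gap].
  move=> m1 b1 m2 b2 gap; have [le|/ltW le] := leP (weighted S g2 v) (weighted S g1 v).
    exact: wl.
  rewrite distrC; apply: wl => //; apply: le_trans gap.
  by apply: eq_leW; apply: eq_integral => u _; rewrite distrC.
rewrite ger0_norm ?subr_ge0// lerBlDl -lee_fin EFinD.
rewrite -(weighted_integral hS m1 b1) -(weighted_integral hS m2 b2).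
have mr := rho1_measurable hS; have r0 := rho1_ge0 hS.
have m1v := measurable_section v m1; have m2v := measurable_section v m2.
have m1r : measurable_fun setT (fun u => g1 (u, v) * rho1 S u) by exact: measurable_funM.
have m2r : measurable_fun setT (fun u => g2 (u, v) * rho1 S u) by exact: measurable_funM.
have mgap : measurable_fun setT (fun u => `|g1 (u, v) - g2 (u, v)| * rho1 S u).
  apply: measurable_funM => //; apply: measurable_abs.
  exact: measurable_funB.
have g20 u : 0 <= g2 (u, v) * rho1 S u by rewrite mulr_ge0//; case/andP: (b2 (u, v)).
have g10 u : 0 <= g1 (u, v) * rho1 S u by rewrite mulr_ge0//; case/andP: (b1 (u, v)).
have gap0 u : 0 <= `|g1 (u, v) - g2 (u, v)| * rho1 S u by rewrite mulr_ge0.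
apply: (@le_trans _ _ (\int[mu]_u (g2 (u, v) * rho1 S u + `|g1 (u, v) - g2 (u, v)| * rho1 S u)%:E)%E).
  apply: (integral_real_le mu measurableT) => //.
    exact: measurable_funD.
  move=> u _; rewrite -mulrDl; apply: ler_wpM2r => //.
  by rewrite addrC -lerBlDr; exact: ler_norm.
rewrite (integral_realD mu measurableT m2r mgap g20 gap0).
by apply: leeD.
Qed.

(** Its integral over omega1 bounds R^4 / 4, where R is the bound of the
    density of phi(., omega_(-1)) given by [density_comp_le]. *)
Definition regularity (z : R * Omega) : R :=
  `|score S z.1| ^+ 8 + (`|slope_path S z|^-1) ^+ 8 +
  `|curvature_path S z| ^+ 8 + (`|slope_path S z|^-1) ^+ 16.

(** Large only where phi is within O(1 / sqrt(m)) of the threshold or where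
    the error is large. *)
Definition near_threshold (m : nat) (z : R * Omega) : R :=
  (1 + `|scaled_path S m z|) ^+ 4 * (1 + (Num.sqrt m%:R * (phi_path S z - thr S)) ^+ 2)^-1.

Hypotheses (hA : assumptionA S) (hB : assumptionB S) (hC : assumptionC S) (hD : assumptionD S).

Let rho_gt0 u : 0 < rho1 S u. Proof. by case: hD => h _; case: (h u). Qed.
Let rho_derivable u : derivable (rho1 S) u 1. Proof. by case: hD => h _; case: (h u). Qed.
Let cr : continuous (rho1 S). Proof. exact: derivable1_continuous. Qed.
Let mslope := measurable_slope_path hS hB.
Let mcurv := measurable_curvature_path hS hB.

Let mscore : measurable_fun setT (score S).
Proof.
apply: measurable_funM; first exact: measurable_derive1.
by apply: measurable_inv; exact: rho1_measurable.
Qed.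

Let mscore1 : measurable_fun setT (fun z : R * Omega => score S z.1).
Proof. exact: (measurableT_comp mscore measurable_fst). Qed.

Lemma regularity_ge0 z : 0 <= regularity z.
Proof. by rewrite /regularity !addr_ge0// exprn_ge0// invr_ge0. Qed.

Let mreg1 : measurable_fun setT (fun z => `|score S z.1| ^+ 8 + (`|slope_path S z|^-1) ^+ 8).
Proof.
by apply: measurable_funD; apply: measurable_funX; [exact: measurable_abs|exact: measurable_inv (measurable_abs mslope)].
Qed.
Let mreg2 : measurable_fun setT (fun z => `|score S z.1| ^+ 8 + (`|slope_path S z|^-1) ^+ 8 + `|curvature_path S z| ^+ 8).
Proof.
by apply: measurable_funD => //; apply: measurable_funX; exact: measurable_abs.
Qed.

Lemma measurable_regularity : measurable_fun setT regularity.
Proof.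
by apply: measurable_funD => //; apply: measurable_funX; exact: measurable_inv (measurable_abs mslope).
Qed.

Lemma regularity_moment : exists2 M : R, 0 <= M & (ES regularity <= M%:E)%E.
Proof.
have [M1 M10 HM1] := score_moment hS hD (isT : (0 < 8)%N).
have [M2 M20 HM2] := inverse_slope_moment hS hB hA hC rho_gt0 cr 7.
have [M3 M30 HM3] := curvature_moment hS hB 8.
have [M4 M40 HM4] := inverse_slope_moment hS hB hA hC rho_gt0 cr 15.
exists (M1 + M2 + M3 + M4); first by rewrite !addr_ge0.
have m1 : measurable_fun setT (fun z : R * Omega => `|score S z.1| ^+ 8) by apply: measurable_funX; exact: measurable_abs.
have m2 : measurable_fun setT (fun z => (`|slope_path S z|^-1) ^+ 8) by apply: measurable_funX; exact: measurable_inv (measurable_abs mslope).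
have m3 : measurable_fun setT (fun z => `|curvature_path S z| ^+ 8) by apply: measurable_funX; exact: measurable_abs.
have m4 : measurable_fun setT (fun z => (`|slope_path S z|^-1) ^+ 16) by apply: measurable_funX; exact: measurable_inv (measurable_abs mslope).
have i0 z n : 0 <= (`|slope_path S z|^-1) ^+ n by rewrite exprn_ge0// invr_ge0.
rewrite /regularity.
rewrite (integral_realD P measurableT (measurable_at_sample S mreg2) (measurable_at_sample S m4)) => [|t|t //]; last by rewrite !addr_ge0// exprn_ge0.
rewrite (integral_realD P measurableT (measurable_at_sample S mreg1) (measurable_at_sample S m3)) => [|t|t]; last 2 first.
- by rewrite addr_ge0// exprn_ge0.
- by rewrite exprn_ge0.
rewrite (integral_realD P measurableT (measurable_at_sample S m1) (measurable_at_sample S m2)) => [|t|t //]; last by rewrite exprn_ge0.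
rewrite !EFinD; apply: leeD => //; apply: leeD => //; exact: leeD.
Qed.

Lemma near_threshold_ge0 m z : 0 <= near_threshold m z.
Proof.
by rewrite mulr_ge0 ?exprn_ge0 ?addr_ge0// invr_ge0 addr_ge0// sqr_ge0.
Qed.

Let mkernel (s : R) : measurable_fun setT (fun x : R => (1 + (s * (x - thr S)) ^+ 2)^-1).
Proof.
apply: measurable_inv; apply: measurable_funD => //.
by apply: measurable_funX; apply: measurable_funM => //; exact: measurable_funB.
Qed.

Lemma measurable_near_threshold m : measurable_fun setT (near_threshold m).
Proof.
apply: measurable_funM; last exact: (measurableT_comp (mkernel _) (measurable_phi_path hS)).
apply: measurable_funX; apply: measurable_funD => //; apply: measurable_abs.
exact: measurable_scaled_path.
Qed.

(** By [scaled_error_moment] with a Cauchy kernel of width 1 / sqrt(m). *)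
Lemma near_threshold_moment : exists2 M : R, 0 <= M & forall m, (0 < m)%N ->
  (ES (near_threshold m) <= (M / Num.sqrt m%:R)%:E)%E.
Proof.
have [K K0 HK] := scaled_error_moment hS hA.
exists (K * pi) => [|m m0]; first by rewrite mulr_ge0// pi_ge0.
have s0 : 0 < Num.sqrt m%:R :> R by rewrite sqrtr_gt0 ltr0n.
apply: (le_trans (HK m m0 _ (mkernel (Num.sqrt m%:R)) _)).
  by move=> x; rewrite invr_ge0 addr_ge0// sqr_ge0.
rewrite -mulrA EFinM; apply: lee_wpmul2l; first by rewrite lee_fin.
exact: integral_cauchy_le.
Qed.

(** 8 (4 pi)^2, from [balance_le] with k = 4 pi / sqrt(m). *)
Definition gap_constant : R := 128 * pi ^+ 2.

(** [indicator_gap_le] integrated over omega1. Its first term is a Cauchy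
    kernel of width t / sqrt(m), with integral at most 2 B pi t / sqrt(m) by
    [density_comp_le]; its second term integrates to Y / t^2. Then
    [balance_le] and [cube_le_sqr] remove t, the powers of sqrt(m) being shared
    between B^2 and Y so that the final bound is linear in B^4 and Y. *)
Lemma smoothed_gap_path m (v : Omega) (j Y : R) : (0 < m)%N -> 0 <= j -> 0 <= Y ->
  (\int[mu]_u (regularity (u, v) * rho1 S u)%:E <= j%:E)%E ->
  (\int[mu]_u (near_threshold m (u, v) * rho1 S u)%:E <= Y%:E)%E ->
  {ae mu, forall u, slope_path S (u, v) != 0} ->
  (smoothed S m v - smoothed_limit S v) ^+ 2 <=
    (gap_constant + 1) * (4 * j / m%:R + Y / Num.sqrt m%:R).
Proof.
move=> m0 j0 Y0 regj nearY slope0.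
have s0 : 0 < Num.sqrt m%:R :> R by rewrite sqrtr_gt0 ltr0n.
set s := Num.sqrt m%:R in s0 *.
have r0 := rho1_ge0 hS; have mr := rho1_measurable hS.
pose f u := phi_path S (u, v).
pose q u := `|slope_path S (u, v)|^-1.
pose X u := `|score S u| * q u + `|curvature_path S (u, v)| * q u ^+ 2.
have q0 u : 0 <= q u by rewrite invr_ge0.
have mq : measurable_fun setT q by exact: (measurable_section v (measurable_inv (measurable_abs mslope))).
have mcv : measurable_fun setT (fun u => `|curvature_path S (u, v)|) by exact: (measurable_section v (measurable_abs mcurv)).
have mX : measurable_fun setT X.
  apply: measurable_funD; apply: measurable_funM => //.
    exact: (measurable_abs mscore).
  exact: measurable_funX.
have X0 u : 0 <= X u by rewrite addr_ge0// mulr_ge0// exprn_ge0.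
have mregv := measurable_section v measurable_regularity.
have regv0 u : 0 <= regularity (u, v) * rho1 S u by rewrite mulr_ge0// regularity_ge0.
have mregr : measurable_fun setT (fun u => regularity (u, v) * rho1 S u) by exact: measurable_funM.
have X4 : (\int[mu]_u (rho1 S u * X u ^+ 4)%:E <= (4 * j)%:E)%E.
  apply: (@le_trans _ _ (\int[mu]_u (4 * (regularity (u, v) * rho1 S u))%:E)%E).
    apply: (integral_real_le mu measurableT).
    - by apply: measurable_funM => //; exact: measurable_funX.
    - exact: measurable_funM.
    - by move=> u; rewrite mulr_ge0// exprn_ge0.
    - move=> u _; rewrite mulrA [leLHS]mulrC; apply: ler_wpM2r => //.
      exact: fourth_power_sum_le.
  rewrite (integral_realZ mu measurableT mregr regv0)// EFinM.
  by apply: lee_wpmul2l.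
have [B [B0 XB B4]] := fourth_moment_ge mr mX r0 X0 (integral_rho1 hS) (le_lt_trans X4 (ltry _)).
have B4j : B ^+ 4 <= 4 * j by rewrite -lee_fin; exact: le_trans X4.
have rq : (\int[mu]_u (rho1 S u / `|derive1 f u|)%:E < +oo)%E.
  apply: (@le_lt_trans _ _ (\int[mu]_u (rho1 S u + regularity (u, v) * rho1 S u)%:E)%E).
    apply: (integral_real_le mu measurableT).
    - by apply: measurable_funM => //; exact: mq.
    - exact: measurable_funD.
    - by move=> u; exact: (mulr_ge0 (r0 u) (q0 u)).
    - move=> u _; suff qreg : q u <= 1 + regularity (u, v).
        have -> : rho1 S u + regularity (u, v) * rho1 S u = rho1 S u * (1 + regularity (u, v)) by ring.
        by apply: ler_wpM2l.
      apply: (@le_trans _ _ (1 + q u ^+ 8)).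
        have [q1|q1] := leP (q u) 1; first by apply: (le_trans q1); rewrite lerDl exprn_ge0.
        apply: (@le_trans _ _ (q u ^+ 8)); last by rewrite lerDr.
        by rewrite -[leLHS]expr1; apply: ler_weXn2l => //; exact: ltW.
      rewrite lerD2l /regularity -/(q u).
      have := exprn_ge0 8 (normr_ge0 (score S u)).
      have := exprn_ge0 8 (normr_ge0 (curvature_path S (u, v))).
      by have := exprn_ge0 16 (q0 u); rewrite /=; lra.
  rewrite (integral_realD mu measurableT mr mregr r0 regv0) integral_rho1//.
  by apply: (@le_lt_trans _ _ (1 + j%:E)%E); [exact: leeD2l|rewrite -EFinD ltry].
have cauchy a : 0 < a ->
    (\int[mu]_u (rho1 S u / (1 + (a * (f u - thr S)) ^+ 2))%:E <= (2 * B * (pi / a))%:E)%E.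
  move=> a0; apply: density_comp_le => //.
  - move=> u; have [df _ _ _] := hB; exact: (df u v.1).
  - rewrite -XB; apply: eq_leW; apply: eq_integral => u _.
    congr (_ * (_ + _))%:E.
    by rewrite /q exprVn real_normK ?num_real.
pose H := `|smoothed S m v - smoothed_limit S v|.
have Hle t : 0 < t -> H <= 4 * pi / s * B * t + Y / t ^+ 2.
  move=> t0.
  have kt0 u : 0 <= (1 + (s / t * (f u - thr S)) ^+ 2)^-1 by rewrite invr_ge0 addr_ge0// sqr_ge0.
  apply: weighted_gap_le.
  - by apply: measurable_gt_indicator; exact: measurable_phihat.
  - by move=> z; rewrite /ghat; case: ifP => _; rewrite ?lexx ?ler01.
  - by apply: measurable_gt_indicator; exact: measurable_phi_path.
  - by move=> z; case: ifP => _; rewrite ?lexx ?ler01.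
  have mf : measurable_fun setT f by exact: (measurable_section v (measurable_phi_path hS)).
  have mk : measurable_fun setT (fun u => rho1 S u * (1 + (s / t * (f u - thr S)) ^+ 2)^-1).
    by apply: measurable_funM => //; exact: (measurableT_comp (mkernel (s / t)) mf).
  have mn : measurable_fun setT (fun u => near_threshold m (u, v) * rho1 S u).
    by apply: measurable_funM => //; exact: (measurable_section v (measurable_near_threshold m)).
  have k0 u : 0 <= rho1 S u * (1 + (s / t * (f u - thr S)) ^+ 2)^-1 by rewrite mulr_ge0.
  have n0 u : 0 <= near_threshold m (u, v) * rho1 S u by rewrite mulr_ge0// near_threshold_ge0.
  have m2k : measurable_fun setT (fun u => 2 * (rho1 S u * (1 + (s / t * (f u - thr S)) ^+ 2)^-1)) by exact: measurable_funM.
  have mtn : measurable_fun setT (fun u => (t ^+ 2)^-1 * (near_threshold m (u, v) * rho1 S u)) by exact: measurable_funM.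
  have t20 : 0 <= (t ^+ 2)^-1 by rewrite invr_ge0 sqr_ge0.
  apply: (@le_trans _ _ (\int[mu]_u (2 * (rho1 S u * (1 + (s / t * (f u - thr S)) ^+ 2)^-1) +
      (t ^+ 2)^-1 * (near_threshold m (u, v) * rho1 S u))%:E)%E).
    apply: (integral_real_le mu measurableT).
    - apply: measurable_funM => //; apply: measurable_abs.
      apply: measurable_funB.
        apply: (measurable_section v (g := fun z => ghat S m (z.1, z.2.1) z.2.2)).
        by apply: measurable_gt_indicator; exact: measurable_phihat.
      by apply: (measurable_section v (g := fun z => if thr S < phi S (z.1, z.2.1) then 1 else 0)); apply: measurable_gt_indicator; exact: measurable_phi_path.
    - exact: measurable_funD.
    - by move=> u; rewrite mulr_ge0.
    - move=> u _.
      have := indicator_gap_le (f u) (phihat S m (u, v.1) v.2) (thr S) s0 t0.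
      move=> /(ler_wpM2r (r0 u)) /le_trans; apply.
      apply: eq_leW.
      rewrite /near_threshold /scaled_path -/s -/(f u); ring.
  rewrite (integral_realD mu measurableT m2k mtn) => [|u|u]; last 2 first.
  - by rewrite mulr_ge0.
  - by rewrite mulr_ge0.
  rewrite (integral_realZ mu measurableT mk k0)// (integral_realZ mu measurableT mn n0 t20).
  rewrite [leRHS]EFinD; apply: leeD.
    rewrite (_ : 4 * pi / s * B * t = 2 * (2 * B * (pi / (s / t)))); last first.
      by field; rewrite !gt_eqF.
    rewrite [leRHS]EFinM; apply: lee_wpmul2l => //; apply: cauchy.
    exact: divr_gt0.
  by rewrite [Y / _]mulrC [leRHS]EFinM; apply: lee_wpmul2l.
have H0 : 0 <= H by exact: normr_ge0.
have k0 : 0 <= 4 * pi / s by rewrite divr_ge0 ?(ltW s0)// mulr_ge0// pi_ge0.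
have H3 := balance_le H0 B0 Y0 k0 Hle.
have b0 : 0 <= B ^+ 2 / s by rewrite divr_ge0 ?sqr_ge0 ?(ltW s0).
have y0 : 0 <= Y / s by rewrite divr_ge0 ?(ltW s0).
have kk0 : 0 <= gap_constant by rewrite mulr_ge0// sqr_ge0.
have H3' : H ^+ 3 <= gap_constant * (B ^+ 2 / s) * (Y / s).
  apply: (le_trans H3); apply: eq_leW.
  by rewrite /gap_constant; field; rewrite gt_eqF.
have := cube_le_sqr H0 b0 y0 kk0 H3'.
rewrite /H real_normK ?num_real// => /le_trans; apply.
apply: ler_wpM2l; first by rewrite addr_ge0.
rewrite lerD2r exprMn exprVn sqr_sqrtr ?ler0n// -exprM.
by apply: ler_wpM2r.
Qed.

Local Notation flat := (\1_[set z | slope_path S z = 0] : R * Omega -> R).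

(** [smoothed_gap_path] holds for almost every path, and both terms of its
    bound have mean O(1/m). *)
Lemma smoothing_rate_exists : exists2 K : R, 0 <= K & smoothing_rate S K.
Proof.
have [M1 M10 HM1] := regularity_moment.
have [M2 M20 HM2] := near_threshold_moment.
have k0 : 0 <= gap_constant + 1 by rewrite addr_ge0// mulr_ge0// sqr_ge0.
exists ((gap_constant + 1) * (4 * M1 + M2)).
  by apply: mulr_ge0 => //; rewrite addr_ge0// mulr_ge0.
move=> m m0; set K := (X in _ <= X).
have s0 : 0 < Num.sqrt m%:R :> R by rewrite sqrtr_gt0 ltr0n.
pose J t := (\int[mu]_u (regularity (u, base_path S t) * rho1 S u)%:E)%E.
pose Y t := (\int[mu]_u (near_threshold m (u, base_path S t) * rho1 S u)%:E)%E.
have mJ : measurable_fun setT J := measurable_path_integral hS measurable_regularity regularity_ge0.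
have mY : measurable_fun setT Y := measurable_path_integral hS (measurable_near_threshold m) (near_threshold_ge0 m).
have J0 t : (0 <= J t)%E by apply: integral_real_ge0 => u; rewrite mulr_ge0 ?(rho1_ge0 hS)// regularity_ge0.
have Y0 t : (0 <= Y t)%E by apply: integral_real_ge0 => u; rewrite mulr_ge0 ?(rho1_ge0 hS)// near_threshold_ge0.
have IJ : (\int[P]_t J t <= M1%:E)%E.
  by rewrite -(expectation_path hS measurable_regularity regularity_ge0).
have IY : (\int[P]_t Y t <= (M2 / Num.sqrt m%:R)%:E)%E.
  by rewrite -(expectation_path hS (measurable_near_threshold m) (near_threshold_ge0 m)); exact: HM2.
have fin (G : T -> \bar R) (M : R) : measurable_fun setT G -> (forall t, 0 <= G t)%E ->
    (\int[P]_t G t <= M%:E)%E -> {ae P, forall t, G t \is a fin_num}.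
  move=> mG G0 IG.
  have iG : P.-integrable setT G.
    apply/integrableP; split => //; under eq_integral do rewrite gee0_abs//.
    exact: le_lt_trans IG (ltry _).
  by apply: filterS (integrable_ae measurableT iG) => t; apply.
have aeS : {ae P, forall t, {ae mu, forall u, slope_path S (u, base_path S t) != 0}}.
  have mZ : measurable [set z | slope_path S z = 0].
    rewrite -[X in measurable X]setTI.
    exact: (mslope measurableT (measurable_set1 0)).
  have mI : measurable_fun setT flat by exact: measurable_indic.
  have I0 z : 0 <= flat z by [].
  have := slope_neq0_as hS hB hA hC rho_gt0 cr.
  rewrite (expectation_path hS mI I0) => int0.
  have mF := measurable_path_integral hS mI I0.
  have F0 t : (0 <= \int[mu]_u (flat (u, base_path S t) * rho1 S u)%:E)%E.
    by apply: integral_real_ge0 => u; rewrite mulr_ge0// (rho1_ge0 hS).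
  have : ae_eq P setT (fun t => \int[mu]_u (flat (u, base_path S t) * rho1 S u)%:E)%E (cst 0%E).
    apply: (ae_eq_integral_abs P measurableT mF).1.
    by under eq_integral do rewrite gee0_abs//.
  apply: filterS => t /(_ I) /= int0t.
  have mIr : measurable_fun setT (fun u => (flat (u, base_path S t) * rho1 S u)%:E).
    apply/measurable_EFinP; apply: measurable_funM; last exact: rho1_measurable.
    exact: (measurable_section (base_path S t) mI).
  have : ae_eq mu setT (fun u => (flat (u, base_path S t) * rho1 S u)%:E) (cst 0%E).
    apply: (@ae_eq_integral_abs _ (measurableTypeR R) R lebesgue_measure _ measurableT _ mIr).1.
    by under eq_integral do rewrite gee0_abs ?lee_fin ?mulr_ge0 ?(rho1_ge0 hS)//.
  apply: ae_imply => u /(_ I) /= H; apply/eqP => s00; move: H.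
  rewrite indicE mem_set// mul1r => -[ru0].
  by have := rho_gt0 u; rewrite ru0 ltxx.
pose gap t := smoothed S m (base_path S t) - smoothed_limit S (base_path S t).
have ms : measurable_fun setT (fun t => smoothed S m (base_path S t)).
  exact: (measurableT_comp (measurable_smoothed hS m) (measurable_base_path S)).
have ml : measurable_fun setT (fun t => smoothed_limit S (base_path S t)).
  exact: (measurableT_comp (measurable_smoothed_limit hS) (measurable_base_path S)).
have mH : measurable_fun setT (fun t => (gap t ^+ 2)%:E).
  by apply/measurable_EFinP; apply: measurable_funX; exact: measurable_funB.
suff main : (\int[P]_t (gap t ^+ 2)%:E <= K%:E)%E.
  rewrite -lee_fin /Rintegral fineK// ge0_fin_numE; first exact: le_lt_trans main (ltry _).
  by apply: integral_real_ge0 => t; exact: sqr_ge0.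
have pc0 : (0 <= (gap_constant + 1)%:E)%E by rewrite lee_fin.
have mm0 : (0 <= (4 / m%:R : R)%:E)%E by rewrite lee_fin divr_ge0.
have ss0 : (0 <= ((Num.sqrt m%:R)^-1 : R)%:E)%E by rewrite lee_fin invr_ge0 ltW.
pose G t := ((gap_constant + 1)%:E * ((4 / m%:R : R)%:E * J t + ((Num.sqrt m%:R)^-1 : R)%:E * Y t))%E.
have mG1 : measurable_fun setT (fun t => (4 / m%:R : R)%:E * J t)%E by exact: measurable_funeM.
have mG2 : measurable_fun setT (fun t => ((Num.sqrt m%:R)^-1 : R)%:E * Y t)%E by exact: measurable_funeM.
have mG12 : measurable_fun setT (fun t => (4 / m%:R : R)%:E * J t + ((Num.sqrt m%:R)^-1 : R)%:E * Y t)%E by exact: emeasurable_funD.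
have mG : measurable_fun setT G by exact: measurable_funeM.
have G12 t : (0 <= (4 / m%:R : R)%:E * J t + ((Num.sqrt m%:R)^-1 : R)%:E * Y t)%E by rewrite adde_ge0// mule_ge0.
apply: (@le_trans _ _ (\int[P]_t G t)%E).
  apply: (ae_ge0_le_integral measurableT _ mH _ mG).
  - by move=> t _; rewrite lee_fin sqr_ge0.
  - by move=> t _; rewrite mule_ge0.
  have aeJ := fin _ _ mJ J0 IJ; have aeY := fin _ _ mY Y0 IY.
  apply: filterS3 aeS aeJ aeY => t st jt yt _.
  have := @smoothed_gap_path m (base_path S t) (fine (J t)) (fine (Y t)) m0
    (fine_ge0 (J0 t)) (fine_ge0 (Y0 t)).
  rewrite !fineK// => /(_ (lexx _) (lexx _) st).
  have lift (a b c x y : R) : (c%:E * (a%:E * x%:E + b%:E * y%:E) = (c * (a * x + b * y))%:E)%E by [].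
  rewrite /G -(fineK jt) -(fineK yt) lift lee_fin => /le_trans; apply.
  by apply: eq_leW; rewrite /=; ring.
rewrite ge0_integralZl// ge0_integralD//; last 2 first.
- by move=> t _; rewrite mule_ge0.
- by move=> t _; rewrite mule_ge0.
rewrite !ge0_integralZl//.
rewrite (_ : K = (gap_constant + 1) * (4 / m%:R * M1 + (Num.sqrt m%:R)^-1 * (M2 / Num.sqrt m%:R))); last first.
  have := sqr_sqrtr (ler0n R m); rewrite /K; move: (Num.sqrt _) s0 => s s0 <-.
  by field; rewrite gt_eqF.
rewrite [leRHS]EFinM; apply: lee_wpmul2l => //.
rewrite [leRHS]EFinD; apply: leeD; rewrite [leRHS]EFinM; exact: lee_wpmul2l.
Qed.
End setting.

(** * Complexity *)

Theorem corollary1 (R : realType) (d : nat) (hd : (0 < d)%N)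
    (dT dE : measure_display) (T : measurableType dT) (P : probability T R)
    (E : measurableType dE) (S : setting d P E) (hS : standing S)
    (hA : assumptionA S) (hB : assumptionB S)
    (hC : assumptionC S) (hD : assumptionD S) :
  (forall (V : numerical_scheme R d) (s kappa : R),
     simple_root_or_positive S -> newton_approximation S V ->
     0 < s -> preintegration_error S V s -> 0 < kappa ->
     complexity_bigO (complexity_num S V kappa)
       (fun TOL => TOL `^ (- 2 - 2 / s) * (ln TOL) ^+ 2)) /\
  (forall kappa : R, 0 < kappa ->
     complexity_bigO (complexity_exact S kappa)
       (fun TOL => TOL `^ (- 2) * (ln TOL) ^+ 2)).
Proof.
have [K K0 rate] := smoothing_rate_exists hS hA hB hC hD.
split => [V s kappa _ newton s0 err kappa0|kappa kappa0].
  exact: complexity_num_rate rate newton s0 err kappa0.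
exact: complexity_exact_rate rate kappa0.
Qed.
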